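(* Let $N\ge5$, let $m$ be real with $0\le m<\frac{N-4}{2}$, let $\Omega\subset\mathbb{R}^N$ be a bounded domain containing the origin, and let $D\ge\sup_{x\in\Omega}|x|$. Put $$A=(1+m)^2+\frac{(N+2m)(N-4-2m)}{8}.$$ Then for all $u\in C_0^\infty(\Omega)$ $$\int_\Omega\frac{(\Delta u)^2}{|x|^{2m}}dx\ \ge\ \Big(\frac{(N+2m)(N-4-2m)}{4}\Big)^2\int_\Omega\frac{u^2}{|x|^{2m+4}}dx+A\sum_{i=1}^\infty\int_\Omega\frac{u^2}{|x|^{2m+4}}X_1^2X_2^2\cdots X_i^2\,dx.$$ Moreover, $\big(\frac{(N+2m)(N-4-2m)}{4}\big)^2$ is the best constant (i.e. the largest $C$ such that $\int_\Omega|x|^{-2m}(\Delta u)^2dx\ge C\int_\Omega|x|^{-2m-4}u^2dx$ for all $u\in C_0^\infty(\Omega)$). Similarly, for each $k=1,2,\dots$, the constant $A$ is the best constant for the corresponding $k$-improved Hardy-Rellich inequality, that is, $$A=\inf_{u\in C_0^\infty(\Omega),\,u\ne0}\frac{\displaystyle\int_\Omega\frac{|\Delta u|^2}{|x|^{2m}}dx-\Big(\frac{(N+2m)(N-4-2m)}{4}\Big)^2\int_\Omega\frac{u^2}{|x|^{2m+4}}dx-A\sum_{i=1}^{k-1}\int_\Omega\frac{u^2}{|x|^{2m+4}}X_1^2\cdots X_i^2\,dx}{\displaystyle\int_\Omega\frac{u^2}{|x|^{2m+4}}X_1^2\cdots X_k^2\,dx}.$$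
   Context: $X_1(t)=(1-\log t)^{-1}$ and $X_k(t)=X_1(X_{k-1}(t))$, $k=2,3,\dots$, for $t\in(0,1]$; in the integrals $X_i$ stands for $X_i(|x|/D)$. For $k=1$ the sum $\sum_{i=1}^{k-1}$ is empty. *)

(* Defs.v *)
From HB Require Import structures.
From mathcomp Require Import all_boot all_order all_algebra.
From mathcomp Require Import all_classical all_reals all_analysis.

Set Implicit Arguments.
Unset Strict Implicit.
Unset Printing Implicit Defensive.

Import Order.TTheory GRing.Theory Num.Theory.
Import numFieldNormedType.Exports.

Local Open Scope classical_set_scope.
Local Open Scope ring_scope.

(* R^n is 'rV[R]_n, with its library topology and normed-module structure (the
   norm there is the sup norm; the Euclidean norm is enorm below).  The library
   has no measurable structure on row vectors: we equip 'rV[R]_n with the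
   sigma-algebra generated by the coordinates, i.e. the Borel sets of R^n. *)
Definition measure_rV_display : measure_display.
Proof. exact: default_measure_display. Qed.

Section measurable_rV.
Context {R : realType} (n : nat).

Let coors (i : 'I_n) (x : 'rV[R]_n) : measurableTypeR R := x ord0 i.

Let rV_set0 : g_sigma_preimage coors set0.
Proof. exact: sigma_algebra0. Qed.

Let rV_setC A : g_sigma_preimage coors A -> g_sigma_preimage coors (~` A).
Proof. exact: sigma_algebraC. Qed.

Let rV_bigcup (F : (set 'rV[R]_n)^nat) :
  (forall i, g_sigma_preimage coors (F i)) ->
  g_sigma_preimage coors (\bigcup_i (F i)).
Proof. exact: sigma_algebra_bigcup. Qed.

HB.instance Definition _ := @isMeasurable.Build measure_rV_display
  'rV[R]_n (g_sigma_preimage coors) rV_set0 rV_setC rV_bigcup.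

Lemma measurable_coord (i : 'I_n) :
  measurable_fun setT (fun x : 'rV[R]_n => x ord0 i : measurableTypeR R).
Proof.
move=> _ Y mY; rewrite setTI; apply: sub_sigma_algebra => /=.
rewrite -bigcup_seq/=; exists i => /=; first by rewrite mem_index_enum.
by exists Y => //; rewrite setTI.
Qed.

Lemma measurable_fun_rV d (T : measurableType d) (f : T -> 'rV[R]_n) :
  (forall i, measurable_fun setT (fun t => f t ord0 i : measurableTypeR R)) ->
  measurable_fun setT f.
Proof.
move=> mf.
have sub : g_sigma_preimage (fun i => coors i \o f) `<=` measurable.
  apply: smallest_sub; first exact: sigma_algebra_measurable.
  rewrite -bigcup_seq/= => A [i _] /= [B mB <-].
  exact: mf.
by move: sub; rewrite g_sigma_preimage_comp => sub _ A mA; apply: sub; exists A.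
Qed.

End measurable_rV.

(* n-dimensional Lebesgue measure, as the n-fold product of the library's
   one-dimensional one: R^(n+1) is identified with R * R^n by rV_cons. *)
Section lebesgue_rV.
Context {R : realType}.

Definition rV_cons n (p : measurableTypeR R * 'rV[R]_n) : 'rV[R]_n.+1 :=
  row_mx (const_mx p.1 : 'rV[R]_1) p.2.

Lemma measurable_rV_cons n : measurable_fun setT (@rV_cons n).
Proof.
apply: measurable_fun_rV => i.
have [j ij|j ij] := @split_ordP 1 n i.
  rewrite (_ : (fun _ => _) = fst) //.
  by apply/funext => p; rewrite ij; apply: etrans (row_mxEl _ _ _ _) _; rewrite mxE.
rewrite (_ : (fun _ => _) = (fun x : 'rV[R]_n => x ord0 j) \o snd).
  exact: measurableT_comp (measurable_coord j) measurable_snd.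
by apply/funext => p; rewrite ij; exact: row_mxEr.
Qed.

Section step.
Context n (mu : {sigma_finite_measure set 'rV[R]_n -> \bar R}).

Definition lebesgue_cons : set 'rV[R]_n.+1 -> \bar R :=
  pushforward (lebesgue_measure \x mu)%E (@rV_cons n).

Let lebesgue_cons0 : lebesgue_cons set0 = 0%E.
Proof. by rewrite /lebesgue_cons /pushforward preimage_set0 measure0. Qed.

Let lebesgue_cons_ge0 A : (0 <= lebesgue_cons A)%E.
Proof. by rewrite /lebesgue_cons /pushforward measure_ge0. Qed.

Let lebesgue_cons_sigma_additive : semi_sigma_additive lebesgue_cons.
Proof.
pose mf := isMeasurableFun.Build _ _ _ _ _ (@measurable_rV_cons n).
pose f : {mfun _ >-> _} := HB.pack (@rV_cons n) mf.
exact: (@measure_semi_sigma_additive _ _ _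
  (pushforward (lebesgue_measure \x mu)%E f)).
Qed.

HB.instance Definition _ := isMeasure.Build _ _ _ lebesgue_cons
  lebesgue_cons0 lebesgue_cons_ge0 lebesgue_cons_sigma_additive.

Let lebesgue_cons_sigma_finite : sigma_finite setT lebesgue_cons.
Proof.
have /sigma_finiteP[F [FT ndF Foo]] := sigma_finiteT (@lebesgue_measure R).
have /sigma_finiteP[G [GT ndG Goo]] := sigma_finiteT mu.
pose g (x : 'rV[R]_n.+1) : measurableTypeR R * 'rV[R]_n :=
  (x ord0 ord0, \row_i x ord0 (lift ord0 i)).
have mg : measurable_fun setT g.
  apply/measurable_fun_pairP; split; first exact: measurable_coord.
  apply: measurable_fun_rV => i.
  rewrite (_ : (fun _ => _) = (fun x : 'rV[R]_n.+1 => x ord0 (lift ord0 i))).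
    exact: measurable_coord.
  by apply/funext => x; rewrite /= mxE.
have gK p : g (@rV_cons n p) = p.
  case: p => a x; congr pair.
    rewrite /rV_cons (_ : ord0 = lshift n (ord0 : 'I_1)); last exact/val_inj.
    by apply: etrans (row_mxEl _ _ _ _) _; rewrite mxE.
  apply/rowP => i; rewrite mxE /rV_cons.
  rewrite (_ : lift ord0 i = rshift 1 i); last exact/val_inj.
  exact: row_mxEr.
exists (fun k => g @^-1` (F k `*` G k)).
  rewrite -preimage_bigcup (_ : \bigcup_k _ = setT) ?preimage_setT//.
  rewrite -subTset => -[x y] _.
  have [k _ Fx] : (\bigcup_k F k) x by rewrite -FT.
  have [l _ Gy] : (\bigcup_k G k) y by rewrite -GT.
  exists (maxn k l) => //; split.
    by move: x Fx; exact/subsetPset/ndF/leq_maxl.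
  by move: y Gy; exact/subsetPset/ndG/leq_maxr.
move=> k; have [mF Fk] := Foo k; have [mG Gk] := Goo k; split.
  by rewrite -[X in measurable X]setTI; apply: mg => //; exact: measurableX.
rewrite /lebesgue_cons /pushforward -comp_preimage (_ : g \o _ = id).
  by rewrite /= product_measure1E// lte_mul_pinfty// ge0_fin_numE.
by apply/funext => p /=; rewrite gK.
Qed.

HB.instance Definition _ := Measure_isSigmaFinite.Build _ _ _ lebesgue_cons
  lebesgue_cons_sigma_finite.

End step.

Fixpoint lebesgue_rV n : {sigma_finite_measure set 'rV[R]_n -> \bar R} :=
  match n with
  | 0 => dirac (0 : 'rV[R]_0)
  | n'.+1 => lebesgue_cons (lebesgue_rV n')
  end.

End lebesgue_rV.

Section hardy_rellich.
Context {R : realType} (N : nat).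
Implicit Types (u : 'rV[R]_N -> R) (x : 'rV[R]_N) (Omega : set 'rV[R]_N).

Definition enorm x : R := Num.sqrt (\sum_(i < N) x ord0 i ^+ 2).

Definition partial (i : 'I_N) u : 'rV[R]_N -> R :=
  fun x => 'D_(delta_mx ord0 i) u x.

Definition iter_partial (s : seq 'I_N) u : 'rV[R]_N -> R := foldr partial u s.

(* 'D_v f x is a total function, with a default value where the derivative does
   not exist, so existence has to be required explicitly. *)
Definition smooth u : Prop :=
  forall s : seq 'I_N, continuous (iter_partial s u) /\
    forall (i : 'I_N) x, derivable (iter_partial s u) x (delta_mx ord0 i).

(* C_0^oo(Omega): its elements are extended by 0 to the whole of R^N. *)
Definition test_function Omega u : Prop :=
  [/\ smooth u, compact (closure [set x | u x != 0])
    & closure [set x | u x != 0] `<=` Omega].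

Definition laplacian u x : R := \sum_(i < N) partial i (partial i u) x.

Definition X1 (t : R) : R := (1 - ln t)^-1.

(* Meant for k >= 1; the value at k = 0 is never used. *)
Definition X (k : nat) (t : R) : R := iter k X1 t.

Local Open Scope ereal_scope.

(* At the single point x = 0, which is negligible, the integrands below take
   the value given by the conventions for 0 `^ a, 0^-1 and ln 0. *)
Definition rellich_int (m : R) Omega u : \bar R :=
  \int[lebesgue_rV N]_(x in Omega)
    (laplacian u x ^+ 2 / enorm x `^ (2 * m))%R%:E.

Definition hardy_int (m : R) Omega u : \bar R :=
  \int[lebesgue_rV N]_(x in Omega) (u x ^+ 2 / enorm x `^ (2 * m + 4))%R%:E.

Definition hardy_log_int (m D : R) (i : nat) Omega u : \bar R :=
  \int[lebesgue_rV N]_(x in Omega)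
    (u x ^+ 2 / enorm x `^ (2 * m + 4) *
     \prod_(1 <= j < i.+1) X j (enorm x / D) ^+ 2)%R%:E.

End hardy_rellich.

(* Main.v *)
(* Let a = (N-4-2m)/2, kap = (N+2m)(N-4-2m)/4, e = x.grad u + a u and
   Z = |x|^2 Delta u + kap u - 2(1+m) e.  The Pohozaev identity gives
   int |x|^(-2m-4) Z e = 0; with an integration by parts in int |x|^(-2m-2) u Delta u,
     int |x|^(-2m) (Delta u)^2 = kap^2 int |x|^(-2m-4) u^2 + 4A int |x|^(-2m-4) e^2
       + int |x|^(-2m-4) Z^2 + 2kap int |x|^(-2m-4) (|x|^2 |grad u|^2 - (x.grad u)^2).
   Put P_j = X_1 ... X_j and S = P_1 + ... + P_k.  The derivative of S in ln |x| is
   (S^2 + P_1^2 + ... + P_k^2)/2, so that completing the square turns the one-dimensional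
   Hardy inequality into
     int |x|^(-2m-4) e^2 = (1/4) sum_(j <= k) int |x|^(-2m-4) u^2 P_j^2
       + int |x|^(-2m-4) (e + S u / 2)^2.
   All remainders are nonnegative.  They are negligible for
   u = |x|^(-a) P_k^(-1/2) chi(-ln X_k / n - 1), n -> oo, with chi a bump on [0, 1]. *)

Require Import Defs.
From mathcomp Require Import all_boot all_order all_algebra.
From mathcomp Require Import all_classical all_reals all_analysis.
From mathcomp Require Import measurable_realfun.
From mathcomp Require Import ring lra.

Import Order.TTheory GRing.Theory Num.Theory.
Import numFieldNormedType.Exports.

Local Open Scope classical_set_scope.
Local Open Scope ring_scope.

(** * Integration over row vectors *)

(** On a radial u = |x|^(-a) w(ln |x|) the measure |x|^(-2m-4-2a) dx is dt, t = ln |x|, times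
    surface measure on the sphere, while e and Z become |x|^(-a) w' and |x|^(-a) w''. Hence the
    choice of a, kap and 2(1+m) = N-2-2a, and the orthogonality of Z and e: w' w'' is a derivative.
    The weight is singular at the origin and u need not vanish there. Every integration by parts is
    therefore the divergence of a field |x|^(-p) (|x|^2 V + b x), integrated along lines parallel to
    an axis. The line that meets the origin lies in a null hyperplane, so no cut-off is needed. The
    identity holds for each finite k, and the series is reached through its partial sums. Along the
    minimising family the remainders must be compared with the integral of u^2 P_k^2. Apart from the
    term in |grad u|, which vanishes for radial u, they equal or are bounded by multiples of
    integrals of |x|^(-p-2a) P_k psi(s), s being the argument of the bump, and such integrals are
    proportional to that of psi. This is obtained by writing a difference of two of them as a
    divergence, not from polar coordinates. *)

Section derivation_rules.
Context {R : realType} {V : normedModType R}.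
Set Implicit Arguments. Unset Strict Implicit.
Implicit Types (f g : V -> R) (x v : V).

(** Both difference quotients are the same function of [h]. Through this equivalence the
    one-variable theorems act on directional derivatives, the only derivatives in use. *)
Lemma is_derive_line f x v t (d : R) :
  is_derive (t : R) 1 (fun s : R => f (x + s *: v)) d <->
  is_derive (x + t *: v) v f d.
Proof.
have E : (fun h : R => h^-1 *: (((fun s : R => f (x + s *: v)) \o shift t) (h *: 1) -
      f (x + t *: v))) =
    (fun h : R => h^-1 *: ((f \o shift (x + t *: v)) (h *: v) - f (x + t *: v))).
  apply/funext => h /=; congr (_ *: (f _ - _)).
  by rewrite scaler1 scalerDl addrCA addrA addrC addrA.
split=> -[].
  by rewrite /derivable /derive E => ? ?; split.
by move=> ? ?; split; rewrite /derivable /derive E.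
Qed.

Lemma is_derive_fun_eq f g x v (d e : R) : f =1 g -> d = e ->
  is_derive x v f d -> is_derive x v g e.
Proof. by move=> /funext -> ->. Qed.

Lemma is_derive_add f g x v (df dg : R) :
  is_derive x v f df -> is_derive x v g dg ->
  is_derive x v (fun y => f y + g y) (df + dg).
Proof. by move=> ? ?; exact: is_deriveD. Qed.

Lemma is_derive_opp f x v (df : R) :
  is_derive x v f df -> is_derive x v (fun y => - f y) (- df).
Proof. by move=> ?; exact: is_deriveN. Qed.

Lemma is_derive_mul f g x v (df dg : R) :
  is_derive x v f df -> is_derive x v g dg ->
  is_derive x v (fun y => f y * g y) (f x * dg + df * g x).
Proof.
move=> hf hg; have := is_deriveM hf hg.
by rewrite /GRing.scale/= (mulrC df).
Qed.

Lemma is_derive_const (c : R) x v : is_derive x v (fun=> c) 0.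
Proof. exact: is_derive_cst. Qed.

Lemma is_derive_bigsum (I : finType) (F : I -> V -> R) (dF : I -> R) x v :
  (forall i, is_derive x v (F i) (dF i)) ->
  is_derive x v (fun y => \sum_i F i y) (\sum_i dF i).
Proof.
move=> dFi; elim: (index_enum I) => [|i s ih].
  rewrite big_nil (_ : (fun _ => _) = fun=> 0); first exact: is_derive_const.
  by apply/funext => y; rewrite big_nil.
rewrite big_cons (_ : (fun _ => _) = fun y => F i y + \sum_(j <- s) F j y).
  exact: is_derive_add.
by apply/funext => y; rewrite big_cons.
Qed.

(** The inner function has only a derivative along [v], so the one-variable chain rule is applied on
    the line through [x]. *)
Lemma is_derive_compose (h : R -> R) f x v (dh df : R) :
  is_derive (f x) 1 h dh -> is_derive x v f df ->
  is_derive x v (fun y => h (f y)) (dh * df).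
Proof.
move=> dhf dfx; have dfx' : is_derive (x + 0 *: v) v f df by rewrite scale0r addr0.
have := proj2 (is_derive_line f x v 0 df) dfx' => dl.
have := @is_derive1_comp _ h (fun s : R => f (x + s *: v)) 0 dh df.
rewrite scale0r addr0 => /(_ dhf dl) hd.
have := proj1 (is_derive_line (h \o f) x v 0 (dh * df)) hd.
by rewrite scale0r addr0.
Qed.

Lemma is_derive_near f g x v (d : R) : (\near x, f x = g x) ->
  is_derive x v f d -> is_derive x v g d.
Proof. exact: near_eq_is_derive. Qed.

End derivation_rules.

Lemma is_derive_continuous {R : realType} (f : R -> R) (x d : R) :
  is_derive x 1 f d -> {for x, continuous f}.
Proof.
move=> dfx; apply: differentiable_continuous; apply/derivable1_diffP.
exact: ex_derive.
Qed.

Section row_vectors.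
Context {R : realType}.
Set Implicit Arguments. Unset Strict Implicit.

Lemma coord_le_norm n (x : 'rV[R]_n) i : `|x ord0 i| <= `|x|.
Proof. exact: (@le_bigmax_cond _ _ _ _ (ord0, i) xpredT (fun ij => `|x ij.1 ij.2|%:nng)). Qed.

Lemma norm_rV_le n (x : 'rV[R]_n) (c : R) : 0 <= c ->
  (forall i, `|x ord0 i| <= c) -> `|x| <= c.
Proof.
move=> c0 xc; rewrite (_ : `|x| = mx_norm x)// mx_normrE; apply: bigmax_le => //= -[j i] _ /=.
by rewrite ord1.
Qed.

(** The sigma-algebra comes from the coordinates and not from the topology, so a continuous function
    is reached as a limit of functions constant on the half-open cubes of side 1/(k+1). This point
    is the corner of such a cube. *)
Definition lattice_point n (k : nat) (z : 'rV[int]_n) : 'rV[R]_n :=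
  \row_i ((z ord0 i)%:~R / k.+1%:R).

Definition floor_row n (k : nat) (x : 'rV[R]_n) : 'rV[int]_n :=
  \row_i Num.floor (x ord0 i * k.+1%:R).

Lemma measurable_floor_row n k (z : 'rV[int]_n) :
  measurable (@floor_row n k @^-1` [set z]).
Proof.
rewrite (_ : _ @^-1` _ = \bigcap_(i in [set: 'I_n])
    ((fun x : 'rV[R]_n => x ord0 i : measurableTypeR R) @^-1`
      `[(z ord0 i)%:~R / k.+1%:R, (z ord0 i + 1)%:~R / k.+1%:R[)).
  apply: fin_bigcap_measurable => [|i _]; first exact: finite_finset.
  by rewrite -[X in measurable X]setTI; apply: measurable_coord => //; exact: measurable_itv.
have fE (x : 'rV[R]_n) i : (Num.floor (x ord0 i * k.+1%:R) == z ord0 i) =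
    (x ord0 i \in `[(z ord0 i)%:~R / k.+1%:R, (z ord0 i + 1)%:~R / k.+1%:R[).
  by rewrite floor_eq in_itv/= ler_pdivrMr// ltr_pdivlMr.
apply/seteqP; split=> x /=.
  move=> xz i _; suff : Num.floor (x ord0 i * k.+1%:R) == z ord0 i by rewrite fE.
  by rewrite -xz mxE.
by move=> xz; apply/rowP => i; rewrite mxE; apply/eqP; rewrite fE; exact: xz.
Qed.

(** The cells are countably many and measurable, and the function is constant on each of them,
    whatever [f] is. *)
Lemma measurable_fun_lattice d (Y : measurableType d) n k (f : 'rV[R]_n -> Y) :
  measurable_fun setT (fun x => f (lattice_point k (floor_row k x))).
Proof.
move=> _ B mB; rewrite setTI.
rewrite (_ : _ @^-1` _ = \bigcup_(z in [set: 'rV[int]_n])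
  (if `[< B (f (lattice_point k z)) >] then @floor_row n k @^-1` [set z] else set0)).
  apply: countable_bigcupT_measurable => [|z]; first exact: countableP.
  by case: ifP => // _; exact: measurable_floor_row.
apply/seteqP; split=> x /=.
  by move=> Bx; exists (floor_row k x) => //; rewrite asboolT.
by move=> [z _]; case: ifPn => // /asboolP ? /= ->.
Qed.

Lemma cvg_lattice_point n (x : 'rV[R]_n) :
  (fun k => lattice_point k (floor_row k x)) @ \oo --> x.
Proof.
apply/cvgrPdist_lt => e e0.
near=> k.
apply: (@le_lt_trans _ _ k.+1%:R^-1).
  apply: norm_rV_le => [|i]; first by rewrite invr_ge0.
  rewrite !mxE.
  have /andP[lo hi] := floor_itv (x ord0 i * k.+1%:R).
  set z := Num.floor _ in lo hi *.
  rewrite -(@ler_pM2r _ k.+1%:R)// mulVf// -[X in _ * X](@ger0_norm _ k.+1%:R)// -normrM.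
  rewrite mulrBl -mulrA mulVf// mulr1 ger0_norm ?subr_ge0//.
  by rewrite lerBlDl ltW// -[X in _ + X]/(1%:~R) -intrD.
by near: k; exact: (near_infty_natSinv_lt (PosNum e0)).
Unshelve. all: by end_near. Qed.

(* Rounding down to a lattice fixes the origin, so a discontinuity there is harmless. *)
Lemma measurable_fun_continuous_off0 n (f : 'rV[R]_n -> R) :
  (forall x, x != 0 -> {for x, continuous f}) -> measurable_fun setT f.
Proof.
move=> cf.
apply: (@measurable_fun_cvg _ _ _ setT
  (fun k x => f (lattice_point k (floor_row k x)))).
  by move=> k; exact: measurable_fun_lattice.
move=> x _; have [->|x0] := eqVneq x 0.
  rewrite (_ : (fun k => _) = cst (f 0)); first exact: cvg_cst.
  apply/funext => k; congr (f _); apply/rowP => i.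
  by rewrite !mxE mul0r floor0 mul0r.
by apply: continuous_cvg; [exact: cf|exact: cvg_lattice_point].
Qed.

Lemma rV_cons0 n (t : R) (y : 'rV[R]_n) r : rV_cons (t, y) r ord0 = t.
Proof.
rewrite [r]ord1 /rV_cons (_ : ord0 = lshift n (ord0 : 'I_1)); last exact/val_inj.
by apply: etrans (row_mxEl _ _ _ _) _; rewrite mxE.
Qed.

Lemma rV_consS n (t : R) (y : 'rV[R]_n) r i : rV_cons (t, y) r (lift ord0 i) = y r i.
Proof.
by rewrite [r]ord1 /rV_cons (_ : lift ord0 i = rshift 1 i);
  [exact: row_mxEr|exact/val_inj].
Qed.

End row_vectors.

Section fubini_rV.
Context {R : realType}.
Set Implicit Arguments. Unset Strict Implicit.
Local Open Scope ereal_scope.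

Lemma ge0_integral_rVS n (f : 'rV[R]_n.+1 -> \bar R) :
  measurable_fun setT f -> (forall x, 0 <= f x) ->
  \int[lebesgue_rV n.+1]_x f x =
  \int[lebesgue_measure \x lebesgue_rV n]_p f (rV_cons p).
Proof.
move=> mf f0; transitivity
  (\int[pushforward (lebesgue_measure \x lebesgue_rV n) (@rV_cons R n)]_x f x).
  apply: eq_measure_integral; first exact: measurable_rV_cons.
  by move=> *.
by rewrite ge0_integral_pushforward//; exact: measurable_rV_cons.
Qed.

Lemma integrable_rVS n (f : 'rV[R]_n.+1 -> \bar R) :
  (lebesgue_rV n.+1).-integrable setT f ->
  (lebesgue_measure \x lebesgue_rV n).-integrable setT (fun p => f (rV_cons p)).
Proof.
move=> /integrableP[mf fi]; apply/integrableP; split.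
  by apply: measurableT_comp => //; exact: measurable_rV_cons.
by rewrite -(@ge0_integral_rVS n (fun x => `|f x|))//; exact: measurableT_comp.
Qed.

Lemma integral_rVS n (f : 'rV[R]_n.+1 -> \bar R) :
  (lebesgue_rV n.+1).-integrable setT f ->
  \int[lebesgue_rV n.+1]_x f x =
  \int[lebesgue_measure \x lebesgue_rV n]_p f (rV_cons p).
Proof.
move=> fi; transitivity
  (\int[pushforward (lebesgue_measure \x lebesgue_rV n) (@rV_cons R n)]_x f x).
  apply: eq_measure_integral; first exact: measurable_rV_cons.
  by move=> *.
rewrite integral_pushforward//; first exact: measurable_rV_cons.
  exact: measurable_int fi.
exact: integrable_rVS.
Qed.

End fubini_rV.

(** * One-dimensional integrals *)

Section integral_1d.
Context {R : realType}.
Set Implicit Arguments. Unset Strict Implicit.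

Lemma integral_is_derive (f F : R -> R) (a b : R) : a < b ->
  (forall t, a <= t <= b -> is_derive t 1 F (f t)) ->
  (forall t, a <= t <= b -> {for t, continuous f}) ->
  (\int[lebesgue_measure]_(t in `[a, b]) (f t)%:E = (F b - F a)%:E)%E.
Proof.
move=> ab dF cf.
have cF t : a <= t <= b -> {for t, continuous F}.
  move=> /dF dFt; apply: differentiable_continuous; apply/derivable1_diffP.
  exact: ex_derive.
rewrite EFinB; apply: continuous_FTC2 => //.
- apply: continuous_in_subspaceT => t /[!inE]/= /[!in_itv]/=; exact: cf.
- split.
  + by move=> t /[!in_itv]/= /andP[/ltW at_ /ltW tb]; have := dF t; rewrite at_ tb => /(_ isT) [].
  + by apply: cvg_at_right_filter; apply: cF; rewrite lexx ltW.
  + by apply: cvg_at_left_filter; apply: cF; rewrite lexx ltW.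
- move=> t /[!in_itv]/= /andP[/ltW at_ /ltW tb]; rewrite derive1E.
  by have := dF t; rewrite at_ tb => /(_ isT) dFt; exact: derive_val.
Qed.

Lemma integral_derive_compact (f F : R -> R) (a : R) :
  (forall t : R, is_derive t 1 F (f t)) -> continuous f ->
  (forall t, a <= `|t| -> F t = 0) ->
  (\int[lebesgue_measure]_t (f t)%:E = 0)%E.
Proof.
(* [a] may be negative. [b] is positive and exceeds it, so [F] vanishes at both ends of [-b, b] and
   [f] vanishes outside. *)
move=> dF cf F0; pose b : R := `|a| + 1.
have b0 : 0 < b by rewrite /b ltr_wpDl.
have ab : a < b by rewrite (le_lt_trans (ler_norm a))// ltrDl.
have f0 t : a < `|t| -> f t = 0.
  move=> at_; have [_ <-] := dF t.
  rewrite (@near_eq_derive _ _ _ F (cst 0)) ?derive_cst ?oner_eq0//.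
  have : `|x| @[x --> t] --> `|t| by apply: cvg_norm; exact: cvg_id.
  move=> /(@cvgr_gt _ _ _ _ _ _) /(_ _ at_).
  by apply: filterS => x /ltW /F0.
rewrite (_ : (fun t => (f t)%:E) = ((fun t => (f t)%:E) \_ `[- b, b])).
  rewrite -integral_mkcond (@integral_is_derive f F)//; last 2 first.
    by rewrite (lt_trans _ b0)// oppr_lt0.
    by move=> t _; exact: cf.
  by rewrite !F0 ?subrr// ?normrN ger0_norm ltW.
apply/funext => t; rewrite patchE; case: ifPn => // /negP.
rewrite inE/= in_itv/= => /negP; rewrite -ler_norml -ltNge => bt.
by rewrite f0// (lt_trans ab).
Qed.

(** The primitive of (t+d)^(-s) is explicit, and the bound is free of [d], which will allow [d] to
    tend to 0 by monotone convergence. *)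
Lemma integral_shifted_power_le (s d D : R) : 0 <= s < 1 -> 0 < d <= 1 -> 0 < D ->
  (\int[lebesgue_measure]_t (if `|t| <= D then (`|t| + d) `^ (- s) else 0)%:E <=
   (2 * ((D + 1) `^ (1 - s) / (1 - s)))%:E)%E.
Proof.
move=> /andP[s0 s1] /andP[d0 d1] D0.
pose F (t : R) := (t + d) `^ (1 - s) / (1 - s).
pose f (t : R) := (t + d) `^ (- s).
pose A1 : set R := `[0, D]%classic.
pose A2 : set R := `[- D, 0]%classic.
have s10 : 0 < 1 - s by lra.
have dsh (t : R) : is_derive t 1 (fun t : R => t + d) (1 : R).
  by apply: is_derive_eq; rewrite addr0.
have dF (t : R) : 0 <= t -> is_derive t 1 F (f t).
  move=> t0; have td : 0 < t + d by lra.
  have := is_derive1_powR (1 - s) td.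
  move=> dp.
  have := is_derive_mul (@is_derive_compose _ _ (fun y : R => y `^ (1 - s)) (fun y : R => y + d) _ _ _ _ dp (dsh t)) (is_derive_const ((1 - s)^-1) t 1).
  apply: is_derive_fun_eq => //; rewrite mulr0 add0r mulr1 mulrAC mulfV ?mul1r; last by lra.
  by congr (_ `^ _); lra.
have cf (t : R) : 0 <= t -> {for t, continuous f}.
  move=> t0; have td : 0 < t + d by lra.
  have dp := is_derive1_powR (- s) td.
  exact: is_derive_continuous (@is_derive_compose _ _ (fun y : R => y `^ (- s))
    (fun y : R => y + d) _ _ _ _ dp (dsh t)).
have cNf (t : R) : t <= 0 -> {for t, continuous (fun t => f (- t))}.
  move=> t0; apply: (@continuous_comp _ _ _ (fun t : R => - t) f).
    exact: opp_continuous.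
  by apply: cf; rewrite oppr_ge0.
have FD : F D - F 0 <= (D + 1) `^ (1 - s) / (1 - s).
  rewrite /F -mulrBl ler_pM2r ?invr_gt0// (@le_trans _ _ ((D + d) `^ (1 - s)))//.
    by rewrite gerBl powR_ge0.
  by apply: ge0_ler_powR; rewrite ?nnegrE; lra.
have I1 : (\int[lebesgue_measure]_(t in A1) (f t)%:E = (F D - F 0)%:E)%E.
  apply: integral_is_derive => // t /andP[t0 _]; [exact: dF|exact: cf].
have I2 : (\int[lebesgue_measure]_(t in A2) (f (- t))%:E = (F D - F 0)%:E)%E.
  have dG (t : R) : - D <= t <= 0 -> is_derive t 1 (fun t => - F (- t)) (f (- t)).
    move=> /andP[_ t0]; have := dF (- t).
    rewrite oppr_ge0 => /(_ t0) dFt.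
    have := is_derive_opp (@is_derive_compose _ _ F (fun y : R => - y) _ _ _ _ dFt (is_derive_opp (is_derive_id t (1:R)))).
    by apply: is_derive_fun_eq => //; rewrite mulrN1 opprK.
  have D0' : - D < 0 by rewrite oppr_lt0.
  have cG (t : R) : - D <= t <= 0 -> {for t, continuous (fun t => f (- t))}.
    by move=> /andP[_ t0]; exact: cNf.
  rewrite /A2 (@integral_is_derive _ _ _ _ D0' dG cG) oppr0 !opprK.
  by rewrite addrC.
have mf1 : measurable_fun setT ((fun t => (f t)%:E) \_ A1).
  apply/(measurable_restrictT _ _).1; first exact: measurable_itv.
  apply/measurable_EFinP.
  apply: subspace_continuous_measurable_fun; first exact: measurable_itv.
  apply: continuous_in_subspaceT => t /set_mem.
  by rewrite /A1/= in_itv/= => /andP[t0 _]; exact: cf.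
have mf2 : measurable_fun setT ((fun t => (f (- t))%:E) \_ A2).
  apply/(measurable_restrictT _ _).1; first exact: measurable_itv.
  apply/measurable_EFinP.
  apply: subspace_continuous_measurable_fun; first exact: measurable_itv.
  apply: continuous_in_subspaceT => t /set_mem.
  by rewrite /A2/= in_itv/= => /andP[_ t0]; exact: cNf.
apply: (@le_trans _ _ (\int[lebesgue_measure]_t
   (((fun t => (f t)%:E) \_ A1) t + ((fun t => (f (- t))%:E) \_ A2) t))%E).
  apply: ge0_le_integral => //.
  - by move=> t _; rewrite lee_fin; case: ifP => //; rewrite powR_ge0.
  - apply/measurable_EFinP; apply: measurable_fun_ifT => //.
    + by apply: measurable_fun_ler => //; exact: measurableT_comp.
    + apply: (@measurableT_comp _ _ _ _ _ _ (fun y => y `^ (- s))).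
        exact: measurable_powR.
      by apply: measurable_funD => //; exact: measurableT_comp.
  - exact: emeasurable_funD.
  - move=> t _; rewrite !patchE; case: ifPn => [tD|_]; last first.
      by apply: adde_ge0; case: ifP; rewrite // lee_fin powR_ge0.
    have [t0|t0] := leP 0 t.
      have -> : t \in A1 by apply: mem_set; rewrite /A1/= in_itv/= t0/= -(ger0_norm t0).
      by rewrite ger0_norm// leeDl//; case: ifP; rewrite // lee_fin powR_ge0.
    have -> : t \in A2.
      by apply: mem_set; rewrite /A2/= in_itv/= (ltW t0) andbT; move: tD; rewrite ler_norml => /andP[].
    by rewrite ltr0_norm// leeDr//; case: ifP; rewrite // lee_fin powR_ge0.
rewrite ge0_integralD//=.
- rewrite -!integral_mkcond I1 I2 -EFinD lee_fin; lra.
- by move=> t _; rewrite patchE; case: ifP; rewrite // lee_fin powR_ge0.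
- by move=> t _; rewrite patchE; case: ifP; rewrite // lee_fin powR_ge0.
Qed.

End integral_1d.

Section lebesgue_rV_integrals.
Context {R : realType}.
Set Implicit Arguments. Unset Strict Implicit.
Local Open Scope ereal_scope.

(** Tonelli and induction on the dimension. It serves to evaluate a product majorant of a power of
    |x| and the volume of a cube. *)
Lemma integral_prod_coord n (f : 'I_n -> R -> R) (c : 'I_n -> R) :
  (forall i, measurable_fun setT (f i)) -> (forall i t, (0 <= f i t)%R) ->
  (forall i, \int[lebesgue_measure]_t (f i t)%:E = (c i)%:E) ->
  \int[lebesgue_rV n]_x (\prod_(i < n) f i (x ord0 i))%:E = (\prod_(i < n) c i)%:E.
Proof.
have mprod k (g : 'I_k -> R -> R) : (forall i, measurable_fun setT (g i)) ->
    measurable_fun setT (fun x : 'rV[R]_k => \prod_(i < k) g i (x ord0 i))%R.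
  move=> mg; apply: measurable_prod => i _.
  by apply: (measurableT_comp (mg i)); exact: measurable_coord.
elim: n f c => [|n ih] f c mf f0 fc.
  rewrite /= integral_dirac//.
    by rewrite !big_ord0 diracE mem_set// mul1e.
  by apply/measurable_EFinP; exact: mprod.
rewrite ge0_integral_rVS; last 2 first.
  by apply/measurable_EFinP; exact: mprod.
  by move=> x; rewrite lee_fin; apply: prodr_ge0.
pose P (y : 'rV[R]_n) := (\prod_(i < n) f (lift ord0 i) (y ord0 i))%R.
rewrite (eq_integral (fun p : measurableTypeR R * 'rV[R]_n => (f ord0 p.1)%:E * (P p.2)%:E)); last first.
  move=> [t y] _ /=; rewrite -EFinM big_ord_recl rV_cons0; congr ((_ * _)%:E).
  by apply: eq_bigr => i _; rewrite rV_consS.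
have mP : measurable_fun setT P by apply: (mprod n (fun i => f (lift ord0 i))).
have P0 y : (0 <= P y)%R by apply: prodr_ge0.
rewrite fubini_tonelli1/=; last 2 first.
- apply/measurable_EFinP; apply: measurable_funM.
    exact: (measurableT_comp (mf ord0) measurable_fst).
  exact: (measurableT_comp mP measurable_snd).
- by move=> [t y]; rewrite -EFinM lee_fin mulr_ge0.
rewrite /fubini_F/=.
pose C := (\prod_(i < n) c (lift ord0 i))%R.
rewrite (eq_integral (fun t : measurableTypeR R => (f ord0 t)%:E * C%:E)); last first.
  move=> t _; rewrite ge0_integralZl//.
  - by rewrite (ih (fun i => f (lift ord0 i)) (fun i => c (lift ord0 i))).
  - exact/measurable_EFinP.
  - by move=> y _; rewrite lee_fin P0.
  - by rewrite lee_fin f0.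
rewrite ge0_integralZr//; last 3 first.
- by apply/measurable_EFinP; exact: mf.
- by move=> t _; rewrite lee_fin f0.
- rewrite lee_fin; apply: prodr_ge0 => i _; rewrite -lee_fin -fc.
  by apply: integral_ge0 => t _; rewrite lee_fin f0.
by rewrite fc -EFinM big_ord_recl.
Qed.

Lemma lebesgue_rV_hyperplane n (j : 'I_n) :
  lebesgue_rV n [set x : 'rV[R]_n | x ord0 j = 0%R] = 0.
Proof.
have mH k (i : 'I_k) : measurable [set x : 'rV[R]_k | x ord0 i = 0%R].
  rewrite -[X in measurable X]setTI.
  exact: (@measurable_coord R k i measurableT [set 0%R] (measurable_set1 _)).
elim: n j => [[]//|n ih] j.
have -> : lebesgue_rV n.+1 [set x : 'rV[R]_n.+1 | x ord0 j = 0%R] =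
    \int[lebesgue_rV n.+1]_x (\1_[set x : 'rV[R]_n.+1 | x ord0 j = 0%R] x)%:E.
  by rewrite integral_indic ?setIT//; exact: mH.
rewrite ge0_integral_rVS; last 2 first.
  by apply/measurable_EFinP; apply: measurable_indic; exact: mH.
  by move=> x; rewrite lee_fin.
have mc : measurable_fun setT (fun p : measurableTypeR R * 'rV[R]_n =>
    (\1_[set x : 'rV[R]_n.+1 | x ord0 j = 0%R] (rV_cons p))%:E : \bar R).
  apply/measurable_EFinP; apply: measurableT_comp; last exact: measurable_rV_cons.
  by apply: measurable_indic; exact: mH.
case: (unliftP ord0 j) mc => [i ->|->] mc.
  rewrite fubini_tonelli1//.
  rewrite integral0_eq// => t _; rewrite /fubini_F/=.
  rewrite (eq_integral (fun y => (\1_[set y : 'rV[R]_n | y ord0 i = 0%R] y)%:E)).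
    by rewrite integral_indic; [rewrite setIT; exact: ih|exact: measurableT|exact: mH].
  by move=> y _; rewrite !indicE; congr ((nat_of_bool _)%:R%:E); apply/idP/idP; rewrite !inE/= rV_consS.
rewrite fubini_tonelli2//.
rewrite integral0_eq// => y _; rewrite /fubini_G/=.
rewrite (eq_integral (fun t : measurableTypeR R => (\1_[set 0%R : R] t)%:E)).
  by rewrite integral_indic; [rewrite setIT; exact: lebesgue_measure_set1|exact: measurableT|exact: measurable_set1].
by move=> t _; rewrite !indicE; congr ((nat_of_bool _)%:R%:E); apply/idP/idP; rewrite !inE/= rV_cons0.
Qed.

End lebesgue_rV_integrals.

(** * Integration along lines parallel to a coordinate axis *)

Section integral_lines.
Context {R : realType}.
Set Implicit Arguments. Unset Strict Implicit.
Local Open Scope ereal_scope.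

Lemma rV_cons_add_ord0 n (t : R) (y : 'rV[R]_n) :
  rV_cons (t, y) = (rV_cons (0, y) + t *: delta_mx ord0 ord0)%R.
Proof.
apply/rowP => k; rewrite [RHS]mxE [X in _ = (_ + X)%R]mxE [X in (_ + _ * X)%R]mxE; case: (unliftP ord0 k) => [i ->|->].
  by rewrite !rV_consS [lift _ _ == _]eq_sym (negbTE (neq_lift _ _)) andbF mulr0 addr0.
by rewrite !rV_cons0 eqxx andbT mulr1 add0r.
Qed.

Lemma rV_cons_add_lift n (s t : R) (y : 'rV[R]_n) i :
  rV_cons (s, y + t *: delta_mx ord0 i)%R =
  (rV_cons (s, y) + t *: delta_mx ord0 (lift ord0 i))%R.
Proof.
apply/rowP => k; rewrite [RHS]mxE [X in _ = (_ + X)%R]mxE [X in (_ + _ * X)%R]mxE; case: (unliftP ord0 k) => [j ->|->].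
  by rewrite !rV_consS !mxE/= (inj_eq lift_inj).
by rewrite !rV_cons0 (negbTE (neq_lift _ _)) andbF mulr0 addr0.
Qed.

(** Fubini and induction on the dimension: the coordinate [i] is either the one split off, and then
    it is integrated innermost, or a coordinate of the slices. Each line parallel to the axis has
    exactly one base point with [x ord0 i = 0]. *)
Lemma integral_lines_eq0 n (h : 'rV[R]_n -> R) (i : 'I_n) :
  (lebesgue_rV n).-integrable setT (EFin \o h) ->
  (forall x : 'rV[R]_n, x ord0 i = 0%R ->
    \int[lebesgue_measure]_t (h (x + t *: delta_mx ord0 i)%R)%:E = 0) ->
  \int[lebesgue_rV n]_x (h x)%:E = 0.
Proof.
elim: n h i => [h []//|n ih] h i hi hl.
have hi' := integrable_rVS hi.
rewrite (integral_rVS hi).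
case: (unliftP ord0 i) hl => [j ->|->] hl.
  rewrite -(integral12_prod_meas1 hi').
  transitivity (\int[@lebesgue_measure R]_(t in setT) cst 0 t); last exact: integral0.
  apply: ae_eq_integral; [exact: measurableT| |exact: measurable_cst|].
    exact: (measurable_fubini_F hi').
  (* Only almost every slice is integrable, so the slice integrals are known to vanish only almost
     everywhere. *)
  have := ae_integrable1 hi'; apply: filterS => t hit _.
  rewrite /fubini_F; apply: (ih (fun y => h (rV_cons (t, y))) j hit) => y yj.
  rewrite -[RHS](hl (rV_cons (t, y))) ?rV_consS//.
  by apply: eq_integral => s _; rewrite rV_cons_add_lift.
rewrite -(integral21_prod_meas1 hi').
apply: integral0_eq => y _; rewrite /fubini_G.
rewrite -[RHS](hl (rV_cons (0%R, y))) ?rV_cons0//.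
by apply: eq_integral => s _; rewrite -rV_cons_add_ord0.
Qed.

(** Multiplying [h] by the indicator of [x ord0 j != 0] alters it on a null set only and makes it
    vanish on the exceptional lines. The [i]-th axis, the one line of this direction through the
    origin, is among them. *)
Lemma integral_lines_off_hyperplane_eq0 n (h : 'rV[R]_n -> R) (i j : 'I_n) : i != j ->
  (lebesgue_rV n).-integrable setT (EFin \o h) ->
  (forall x : 'rV[R]_n, x ord0 i = 0%R -> x ord0 j != 0%R ->
    \int[lebesgue_measure]_t (h (x + t *: delta_mx ord0 i)%R)%:E = 0) ->
  \int[lebesgue_rV n]_x (h x)%:E = 0.
Proof.
move=> ij hi hl; have ji : (j == i) = false by rewrite eq_sym; exact: negbTE.
pose h' (x : 'rV[R]_n) := (h x * (x ord0 j != 0%R)%:R)%R.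
have mh : measurable_fun setT h by apply/measurable_EFinP; exact: measurable_int hi.
have mj : measurable [set x : 'rV[R]_n | x ord0 j = 0%R].
  rewrite -[X in measurable X]setTI.
  exact: (@measurable_coord R n j measurableT [set 0%R] (measurable_set1 _)).
have mh' : measurable_fun setT h'.
  apply: measurable_funM => //.
  rewrite (_ : (fun _ => _) = \1_(~` [set x : 'rV[R]_n | x ord0 j = 0%R])).
    by apply: measurable_indic; exact: measurableC.
  apply/funext => x; rewrite indicE; congr ((nat_of_bool _)%:R).
  by apply/idP/idP => [/eqP xj|]; rewrite ?inE//= => /eqP.
have hh' : ae_eq (lebesgue_rV n) setT (EFin \o h) (EFin \o h').
  exists [set x : 'rV[R]_n | x ord0 j = 0%R]; split => //.
    exact: lebesgue_rV_hyperplane.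
  move=> x /= hx; apply: contrapT => /eqP xj; apply: hx => _.
  by rewrite /h' xj mulr1.
transitivity (\int[lebesgue_rV n]_x (h' x)%:E).
  by apply: ae_eq_integral => //; exact/measurable_EFinP.
apply: (@integral_lines_eq0 _ _ i).
  apply: le_integrable hi => //; first exact/measurable_EFinP.
  move=> x _; rewrite /= lee_fin /h' normrM ler_piMr//.
  by case: (_ != _); rewrite ?normr1 ?normr0.
move=> x xi; have [xj|xj] := eqVneq (x ord0 j) 0%R.
  apply: integral0_eq => t _.
  by rewrite /h' !mxE ji andbF mulr0 addr0 xj eqxx mulr0.
rewrite -[RHS](hl x)//; apply: eq_integral => t _.
by rewrite /h' !mxE ji andbF mulr0 addr0 xj mulr1.
Qed.

End integral_lines.

Section euclidean_norm.
Context {R : realType} (n : nat).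
Set Implicit Arguments. Unset Strict Implicit.
Implicit Type x : 'rV[R]_n.

Definition sqnorm x : R := \sum_(i < n) x ord0 i ^+ 2.

Lemma enormE x : enorm x = Num.sqrt (sqnorm x). Proof. by []. Qed.

Lemma sqnorm_ge0 x : 0 <= sqnorm x.
Proof. by apply: sumr_ge0 => i _; exact: sqr_ge0. Qed.

Lemma sqr_enorm x : enorm x ^+ 2 = sqnorm x.
Proof. by rewrite enormE sqr_sqrtr// sqnorm_ge0. Qed.

Lemma enorm_ge0 x : 0 <= enorm x. Proof. exact: sqrtr_ge0. Qed.

Lemma coord_le_enorm x i : `|x ord0 i| <= enorm x.
Proof.
rewrite -sqrtr_sqr enormE ler_sqrt ?sqnorm_ge0// /sqnorm (bigD1 i)//= lerDl.
by apply: sumr_ge0 => j _; exact: sqr_ge0.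
Qed.

Lemma enorm0 : enorm (0 : 'rV[R]_n) = 0.
Proof. by rewrite enormE /sqnorm big1 ?sqrtr0// => i _; rewrite mxE expr0n. Qed.

Lemma enorm_gt0 x : x != 0 -> 0 < enorm x.
Proof.
move=> x0; rewrite lt_def enorm_ge0 andbT; apply: contra x0 => /eqP e0.
apply/eqP/rowP => i; rewrite mxE; apply/eqP; rewrite -normr_le0 -e0.
exact: coord_le_enorm.
Qed.

Lemma sqnorm_gt0 x : x != 0 -> 0 < sqnorm x.
Proof. by move=> x0; rewrite -sqr_enorm exprn_gt0// enorm_gt0. Qed.

Lemma norm_le_enorm x : `|x| <= enorm x.
Proof. by apply: norm_rV_le => [|i]; [exact: enorm_ge0|exact: coord_le_enorm]. Qed.

Lemma continuous_sqnorm : continuous sqnorm.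
Proof.
apply: continuous_big => [|i _ y]; first exact: add_continuous.
apply: (@continuous_comp _ _ _ (fun z : 'rV[R]_n => z ord0 i) (fun t : R => t ^+ 2)).
  exact: coord_continuous.
exact: exprn_continuous.
Qed.

Lemma continuous_enorm : continuous (@enorm R n).
Proof.
move=> x; apply: (@continuous_comp _ _ _ sqnorm Num.sqrt).
  exact: continuous_sqnorm.
exact: sqrt_continuous.
Qed.

End euclidean_norm.

(** * Integrability of functions bounded by |x|^(-p), p < n *)

Section integrability.
Context {R : realType}.
Set Implicit Arguments. Unset Strict Implicit.

Lemma measurable_enorm n : measurable_fun setT (@enorm R n).
Proof. by apply: measurable_fun_continuous_off0 => x _; exact: continuous_enorm. Qed.

Lemma norm_rV_leP n (x : 'rV[R]_n) (c : R) : 0 <= c ->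
  (`|x| <= c) = [forall i, `|x ord0 i| <= c].
Proof.
move=> c0; apply/idP/forallP => [xc i|xc]; last exact: norm_rV_le.
exact: le_trans (coord_le_norm _ _) xc.
Qed.

(** For p > 0 this increases to |x|^(-p) off the origin as [d] decreases to 0. The cut-off is in the
    sup norm, so that it splits into conditions on the coordinates. *)
Definition shifted_power n (p d D : R) (x : 'rV[R]_n) : R :=
  if `|x| <= D then (enorm x + d) `^ (- p) else 0.

Lemma shifted_power_ge0 n p d D (x : 'rV[R]_n) : 0 <= shifted_power p d D x.
Proof. by rewrite /shifted_power; case: ifP => // _; exact: powR_ge0. Qed.

Lemma measurable_shifted_power n (p d D : R) :
  measurable_fun setT (@shifted_power n p d D).
Proof.
apply: measurable_fun_ifT => //.
  apply: measurable_fun_ler => //.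
  by apply: measurable_fun_continuous_off0 => x _; exact: norm_continuous.
apply: (@measurableT_comp _ _ _ _ _ _ (fun y : R => y `^ (- p))).
  exact: measurable_powR.
by apply: measurable_funD => //; exact: measurable_enorm.
Qed.

(** Since |x_i| <= |x|, the power (|x|+d)^(-p) is at most the product of the (|x_i|+d)^(-p/n), and
    the exponent p/n is below 1. *)
Lemma integral_shifted_power_rV_le n (p d D : R) : 0 <= p < n%:R -> 0 < d <= 1 -> 0 < D ->
  (\int[lebesgue_rV n]_x (shifted_power p d D x)%:E <=
   ((2 * ((D + 1) `^ (1 - p / n%:R) / (1 - p / n%:R))) ^+ n)%:E)%E.
Proof.
move=> /andP[p0 pn] d01 D0; have /andP[d0 _] := d01.
have n0 : 0 < n%:R :> R by rewrite (le_lt_trans p0).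
set s := p / n%:R.
have s01 : 0 <= s < 1 by apply/andP; split; [apply: divr_ge0 => //; exact: ltW|rewrite ltr_pdivrMr// mul1r].
pose g (t : R) : R := if `|t| <= D then (`|t| + d) `^ (- s) else 0.
have g0 t : 0 <= g t by rewrite /g; case: ifP => // _; exact: powR_ge0.
have mg : measurable_fun setT g.
  apply: measurable_fun_ifT => //.
    by apply: measurable_fun_ler => //; exact: measurableT_comp.
  apply: (@measurableT_comp _ _ _ _ _ _ (fun y : R => y `^ (- s))).
    exact: measurable_powR.
  by apply: measurable_funD => //; exact: measurableT_comp.
have := @integral_shifted_power_le R s d D s01 d01 D0; rewrite -/g.
set B := 2 * _ => gB.
have g_fin : (\int[lebesgue_measure]_t (g t)%:E)%E \is a fin_num.
  rewrite ge0_fin_numE; first exact: le_lt_trans gB (ltry _).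
  by apply: integral_ge0 => t _; rewrite lee_fin g0.
have := @integral_prod_coord R n (fun=> g)
  (fun=> fine (\int[lebesgue_measure]_t (g t)%:E)%E) (fun=> mg) (fun=> g0).
move=> /(_ (fun=> esym (fineK g_fin))) Ig.
apply: (@le_trans _ _ (\int[lebesgue_rV n]_x (\prod_(i < n) g (x ord0 i))%:E)%E).
  apply: ge0_le_integral => //.
  - by move=> x _; rewrite lee_fin shifted_power_ge0.
  - by apply/measurable_EFinP; exact: measurable_shifted_power.
  - apply/measurable_EFinP; apply: measurable_prod => i _.
    by apply: (measurableT_comp mg); exact: measurable_coord.
  - move=> x _; rewrite lee_fin /shifted_power norm_rV_leP ?(ltW D0)//.
    case: ifPn => [/forallP xD|_]; last by apply: prodr_ge0.
    rewrite (_ : - p = - s * n%:R); last by rewrite mulNr divfK// gt_eqF.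
    rewrite powRrM powR_mulrn ?powR_ge0// -[X in _ ^+ X]card_ord -prodr_const.
    apply: ler_prod => i _; rewrite powR_ge0/= /g xD !powRN.
    have xd : 0 < `|x ord0 i| + d by rewrite ltr_wpDl.
    have xe : `|x ord0 i| + d <= enorm x + d by rewrite lerD2r coord_le_enorm.
    have ed : 0 < enorm x + d by exact: lt_le_trans xe.
    rewrite lef_pV2 ?posrE ?powR_gt0//.
    apply: ge0_ler_powR => //; first by case/andP: s01.
    - by rewrite nnegrE ltW.
    - by rewrite nnegrE ltW.
rewrite Ig lee_fin prodr_const card_ord lerXn2r//.
- by rewrite nnegrE fine_ge0//; apply: integral_ge0 => t _; rewrite lee_fin g0.
- rewrite nnegrE -lee_fin; apply: le_trans gB.
  by apply: integral_ge0 => t _; rewrite lee_fin g0.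
- by rewrite -lee_fin fineK.
Qed.

(** Monotone convergence along d = 1/(k+1), the integrals being bounded uniformly in [k]. *)
Lemma integrable_le_power n (p C D : R) (f : 'rV[R]_n -> R) :
  0 < p < n%:R -> 0 < D -> 0 <= C -> measurable_fun setT f ->
  (forall x, enorm x <= D -> `|f x| <= C / enorm x `^ p) ->
  (forall x, D < enorm x -> f x = 0) ->
  (lebesgue_rV n).-integrable setT (EFin \o f).
Proof.
move=> /andP[p0 pn] D0 C0 mf fle f0.
pose d (k : nat) : R := k.+1%:R^-1.
have d0 k : 0 < d k by rewrite invr_gt0.
have d1 k : d k <= 1 by rewrite invf_le1// ler1n.
pose g k (x : 'rV[R]_n) : \bar R := (C * shifted_power p (d k) D x)%:E.
have mg k : measurable_fun setT (g k).
  by apply/measurable_EFinP; apply: measurable_funM => //; exact: measurable_shifted_power.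
have g0 k x : (0 <= g k x)%E by rewrite lee_fin mulr_ge0// shifted_power_ge0.
have ndg x : {homo g ^~ x : a b / (a <= b)%N >-> (a <= b)%E}.
  move=> a b ab; rewrite lee_fin ler_wpM2l// /shifted_power; case: ifP => // _.
  have db : d b <= d a by rewrite lef_pV2 ?posrE// ler_nat.
  have ed k : 0 < enorm x + d k by rewrite ltr_wpDl// enorm_ge0.
  rewrite !powRN lef_pV2 ?posrE ?powR_gt0//.
  apply: ge0_ler_powR; rewrite ?nnegrE ?(ltW p0) ?(ltW (ed _))//.
  by rewrite lerD2l.
have glim x : (`|(f x)%:E| <= limn (g ^~ x))%E.
  have [->|x0] := eqVneq x 0.
    apply: (@le_trans _ _ 0%E); last by apply: lime_ge; [exact: ereal_nondecreasing_is_cvgn|near=> k; exact: g0].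
    (* The convention [0^-1 = 0] turns the assumed bound at the origin into [f 0 = 0]. *)
    have := fle 0; rewrite enorm0 (ltW D0) powR0 ?gt_eqF// invr0 mulr0 => /(_ isT).
    by rewrite /= lee_fin.
  have [xD|xD] := leP (enorm x) D; last first.
    rewrite f0//= normr0; apply: lime_ge; [exact: ereal_nondecreasing_is_cvgn|near=> k; exact: g0].
  suff -> : limn (g ^~ x) = (C * enorm x `^ (- p))%:E by rewrite powRN lee_fin fle.
  apply/cvg_lim => //; apply/cvg_EFin; first by near=> k.
  rewrite /comp/=; apply: cvgMr.
  rewrite /shifted_power (le_trans (norm_le_enorm x) xD).
  have ex0 := enorm_gt0 x0.
  have cd : (fun k => enorm x + d k) @ \oo --> enorm x.
    rewrite -[X in _ --> X]addr0; apply: cvgD; first exact: cvg_cst.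
    exact: (@cvg_harmonic R).
  apply: (@cvg_comp _ _ _ (fun k => enorm x + d k) (fun y : R => y `^ (- p)) _ _ _ cd).
  exact: is_derive_continuous (is_derive1_powR (- p) ex0).
apply/integrableP; split; first exact/measurable_EFinP.
set B := ((2 * ((D + 1) `^ (1 - p / n%:R) / (1 - p / n%:R))) ^+ n).
apply: (@le_lt_trans _ _ (C * B)%:E); last exact: ltry.
apply: (@le_trans _ _ (\int[lebesgue_rV n]_x limn (g ^~ x))%E).
  apply: ge0_le_integral => //.
  - by apply: measurableT_comp => //; exact/measurable_EFinP.
  - apply: (emeasurable_fun_cvg g) => // x _.
    exact: ereal_nondecreasing_is_cvgn.
  - by move=> x _; exact: glim.
rewrite monotone_convergence//.
apply: lime_le.
  apply: ereal_nondecreasing_is_cvgn => a b ab.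
  by apply: ge0_le_integral => // x _; exact: ndg.
near=> k.
rewrite /g; under eq_integral do rewrite EFinM.
rewrite ge0_integralZl//; last 2 first.
- by apply/measurable_EFinP; exact: measurable_shifted_power.
- by move=> x _; rewrite lee_fin shifted_power_ge0.
rewrite EFinM lee_wpmul2l ?lee_fin//.
by apply: integral_shifted_power_rV_le; rewrite ?d0 ?d1 ?(ltW p0).
Unshelve. all: by end_near. Qed.

(** [f] exceeds [f x0 / 2] on a cube around [x0], and the indicator of a cube is a product over the
    coordinates. *)
Lemma integral_gt0_continuous n (f : 'rV[R]_n -> R) (x0 : 'rV[R]_n) :
  measurable_fun setT f -> (forall x, 0 <= f x) ->
  {for x0, continuous f} -> 0 < f x0 ->
  (0 < \int[lebesgue_rV n]_x (f x)%:E)%E.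
Proof.
move=> mf f0 cf fx0.
have /nbhs_ballP[e /= e0 be] : \forall x \near x0, f x0 / 2 < f x.
  have f2 : f x0 / 2 < f x0 by lra.
  exact: (cvgr_gt (f x0) cf).
pose b (i : 'I_n) (t : R) : R := \1_(`[x0 ord0 i - e / 2, x0 ord0 i + e / 2]) t.
have Ib := @integral_prod_coord R n b (fun=> e).
have {Ib} Ib : (\int[lebesgue_rV n]_x (\prod_(i < n) b i (x ord0 i))%:E)%E = (\prod_(i < n) e)%:E.
  apply: Ib => [i|i t|i].
  - by apply: measurable_indic; exact: measurable_itv.
  - by rewrite /b indicE.
  - rewrite integral_indic ?setIT; [|exact: measurableT|exact: measurable_itv].
    apply: etrans (lebesgue_measure_itv _) _ => /=.
    rewrite lte_fin ifT; last by lra.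
    by rewrite -EFinB; congr (_%:E); lra.
have mb : measurable_fun setT (fun x : 'rV[R]_n => \prod_(i < n) b i (x ord0 i)).
  apply: measurable_prod => i _.
  apply: (@measurableT_comp _ _ _ _ _ _ (b i)); last exact: measurable_coord.
  by apply: measurable_indic; exact: measurable_itv.
have b0 x : 0 <= \prod_(i < n) b i (x ord0 i).
  by apply: prodr_ge0 => i _; rewrite /b indicE.
apply: (@lt_le_trans _ _ (\int[lebesgue_rV n]_x ((f x0 / 2) * \prod_(i < n) b i (x ord0 i))%:E)%E).
  under eq_integral do rewrite EFinM.
  rewrite ge0_integralZl//; last 3 first.
  - exact/measurable_EFinP.
  - by move=> x _; rewrite lee_fin.
  - by rewrite lee_fin; lra.
  by rewrite Ib -EFinM lte_fin mulr_gt0 ?prodr_gt0//; lra.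
apply: ge0_le_integral => //.
- by move=> x _; rewrite lee_fin mulr_ge0//; lra.
- by apply/measurable_EFinP; exact: measurable_funM.
- exact/measurable_EFinP.
move=> x _; rewrite lee_fin.
have [/forallP xb|] := boolP [forall i, `|x0 ord0 i - x ord0 i| <= e / 2].
  apply: (@le_trans _ _ (f x0 / 2)); last first.
    apply/ltW/be; rewrite -ball_normE/=.
    apply: (@le_lt_trans _ _ (e / 2)); last by lra.
    by apply: norm_rV_le => [|i]; [lra|rewrite !mxE].
  rewrite ler_piMr//; first by lra.
  by apply: prodr_ile1 => i _; rewrite /b indicE; case: (_ \in _); rewrite /= ?lexx ler01.
rewrite negb_forall => /existsP[i xi].
rewrite (bigD1 i)//= {1}/b indicE memNset ?mul0r ?mulr0//= in_itv/=.
by move=> xi'; move: xi; rewrite distrC ler_distl xi'.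
Qed.

End integrability.

(** * Weighted integrals and the divergence theorem *)

Section radial_derivatives.
Context {R : realType} (N : nat).
Set Implicit Arguments. Unset Strict Implicit.
Implicit Types (x : 'rV[R]_N) (i j : 'I_N).
Local Notation ei i := (delta_mx ord0 i : 'rV[R]_N).

Lemma is_derive_coord x i j :
  is_derive x (ei i) (fun y : 'rV[R]_N => y ord0 j) (i == j)%:R.
Proof.
have h : is_derive (0 : R) 1 (fun s : R => (x + s *: ei i) ord0 j) (i == j)%:R.
  have := is_derive_add (is_derive_const (x ord0 j) (0:R) 1)
    (is_derive_mul (is_derive_id (0:R) (1:R)) (is_derive_const (i == j)%:R (0:R) 1)).
  apply: is_derive_fun_eq => [s|]; first by rewrite !mxE eqxx/= eq_sym.
  by rewrite mulr0 mul1r !add0r.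
have := proj1 (is_derive_line (fun y : 'rV[R]_N => y ord0 j) x (ei i) 0 _) h.
by rewrite scale0r addr0.
Qed.

Lemma is_derive_sqnorm x i : is_derive x (ei i) (@sqnorm R N) (2 * x ord0 i).
Proof.
have := is_derive_bigsum (fun j => is_derive_mul (is_derive_coord x i j) (is_derive_coord x i j)).
apply: is_derive_fun_eq => [y|].
  by rewrite /sqnorm; apply: eq_bigr => j _; rewrite expr2.
rewrite (bigD1 i)//= eqxx big1 ?addr0; first by rewrite mulr1 mul1r; ring.
by move=> j ji; rewrite eq_sym (negbTE ji) mulr0 mul0r addr0.
Qed.

Lemma powR_enorm x (q : R) : enorm x `^ q = sqnorm x `^ (q / 2).
Proof.
by rewrite enormE -powR12_sqrt ?sqnorm_ge0// -powRrM mulrC.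
Qed.

Lemma is_derive_powR_enorm x i (q : R) : x != 0 ->
  is_derive x (ei i) (fun y => enorm y `^ q) (q * x ord0 i / sqnorm x * enorm x `^ q).
Proof.
move=> x0; have Q0 := sqnorm_gt0 x0.
have := @is_derive_compose _ _ (fun s : R => s `^ (q / 2)) (@sqnorm R N) x (ei i) _ _
  (is_derive1_powR (q / 2) Q0) (is_derive_sqnorm x i).
apply: is_derive_fun_eq => [y|]; first by rewrite powR_enorm.
rewrite powR_enorm powRB ?powRr1 ?ltW//; last by rewrite (gt_eqF Q0) implybT.
by field; rewrite gt_eqF.
Qed.

End radial_derivatives.

Section weighted_integral.
Context {R : realType} (N : nat).
Set Implicit Arguments. Unset Strict Implicit.
Implicit Types (x : 'rV[R]_N) (f g : 'rV[R]_N -> R) (i j : 'I_N).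
Local Notation ei i := (delta_mx ord0 i : 'rV[R]_N).

Definition wint (p : R) f : R := \int[lebesgue_rV N]_x (f x / enorm x `^ p).

(** [K] will contain the supports. It lies in the open ball of radius [D], where the iterated
    logarithms are smooth off the origin, and p < N makes |x|^(-p) locally integrable. *)
Definition weight_data (p D : R) (K : set 'rV[R]_N) : Prop :=
  [/\ 0 < p, p < N%:R, 0 < D, closed K & forall x, K x -> enorm x < D].

Context (p D : R) (K : set 'rV[R]_N).
Hypothesis H : weight_data p D K.
Let p0 : 0 < p. Proof. by case: H. Qed.
Let pN : p < N%:R. Proof. by case: H. Qed.
Let D0 : 0 < D. Proof. by case: H. Qed.
Let clK : closed K. Proof. by case: H. Qed.
Let KD x : K x -> enorm x < D. Proof. by case: H => _ _ _ _; apply. Qed.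

(** The class of coefficients. The origin is left out because a bounded coefficient such as
    [x ord0 i ^+ 2 / sqnorm x] has in general no limit there. *)
Definition bc f : Prop :=
  (forall x, x != 0 -> enorm x < D -> {for x, continuous f}) /\
  exists C : R, forall x, x != 0 -> enorm x < D -> `|f x| <= C.

(** The class of integrands: integrable against |x|^(-p), and stable under multiplication by [bc]
    functions, so that the integrability of each integrand below follows from closure rules. *)
Definition adm f : Prop := bc f /\ forall x, ~ K x -> f x = 0.

Lemma bc_const (c : R) : bc (fun=> c).
Proof. by split=> [x _ _|]; [exact: cst_continuous|exists `|c|]. Qed.

Lemma bc_add f g : bc f -> bc g -> bc (fun x => f x + g x).
Proof.
move=> [cf [Cf bf]] [cg [Cg bg]]; split=> [x x0 xD|].
  exact: (cvgD (cf x x0 xD) (cg x x0 xD)).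
exists (Cf + Cg) => x x0 xD; apply: le_trans (ler_normD _ _) _.
by apply: lerD; [exact: bf|exact: bg].
Qed.

Lemma bc_mul f g : bc f -> bc g -> bc (fun x => f x * g x).
Proof.
move=> [cf [Cf bf]] [cg [Cg bg]]; split=> [x x0 xD|].
  exact: (cvgM (cf x x0 xD) (cg x x0 xD)).
by exists (Cf * Cg) => x x0 xD; rewrite normrM ler_pM//; [exact: bf|exact: bg].
Qed.

Lemma bc_opp f : bc f -> bc (fun x => - f x).
Proof.
move=> [cf [Cf bf]]; split=> [x x0 xD|]; first exact: (cvgN (cf x x0 xD)).
by exists Cf => x x0 xD; rewrite normrN; exact: bf.
Qed.

Lemma bc_sub f g : bc f -> bc g -> bc (fun x => f x - g x).
Proof. by move=> hf /bc_opp; exact: bc_add. Qed.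

Lemma bc_exp f k : bc f -> bc (fun x => f x ^+ k).
Proof.
move=> bf; elim: k => [|k ih]; first exact: bc_const.
rewrite (_ : (fun _ => _) = fun x => f x * f x ^+ k); first exact: bc_mul.
by apply/funext => x; rewrite exprS.
Qed.

Lemma bc_sum (I : Type) (s : seq I) (P : pred I) (F : I -> 'rV[R]_N -> R) :
  (forall k, P k -> bc (F k)) -> bc (fun x => \sum_(k <- s | P k) F k x).
Proof.
move=> bF; elim: s => [|k s ih].
  rewrite (_ : (fun _ => _) = fun=> 0); first exact: bc_const.
  by apply/funext => x; rewrite big_nil.
case Pk : (P k).
  rewrite (_ : (fun _ => _) = fun x => F k x + \sum_(j <- s | P j) F j x).
    by apply: bc_add => //; exact: bF.
  by apply/funext => x; rewrite big_cons Pk.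
rewrite (_ : (fun _ => _) = fun x => \sum_(j <- s | P j) F j x)//.
by apply/funext => x; rewrite big_cons Pk.
Qed.

Lemma bc_coord i : bc (fun x => x ord0 i).
Proof.
split=> [x _ _|]; first exact: coord_continuous.
by exists D => x _ /ltW; apply: le_trans; exact: coord_le_enorm.
Qed.

Lemma bc_sqnorm : bc (@sqnorm R N).
Proof.
apply: (bc_sum _ (fun i _ => bc_exp 2 (bc_coord i))).
Qed.

Lemma bc_sqr_coord_ratio i : bc (fun x => x ord0 i ^+ 2 / sqnorm x).
Proof.
split=> [x x0 xD|].
  have Q0 : sqnorm x != 0 by rewrite gt_eqF// sqnorm_gt0.
  exact: (cvgM ((bc_exp 2 (bc_coord i)).1 x x0 xD) (cvgV Q0 (@continuous_sqnorm R N x))).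
exists 1 => x x0 _; have Q0 := sqnorm_gt0 x0.
rewrite ger0_norm ?divr_ge0 ?sqr_ge0 ?(ltW Q0)// ler_pdivrMr// mul1r.
by rewrite /sqnorm (bigD1 i)//= lerDl; apply: sumr_ge0 => j _; exact: sqr_ge0.
Qed.

Lemma adm_mul f g : adm f -> bc g -> adm (fun x => f x * g x).
Proof.
by move=> [bf f0] bg; split=> [|x Kx]; [exact: bc_mul|rewrite f0 ?mul0r].
Qed.

Lemma adm_mull f g : bc f -> adm g -> adm (fun x => f x * g x).
Proof.
by move=> bf [bg g0]; split=> [|x Kx]; [exact: bc_mul|rewrite g0 ?mulr0].
Qed.

Lemma adm_add f g : adm f -> adm g -> adm (fun x => f x + g x).
Proof.
by move=> [bf f0] [bg g0]; split=> [|x Kx]; [exact: bc_add|rewrite f0 ?g0 ?addr0].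
Qed.

Lemma adm_opp f : adm f -> adm (fun x => - f x).
Proof.
by move=> [bf f0]; split=> [|x Kx]; [exact: bc_opp|rewrite f0 ?oppr0].
Qed.

Lemma adm_sub f g : adm f -> adm g -> adm (fun x => f x - g x).
Proof. by move=> hf /adm_opp; exact: adm_add. Qed.

Lemma adm_scale (c : R) f : adm f -> adm (fun x => c * f x).
Proof. by apply: adm_mull; exact: bc_const. Qed.

Lemma adm_sqr f : adm f -> adm (fun x => f x ^+ 2).
Proof. by move=> af; exact: adm_mul af af.1. Qed.

Lemma adm_sum (I : Type) (s : seq I) (P : pred I) (F : I -> 'rV[R]_N -> R) :
  (forall k, P k -> adm (F k)) -> adm (fun x => \sum_(k <- s | P k) F k x).
Proof.
move=> aF; split; first by apply: bc_sum => k Pk; exact: (aF k Pk).1.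
by move=> x Kx; apply: big1 => k Pk; exact: (aF k Pk).2.
Qed.

Lemma near_off_K x : ~ K x -> \forall y \near x, ~ K y.
Proof. by move=> Kx; apply: open_nbhs_nbhs; split => //; exact: closed_openC. Qed.

(** At radius [D] and beyond, continuity comes from the support alone: [K] is closed, so [f]
    vanishes near each point off [K]. *)
Lemma adm_weight_continuous f : adm f ->
  forall x, x != 0 -> {for x, continuous (fun x => f x / enorm x `^ p)}.
Proof.
move=> [[cf _] f0] x x0; have [xD|Dx] := ltP (enorm x) D.
  have e0 : enorm x `^ p != 0 by rewrite gt_eqF// powR_gt0// enorm_gt0.
  have ce : {for x, continuous (fun y => enorm y `^ p)}.
    apply: (@continuous_comp _ _ _ (@enorm R N) (fun y : R => y `^ p)).
      exact: continuous_enorm.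
    exact: is_derive_continuous (is_derive1_powR p (enorm_gt0 x0)).
  exact: (cvgM (cf x x0 xD) (cvgV e0 ce)).
have Kx : ~ K x by move=> /KD; rewrite ltNge Dx.
have h0 : (fun y => f y / enorm y `^ p) @ x --> (0 : R).
  apply: (@cvg_near_cst _ _ _ _ (nbhs x)).
  by have := near_off_K Kx; apply: filterS => y Ky; rewrite f0// mul0r.
by rewrite /prop_for/continuous_at [X in _ --> X](_ : _ = 0)// f0// mul0r.
Qed.

Lemma adm_integrable f : adm f ->
  (lebesgue_rV N).-integrable setT (EFin \o (fun x => f x / enorm x `^ p)).
Proof.
move=> af; have cw := adm_weight_continuous af; case: af => -[_ [C bf]] f0.
apply: (@integrable_le_power _ _ p `|C| D) => //; first by rewrite p0.
- exact: measurable_fun_continuous_off0.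
- move=> x xD; have [->|x0] := eqVneq x 0.
    by rewrite enorm0 powR0 ?gt_eqF// invr0 !mulr0 normr0.
  rewrite normrM normfV [X in _ * X^-1]ger0_norm ?powR_ge0//.
  apply: ler_wpM2r; first by rewrite invr_ge0 powR_ge0.
  move: xD; rewrite le_eqVlt => /predU1P[xD|xD].
    by rewrite f0 ?normr0// => /KD; rewrite xD ltxx.
  by apply: le_trans (ler_norm _); exact: bf.
- by move=> x xD; rewrite f0 ?mul0r// => /KD; rewrite ltNge ltW.
Qed.

Lemma wint_EFin f : adm f ->
  (\int[lebesgue_rV N]_x (f x / enorm x `^ p)%:E)%E = (wint p f)%:E.
Proof.
move=> af; rewrite /wint /Rintegral fineK//.
exact: integrable_fin_num (adm_integrable af).
Qed.

Lemma eq_wint f g : (forall x, x != 0 -> enorm x < D -> K x -> f x = g x) ->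
  adm f -> adm g -> wint p f = wint p g.
Proof.
move=> fg [_ f0] [_ g0]; apply: eq_Rintegral => x _.
(* At the origin both integrands are 0 by the conventions for powers and inverses, whatever [f] and
   [g] are. *)
have [->|x0] := eqVneq x 0; first by rewrite enorm0 powR0 ?gt_eqF// invr0 !mulr0.
have [Kx|Kx] := pselect (K x); first by rewrite fg//; exact: KD.
by rewrite f0// g0.
Qed.

Lemma le_wint f g : (forall x, x != 0 -> enorm x < D -> K x -> f x <= g x) ->
  adm f -> adm g -> wint p f <= wint p g.
Proof.
move=> fg af ag; apply: le_Rintegral => //; [exact: adm_integrable|exact: adm_integrable|].
move=> x _; have [->|x0] := eqVneq x 0; first by rewrite enorm0 powR0 ?gt_eqF// invr0 !mulr0.
have [Kx|Kx] := pselect (K x); last by rewrite af.2// ag.2.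
by apply: ler_wpM2r; [rewrite invr_ge0 powR_ge0|apply: fg => //; exact: KD].
Qed.

Lemma wint_ge0 f : (forall x, 0 <= f x) -> 0 <= wint p f.
Proof. by move=> f0; apply: Rintegral_ge0 => x _; rewrite divr_ge0 ?powR_ge0. Qed.

Lemma wint_add f g : adm f -> adm g -> wint p (fun x => f x + g x) = wint p f + wint p g.
Proof.
move=> af ag; rewrite /wint -RintegralD//; [|exact: adm_integrable|exact: adm_integrable].
by apply: eq_Rintegral => x _; rewrite mulrDl.
Qed.

Lemma wint_scale (c : R) f : adm f -> wint p (fun x => c * f x) = c * wint p f.
Proof.
move=> af; rewrite /wint -RintegralZl//; last exact: adm_integrable.
by apply: eq_Rintegral => x _; rewrite mulrA.
Qed.

Lemma wint_opp f : adm f -> wint p (fun x => - f x) = - wint p f.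
Proof.
move=> af; rewrite -mulN1r -wint_scale//.
by congr (wint p); apply/funext => x; rewrite mulN1r.
Qed.

Lemma wint_sub f g : adm f -> adm g -> wint p (fun x => f x - g x) = wint p f - wint p g.
Proof. by move=> af ag; rewrite wint_add ?wint_opp//; exact: adm_opp. Qed.

Lemma wint0 : wint p (fun=> 0) = 0.
Proof.
have a0 : adm (fun=> 0) by split=> //; exact: bc_const.
by have := wint_scale 0 a0; rewrite !mul0r.
Qed.

Lemma wint_sum (I : Type) (s : seq I) (P : pred I) (F : I -> 'rV[R]_N -> R) :
  (forall k, P k -> adm (F k)) ->
  wint p (fun x => \sum_(k <- s | P k) F k x) = \sum_(k <- s | P k) wint p (F k).
Proof.
move=> aF; elim: s => [|k s ih].
  rewrite big_nil -[RHS]wint0.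
  by congr (wint p); apply/funext => x; rewrite big_nil.
rewrite big_cons; case Pk : (P k).
  rewrite -ih -wint_add; [|exact: aF|exact: adm_sum].
  by congr (wint p); apply/funext => x; rewrite big_cons Pk.
rewrite -ih.
by congr (wint p); apply/funext => x; rewrite big_cons Pk.
Qed.

End weighted_integral.

Section divergence.
Context {R : realType} (N : nat).
Set Implicit Arguments. Unset Strict Implicit.
Implicit Types (x : 'rV[R]_N) (f g : 'rV[R]_N -> R) (i j : 'I_N).
Local Notation ei i := (delta_mx ord0 i : 'rV[R]_N).

Context (p D : R) (K : set 'rV[R]_N).
Hypothesis H : weight_data p D K.
Hypothesis N2 : (2 <= N)%N.
Let p0 : 0 < p. Proof. by case: H. Qed.
Let pN : p < N%:R. Proof. by case: H. Qed.
Let D0 : 0 < D. Proof. by case: H. Qed.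
Let clK : closed K. Proof. by case: H. Qed.
Let KD x : K x -> enorm x < D. Proof. by case: H => _ _ _ _; apply. Qed.

(* The weighted field V_i = |x|^2 al + x_i be vanishes at the origin, which keeps
   the flux density integrable; lines through the origin are negligible. *)
Lemma wint_partial_eq0 i (al be dal dbe : 'rV[R]_N -> R) :
  (forall x, x != 0 -> enorm x < D -> is_derive x (ei i) al (dal x)) ->
  (forall x, x != 0 -> enorm x < D -> is_derive x (ei i) be (dbe x)) ->
  adm D K al -> adm D K be -> adm D K dal -> adm D K (fun x => x ord0 i * dbe x) ->
  let h x := 2 * (x ord0 i * al x) + sqnorm x * dal x + be x + x ord0 i * dbe x
        - p * (x ord0 i * al x + x ord0 i ^+ 2 / sqnorm x * be x) in
  adm D K h /\ wint p h = 0.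
Proof.
move=> dalP dbeP aal abe adal adbe h.
have ah : adm D K h.
  apply: adm_sub.
    apply: adm_add => //; apply: adm_add => //; apply: adm_add.
      by apply: adm_scale; apply: adm_mull => //; exact: bc_coord.
    by apply: adm_mull => //; exact: bc_sqnorm.
  apply: adm_scale; apply: adm_add; apply: adm_mull => //; first exact: bc_coord.
  exact: bc_sqr_coord_ratio.
split=> //.
(* A line of direction [ei i] on which the coordinate [j] is not 0 misses the origin; such a [j]
   exists because N >= 2. *)
have [j ij] : exists j : 'I_N, i != j.
  have lt0 : (0 < N)%N by exact: ltnW.
  have [i0|i0] := eqVneq (val i) 0%N.
    by exists (Ordinal N2); rewrite -(inj_eq val_inj) i0.
  by exists (Ordinal lt0); rewrite -(inj_eq val_inj).
(* [F] is the [i]-th component of the weighted field and [G] its derivative along [ei i]; the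
   formula for [h] is read off from this. *)
pose F x := (sqnorm x * al x + x ord0 i * be x) / enorm x `^ p.
pose G x := h x / enorm x `^ p.
have F0 x : ~ K x -> F x = 0.
  by move=> Kx; rewrite /F aal.2// abe.2// !mulr0 add0r mul0r.
have dF x : x != 0 -> is_derive x (ei i) F (G x).
  move=> x0; have [xD|Dx] := ltP (enorm x) D.
    have := is_derive_mul
      (is_derive_add (is_derive_mul (is_derive_sqnorm x i) (dalP x x0 xD))
        (is_derive_mul (is_derive_coord x i i) (dbeP x x0 xD)))
      (is_derive_powR_enorm i (- p) x0).
    apply: is_derive_fun_eq => [y|]; first by rewrite powRN.
    have Q0 := sqnorm_gt0 x0; have e0 : enorm x `^ p != 0 by rewrite gt_eqF// powR_gt0// enorm_gt0.
    rewrite /G /h eqxx powRN mulr1n; field.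
    by rewrite e0 gt_eqF.
  have Kx : ~ K x by move=> /KD; rewrite ltNge Dx.
  rewrite /G ah.2// mul0r.
  apply: is_derive_near (is_derive_const 0 x (ei i)).
  by have := near_off_K H Kx; apply: filterS => y /F0.
suff I0 : (\int[lebesgue_rV N]_x (G x)%:E = 0)%E by rewrite /wint /Rintegral I0.
apply: (integral_lines_off_hyperplane_eq0 ij); first exact: (adm_integrable H).
move=> x xi xj.
have x0 t : x + t *: ei i != 0.
  apply: contra xj => /eqP/rowP/(_ j); rewrite !mxE (_ : (j == i) = false) ?andbF ?mulr0 ?addr0.
    by move=> ->.
  by apply/negbTE; rewrite eq_sym.
apply: (@integral_derive_compact _ (fun t => G (x + t *: ei i)) (fun t => F (x + t *: ei i)) D).
- by move=> t; apply/is_derive_line; exact: dF.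
- move=> t; apply: (@continuous_comp _ _ _ (fun t : R => x + t *: ei i) G).
    apply: cvgD; first exact: cvg_cst.
    by apply: cvgZl; exact: cvg_id.
  exact: (adm_weight_continuous H ah).
- move=> t Dt; apply: F0 => /KD; rewrite ltNge => /negP; apply.
  apply: le_trans Dt _; have := coord_le_enorm (x + t *: ei i) i.
  by rewrite !mxE xi !eqxx mulr1 add0r.
Qed.

(** The integrand is |x|^p times the divergence of |x|^(-p) (|x|^2 al + be x), since the x_i^2/|x|^2
    add up to 1. All later integrations by parts, and the comparison of integrals along the
    minimising family, are instances. *)
Lemma wint_div_eq0 (al dal : 'I_N -> 'rV[R]_N -> R) (be : 'rV[R]_N -> R) (dbe : 'I_N -> 'rV[R]_N -> R) :
  (forall i x, x != 0 -> enorm x < D -> is_derive x (ei i) (al i) (dal i x)) ->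
  (forall i x, x != 0 -> enorm x < D -> is_derive x (ei i) be (dbe i x)) ->
  (forall i, adm D K (al i)) -> adm D K be -> (forall i, adm D K (dal i)) ->
  (forall i, adm D K (fun x => x ord0 i * dbe i x)) ->
  wint p (fun x => (2 - p) * (\sum_i x ord0 i * al i x) + sqnorm x * \sum_i dal i x
    + (N%:R - p) * be x + \sum_i x ord0 i * dbe i x) = 0.
Proof.
move=> dalP dbeP aal abe adal adbe.
pose h i x := 2 * (x ord0 i * al i x) + sqnorm x * dal i x + be x + x ord0 i * dbe i x
        - p * (x ord0 i * al i x + x ord0 i ^+ 2 / sqnorm x * be x).
have hP i := wint_partial_eq0 (dalP i) (dbeP i) (aal i) abe (adal i) (adbe i).
have ah i : adm D K (h i) by have [] := hP i.
have E : wint p (fun x => \sum_i h i x) = 0.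
  rewrite (wint_sum H)//; apply: big1 => i _; exact: (hP i).2.
rewrite -[RHS]E; apply: (eq_wint H) => [x x0 xD Kx||].
- rewrite /h sumrB !big_split/= -!mulr_sumr big_split/= -mulr_suml.
  rewrite -mulr_suml -/(sqnorm x) mulfV ?gt_eqF ?sqnorm_gt0// mul1r.
  by rewrite sumr_const card_ord -mulr_natl; ring.
- apply: adm_add; last by apply: adm_sum => i _; exact: adbe.
  apply: adm_add; last exact: adm_scale.
  apply: adm_add; last by apply: adm_mull; [exact: bc_sqnorm|apply: adm_sum].
  by apply: adm_scale; apply: adm_sum => i _; apply: adm_mull => //; exact: bc_coord.
- by apply: adm_sum.
Qed.

End divergence.

(** * The Rellich identity *)

Section rellich_identity.
Context {R : realType} (N : nat).
Set Implicit Arguments. Unset Strict Implicit.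
Implicit Types (x : 'rV[R]_N) (i j : 'I_N).
Local Notation ei i := (delta_mx ord0 i : 'rV[R]_N).
Local Notation Q := (@sqnorm R N).

Context (m D : R) (K : set 'rV[R]_N).
Let p : R := 2 * m + 4.
Let a : R := (N%:R - 4 - 2 * m) / 2.
Let kap : R := (N%:R + 2 * m) * (N%:R - 4 - 2 * m) / 4.
Hypothesis H : weight_data p D K.
Hypothesis N2 : (2 <= N)%N.

Context (u : 'rV[R]_N -> R) (u1 : 'I_N -> 'rV[R]_N -> R) (u2 : 'I_N -> 'I_N -> 'rV[R]_N -> R).
Hypothesis du : forall i x, is_derive x (ei i) u (u1 i x).
Hypothesis du1 : forall i j x, is_derive x (ei i) (u1 j) (u2 i j x).
Hypothesis u2C : forall i j x, u2 i j x = u2 j i x.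
Hypothesis au : adm D K u.
Hypothesis au1 : forall i, adm D K (u1 i).
Hypothesis au2 : forall i j, adm D K (u2 i j).

Definition euler x := \sum_i x ord0 i * u1 i x.
(* |x|^a u has radial derivative |x|^(a-1) times this. *)
Definition euler_shift x := euler x + a * u x.
Definition scaled_laplacian x := Q x * \sum_i u2 i i x.
Definition grad_sqr x := \sum_i u1 i x ^+ 2.
(** [kap] is determined by |x|^2 Delta |x|^(-a) = - kap |x|^(-a). Both [euler_shift] and this
    expression vanish on |x|^(-a), the function that would attain the constant if it were
    admissible. *)
Definition rellich_defect x :=
  scaled_laplacian x + kap * u x - 2 * (1 + m) * euler_shift x.

Local Notation E := euler.
Local Notation e := euler_shift.
Local Notation Lam := scaled_laplacian.
Local Notation G2 := grad_sqr.
Local Notation Z := rellich_defect.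

Lemma adm_euler : adm D K E.
Proof. by apply: adm_sum => i _; apply: adm_mull => //; exact: bc_coord. Qed.

Lemma adm_euler_shift : adm D K e.
Proof. by apply: adm_add; [exact: adm_euler|exact: adm_scale]. Qed.

Lemma adm_scaled_laplacian : adm D K Lam.
Proof. by apply: adm_mull; [exact: bc_sqnorm|apply: adm_sum]. Qed.

Lemma adm_grad_sqr : adm D K G2.
Proof. by apply: adm_sum => i _; exact: adm_sqr. Qed.

Lemma adm_rellich_defect : adm D K Z.
Proof.
apply: adm_sub; last by apply: adm_scale; exact: adm_euler_shift.
by apply: adm_add; [exact: adm_scaled_laplacian|exact: adm_scale].
Qed.

Lemma adm_grad_radial_gap : adm D K (fun x => Q x * G2 x - E x ^+ 2).
Proof.
apply: adm_sub; last by apply: adm_sqr; exact: adm_euler.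
by apply: adm_mull; [exact: bc_sqnorm|exact: adm_grad_sqr].
Qed.

(** Lagrange's identity: the gap is half the sum of the squares of x_i u_j - x_j u_i, that is, |x|^2
    times the squared tangential part of the gradient. *)
Lemma grad_radial_gap_ge0 x : 0 <= Q x * G2 x - E x ^+ 2.
Proof.
have sq : 0 <= \sum_i \sum_j (x ord0 i * u1 j x - x ord0 j * u1 i x) ^+ 2.
  by apply: sumr_ge0 => i _; apply: sumr_ge0 => j _; exact: sqr_ge0.
suff <- : 2^-1 * \sum_i \sum_j (x ord0 i * u1 j x - x ord0 j * u1 i x) ^+ 2 =
    Q x * G2 x - E x ^+ 2 by rewrite mulr_ge0.
have -> : \sum_i \sum_j (x ord0 i * u1 j x - x ord0 j * u1 i x) ^+ 2 =
    Q x * G2 x + G2 x * Q x - 2 * (E x * E x).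
  rewrite /sqnorm /grad_sqr /euler !mulr_suml mulr_sumr -big_split -sumrB/=.
  apply: eq_bigr => i _; rewrite !mulr_sumr -big_split -sumrB/=.
  by apply: eq_bigr => j _; ring.
by field.
Qed.

(* Integrates the divergence of |x|^-p phi u^2 x. *)
Lemma wint_radial_weight_eq0 (phi phit : 'rV[R]_N -> R) :
  (forall i x, x != 0 -> enorm x < D ->
    is_derive x (ei i) phi (x ord0 i / Q x * phit x)) ->
  bc D phi -> bc D phit ->
  wint p (fun x => 2 * (phi x * u x * e x) + phit x * u x ^+ 2) = 0.
Proof.
move=> dphi bphi bphit.
pose be x := phi x * (u x * u x).
pose dbe i x := phi x * (u x * u1 i x + u1 i x * u x) + x ord0 i / Q x * phit x * (u x * u x).
have a0 : adm D K (fun=> 0) by split=> //; exact: bc_const.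
have dbeP i x : x != 0 -> enorm x < D -> is_derive x (ei i) be (dbe i x).
  move=> x0 xD; apply: is_derive_fun_eq (is_derive_mul (dphi i x x0 xD)
    (is_derive_mul (du i x) (du i x))) => //.
have abe : adm D K be by apply: adm_mull => //; exact: adm_sqr.
have adbe i : adm D K (fun x => x ord0 i * dbe i x).
  have : adm D K (fun x => x ord0 i * (phi x * (u x * u1 i x + u1 i x * u x)) +
      x ord0 i ^+ 2 / Q x * (phit x * u x ^+ 2)).
    apply: adm_add; apply: adm_mull.
    - exact: bc_coord.
    - by apply: adm_mull => //; apply: adm_add; apply: adm_mul => //; [exact: (au1 i).1|exact: au.1].
    - exact: bc_sqr_coord_ratio.
    - by apply: adm_mull => //; exact: adm_sqr.
  by congr adm; apply/funext => x; rewrite /dbe; ring.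
rewrite -[RHS](@wint_div_eq0 _ _ _ _ _ H N2 (fun i x => 0) (fun i x => 0) be dbe
  (fun i x _ _ => is_derive_const 0 x (ei i)) dbeP (fun=> a0) abe (fun=> a0) adbe).
apply: (eq_wint H) => [x x0 xD Kx||].
- rewrite [X in (2 - p) * X]big1 => [|i _]; last by rewrite mulr0.
  rewrite [X in Q x * X]big1//.
  have -> : \sum_i x ord0 i * dbe i x = 2 * (phi x * u x) * E x + phit x * u x ^+ 2 / Q x * Q x.
    rewrite /euler {2}/sqnorm !mulr_sumr -big_split/=.
    by apply: eq_bigr => i _; rewrite /dbe; ring.
  (* [N - p = 2 a], so the term in [be] turns [E] into [e]. *)
  rewrite divfK ?gt_eqF ?sqnorm_gt0// /be /euler_shift /p /a; by field.
- apply: adm_add; last by apply: adm_mull => //; exact: adm_sqr.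
  by apply: adm_scale; apply: adm_mull; [apply: bc_mul => //; exact: au.1|exact: adm_euler_shift].
- apply: adm_add; last exact: adm_sum.
  apply: adm_add; last exact: adm_scale.
  apply: adm_add; last by apply: adm_mull; [exact: bc_sqnorm|apply: adm_sum].
  by apply: adm_scale; apply: adm_sum => i _; apply: adm_mull => //; exact: bc_coord.
Qed.

(** The case [phi = 1]: with w = |x|^a u, the product |x|^(2a) u e is half the derivative of w^2 in
    ln |x|. *)
Lemma wint_shift_eq0 : wint p (fun x => u x * e x) = 0.
Proof.
have d1 i x : x != 0 -> enorm x < D ->
    is_derive x (ei i) (fun=> 1 : R) (x ord0 i / Q x * 0).
  by move=> _ _; rewrite mulr0; exact: is_derive_const.
have /eqP : 2 * wint p (fun x => u x * e x) = 0.
  rewrite -(wint_scale H); last by apply: adm_mull; [exact: au.1|exact: adm_euler_shift].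
  rewrite -[RHS](@wint_radial_weight_eq0 (fun=> 1) (fun=> 0) d1 (bc_const N D 1) (bc_const N D 0)).
  by congr (wint p); apply/funext => x; ring.
by rewrite mulf_eq0 pnatr_eq0/= => /eqP.
Qed.

(* With w = |x|^a u this is |x|^(2a+2) |grad w|^2. *)
Definition grad_shift_sqr x := Q x * G2 x + 2 * a * (u x * E x) + a ^+ 2 * u x ^+ 2.
Local Notation W := grad_shift_sqr.

Lemma adm_grad_shift_sqr : adm D K W.
Proof.
apply: adm_add; last by apply: adm_scale; exact: adm_sqr.
apply: adm_add; first by apply: adm_mull; [exact: bc_sqnorm|exact: adm_grad_sqr].
by apply: adm_scale; apply: adm_mull; [exact: au.1|exact: adm_euler].
Qed.

Lemma grad_shift_sqrE x : W x = e x ^+ 2 + (Q x * G2 x - E x ^+ 2).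
Proof. by rewrite /grad_shift_sqr /euler_shift; ring. Qed.

(* Integrates the divergence of |x|^(2-p) u grad u. *)
Lemma wint_mul_laplacian :
  wint p (fun x => u x * (Lam x + kap * u x)) = - wint p W.
Proof.
have a0 : adm D K (fun=> 0) by split=> //; exact: bc_const.
pose al i x := u x * u1 i x.
pose dal i x := u x * u2 i i x + u1 i x * u1 i x.
have dalP i x : x != 0 -> enorm x < D -> is_derive x (ei i) (al i) (dal i x).
  by move=> _ _; exact: is_derive_mul.
have aal i : adm D K (al i) by apply: adm_mull => //; exact: au.1.
have adal i : adm D K (dal i).
  by apply: adm_add; apply: adm_mull => //; [exact: au.1|exact: (au1 i).1].
have E1 := @wint_div_eq0 _ _ _ _ _ H N2 al dal (fun=> 0) (fun i x => 0)
  dalP (fun i x _ _ => is_derive_const 0 x (ei i)) aal a0 adal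
  (fun i => adm_mull (bc_coord D i) a0).
have aue : adm D K (fun x => u x * e x).
  by apply: adm_mull; [exact: au.1|exact: adm_euler_shift].
have auL : adm D K (fun x => u x * (Lam x + kap * u x)).
  apply: adm_mull; first exact: au.1.
  by apply: adm_add; [exact: adm_scaled_laplacian|exact: adm_scale].
apply/eqP; rewrite -addr_eq0 -(wint_add H)//; last exact: adm_grad_shift_sqr.
rewrite -[X in _ == X]addr0 -[X in _ == X + _]E1.
(* What remains besides the divergence is (2a-2+p) u e, because a (2a-2+p) = kap + a^2. *)
rewrite -[X in _ == _ + X](mulr0 ((2 * a - 2 + p))) -[X in _ == _ + _ * X]wint_shift_eq0.
rewrite -(wint_scale H)// -(wint_add H)//; last 2 first.
- apply: adm_add; last by apply: adm_sum => i _; apply: adm_mull => //; exact: bc_coord.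
  apply: adm_add; last exact: adm_scale.
  apply: adm_add; last by apply: adm_mull; [exact: bc_sqnorm|apply: adm_sum].
  by apply: adm_scale; apply: adm_sum => i _; apply: adm_mull => //; exact: bc_coord.
- exact: adm_scale.
apply/eqP; congr (wint p); apply/funext => x.
have -> : \sum_i x ord0 i * al i x = u x * E x.
  by rewrite /euler mulr_sumr; apply: eq_bigr => i _; rewrite /al; ring.
have -> : \sum_i dal i x = u x * \sum_i u2 i i x + G2 x.
  by rewrite /grad_sqr mulr_sumr -big_split; apply: eq_bigr => i _; rewrite /dal/=; ring.
have -> : \sum_i x ord0 i * (0 : R) = 0 by rewrite big1// => i _; rewrite mulr0.
rewrite /grad_shift_sqr /scaled_laplacian /euler_shift /p /kap /a; by field.
Qed.

(* A Pohozaev identity: integrates the divergence of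
   |x|^-p (e (|x|^2 grad u + a u x) - W x / 2). *)
Lemma wint_pohozaev : wint p (fun x => Z x * e x) = 0.
Proof.
pose T i x := \sum_j x ord0 j * u2 i j x.
pose dE i x := T i x + u1 i x.
pose de i x := dE i x + a * u1 i x.
pose al i x := e x * u1 i x.
pose dal i x := e x * u2 i i x + de i x * u1 i x.
pose be x := a * (u x * e x) - 2^-1 * W x.
pose dW i x := Q x * (\sum_j 2 * (u1 j x * u2 i j x)) + 2 * x ord0 i * G2 x +
  2 * a * (u x * dE i x + u1 i x * E x) + a ^+ 2 * (2 * (u x * u1 i x)).
pose dbe i x := a * (u x * de i x + u1 i x * e x) - 2^-1 * dW i x.
have dEP i x : is_derive x (ei i) E (dE i x).
  have := is_derive_bigsum (fun j => is_derive_mul (is_derive_coord x i j) (du1 i j x)).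
  apply: is_derive_fun_eq => //; rewrite /dE /T big_split/=; congr (_ + _).
  rewrite (bigD1 i)//= eqxx mul1r big1 ?addr0// => j ji.
  by rewrite eq_sym (negbTE ji) mul0r.
have deP i x : is_derive x (ei i) e (de i x).
  have := is_derive_add (dEP i x) (is_derive_mul (is_derive_const a x (ei i)) (du i x)).
  by apply: is_derive_fun_eq => //; rewrite /de mul0r addr0.
have dalP i x : x != 0 -> enorm x < D -> is_derive x (ei i) (al i) (dal i x).
  by move=> _ _; exact: is_derive_mul.
have dWP i x : is_derive x (ei i) W (dW i x).
  have dG2 := is_derive_bigsum (fun j => is_derive_mul (du1 i j x) (du1 i j x)).
  have := is_derive_add (is_derive_add
      (is_derive_mul (is_derive_sqnorm x i) dG2)
      (is_derive_mul (is_derive_const (2 * a) x (ei i)) (is_derive_mul (du i x) (dEP i x))))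
    (is_derive_mul (is_derive_const (a ^+ 2) x (ei i)) (is_derive_mul (du i x) (du i x))).
  apply: is_derive_fun_eq => [y|].
    have -> : \sum_j u1 j y * u1 j y = G2 y by apply: eq_bigr => j _; rewrite expr2.
    by rewrite /grad_shift_sqr; ring.
  have -> : \sum_j (u1 j x * u2 i j x + u2 i j x * u1 j x) =
      \sum_j 2 * (u1 j x * u2 i j x) by apply: eq_bigr => j _; ring.
  have -> : \sum_j u1 j x * u1 j x = G2 x by apply: eq_bigr => j _; rewrite expr2.
  by rewrite /dW; ring.
have dbeP i x : x != 0 -> enorm x < D -> is_derive x (ei i) be (dbe i x).
  move=> _ _; have := is_derive_add
    (is_derive_mul (is_derive_const a x (ei i)) (is_derive_mul (du i x) (deP i x)))
    (is_derive_opp (is_derive_mul (is_derive_const 2^-1 x (ei i)) (dWP i x))).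
  by apply: is_derive_fun_eq => //; rewrite /dbe !mul0r !addr0.
have aE := adm_euler; have ae := adm_euler_shift; have aW := adm_grad_shift_sqr.
have aT i : adm D K (T i).
  by apply: adm_sum => j _; apply: adm_mull => //; exact: bc_coord.
have adE i : adm D K (dE i) by exact: adm_add.
have ade i : adm D K (de i) by apply: adm_add => //; exact: adm_scale.
have aal i : adm D K (al i) by apply: adm_mull => //; exact: ae.1.
have adal i : adm D K (dal i).
  by apply: adm_add; apply: adm_mull => //; [exact: ae.1|exact: (ade i).1].
have abe : adm D K be.
  apply: adm_sub; apply: adm_scale => //.
  by apply: adm_mull => //; exact: au.1.
have adW i : adm D K (dW i).
  apply: adm_add; last by do 2 apply: adm_scale; apply: adm_mull => //; exact: au.1.
  apply: adm_add.
    apply: adm_add.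
      apply: adm_mull; first exact: bc_sqnorm.
      by apply: adm_sum => j _; apply: adm_scale; apply: adm_mull => //; exact: (au1 j).1.
    apply: adm_mull; last exact: adm_grad_sqr.
    by apply: bc_mul; [exact: bc_const|exact: bc_coord].
  by apply: adm_scale; apply: adm_add; apply: adm_mull => //; [exact: au.1|exact: (au1 i).1].
have adbe i : adm D K (fun x => x ord0 i * dbe i x).
  apply: adm_mull; first exact: bc_coord.
  apply: adm_sub; apply: adm_scale => //.
  by apply: adm_add; apply: adm_mull => //; [exact: au.1|exact: (au1 i).1].
have E1 := @wint_div_eq0 _ _ _ _ _ H N2 al dal be dbe dalP dbeP aal abe adal adbe.
have aue : adm D K (fun x => u x * e x) by apply: adm_mull => //; exact: au.1.
rewrite -[RHS]E1; congr (wint p); apply/funext => x.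
pose S := \sum_i u1 i x * T i x.
have -> : \sum_i x ord0 i * al i x = e x * E x.
  by rewrite /euler mulr_sumr; apply: eq_bigr => i _; rewrite /al; ring.
have -> : \sum_i dal i x = e x * \sum_i u2 i i x + S + (1 + a) * G2 x.
  rewrite /S /grad_sqr !mulr_sumr -!big_split/=; apply: eq_bigr => i _.
  by rewrite /dal /de /dE; ring.
(* The symmetry of the second derivatives enters here: the Hessian terms from the divergence of e
   grad u and from the radial derivative of |grad u|^2 / 2 are the same sum, and they cancel. *)
have SE : \sum_i x ord0 i * (\sum_j u1 j x * u2 i j x) = S.
  under eq_bigr do rewrite mulr_sumr.
  rewrite exchange_big /S /T/=; apply: eq_bigr => j _; rewrite mulr_sumr.
  by apply: eq_bigr => i _; rewrite u2C; ring.
have lin (c2 c3 c4 : R) : c2 * E x + c3 * S + c4 * Q x =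
    \sum_i (c2 * (x ord0 i * u1 i x) + c3 * (x ord0 i * \sum_j u1 j x * u2 i j x)
      + c4 * x ord0 i ^+ 2).
  by rewrite -SE /euler /sqnorm !mulr_sumr -!big_split.
have -> : \sum_i x ord0 i * dbe i x =
    (a * u x * (1 + a) + a * e x - a * u x - a * E x - a ^+ 2 * u x) * E x
    + (- Q x) * S + (- G2 x) * Q x.
  rewrite lin; apply: eq_bigr => i _.
  by rewrite /dbe /dW -mulr_sumr /de /dE; field.
rewrite /rellich_defect /scaled_laplacian /be /grad_shift_sqr.
set eu := euler_shift x; have -> : E x = eu - a * u x by rewrite /eu /euler_shift; ring.
by rewrite /p /kap /a; field.
Qed.

(** Square [Lam = (Z + 2 (1 + m) e) - kap u]. The product Z e integrates to 0, and the cross term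
    with [u] is -2 kap u (Lam + kap u), which yields 2 kap W with W = e^2 plus the tangential gap.
    The resulting coefficient of e^2 is 4A. *)
Lemma wint_sqr_laplacian :
  wint p (fun x => Lam x ^+ 2) = kap ^+ 2 * wint p (fun x => u x ^+ 2)
    + wint p (fun x => Z x ^+ 2)
    + (4 * (1 + m) ^+ 2 + 2 * kap) * wint p (fun x => e x ^+ 2)
    + 2 * kap * wint p (fun x => Q x * G2 x - E x ^+ 2).
Proof.
have aZ := adm_rellich_defect; have ae := adm_euler_shift.
have aL := adm_scaled_laplacian; have aW := adm_grad_shift_sqr.
have ag := adm_grad_radial_gap.
have aZe : adm D K (fun x => Z x * e x) by apply: adm_mull => //; exact: aZ.1.
have auL : adm D K (fun x => u x * (Lam x + kap * u x)).
  by apply: adm_mull; [exact: au.1|apply: adm_add => //; exact: adm_scale].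
have au' := adm_sqr au; have aZ' := adm_sqr aZ; have ae' := adm_sqr ae.
have EW : wint p W = wint p (fun x => e x ^+ 2) + wint p (fun x => Q x * G2 x - E x ^+ 2).
  rewrite -(wint_add H)//; congr (wint p); apply/funext => x.
  exact: grad_shift_sqrE.
have : wint p (fun x => Lam x ^+ 2) = wint p (fun x => Z x ^+ 2)
    + 4 * (1 + m) ^+ 2 * wint p (fun x => e x ^+ 2)
    + kap ^+ 2 * wint p (fun x => u x ^+ 2)
    + 4 * (1 + m) * wint p (fun x => Z x * e x)
    - 2 * kap * wint p (fun x => u x * (Lam x + kap * u x)).
  rewrite -!(wint_scale H)// -!(wint_add H) -?(wint_sub H)//; last first.
  all: try by repeat (apply: adm_add => //); exact: adm_scale.
  all: try exact: adm_scale.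
  congr (wint p); apply/funext => x; rewrite /rellich_defect; ring.
rewrite wint_pohozaev wint_mul_laplacian EW => ->; ring.
Qed.

(** A null integral is added to complete the square. Any [phi] is allowed; the gain
    [phit - phi ^+ 2] is the Riccati form of the one-dimensional Hardy inequality. *)
Lemma wint_sqr_euler_shift (phi phit : 'rV[R]_N -> R) :
  (forall i x, x != 0 -> enorm x < D ->
    is_derive x (ei i) phi (x ord0 i / Q x * phit x)) ->
  bc D phi -> bc D phit ->
  wint p (fun x => e x ^+ 2) = wint p (fun x => (e x + phi x * u x) ^+ 2)
    + wint p (fun x => (phit x - phi x ^+ 2) * u x ^+ 2).
Proof.
move=> dphi bphi bphit; have ae := adm_euler_shift.
have a1 : adm D K (fun x => (e x + phi x * u x) ^+ 2).
  by apply: adm_sqr; apply: adm_add => //; exact: adm_mull.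
have a2 : adm D K (fun x => (phit x - phi x ^+ 2) * u x ^+ 2).
  apply: adm_mull; last exact: adm_sqr.
  by apply: bc_sub => //; exact: bc_exp.
have a3 : adm D K (fun x => 2 * (phi x * u x * e x) + phit x * u x ^+ 2).
  apply: adm_add; last by apply: adm_mull => //; exact: adm_sqr.
  by apply: adm_scale; apply: adm_mull => //; apply: bc_mul => //; exact: au.1.
rewrite -[LHS]addr0 -[X in _ + X](wint_radial_weight_eq0 dphi bphi bphit).
rewrite -!(wint_add H)//; last exact: adm_sqr.
by congr (wint p); apply/funext => x; ring.
Qed.

End rellich_identity.

(** * Symmetry of second derivatives *)

Section schwarz.
Context {R : realType} {V : normedModType R}.
Set Implicit Arguments. Unset Strict Implicit.
Implicit Types (f : V -> R) (x v w : V).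

(** The mean value theorem twice: along [v] for the increment of [f] by [h *: w], then along [w] for
    [fv]. *)
Lemma second_difference f (fv fvw : V -> R) x v w (h : R) : 0 < h ->
  (forall y, is_derive y v f (fv y)) -> (forall y, is_derive y w fv (fvw y)) ->
  exists s t : R, [/\ 0 <= s <= h, 0 <= t <= h &
    f (x + h *: v + h *: w) - f (x + h *: v) - f (x + h *: w) + f x =
    h ^+ 2 * fvw (x + s *: v + t *: w)].
Proof.
move=> h0 dv dw.
have cts (g dg : R -> R) : (forall s : R, is_derive s 1 g (dg s)) -> {within `[0, h], continuous g}.
  by move=> dg'; apply: continuous_subspaceT => s; exact: is_derive_continuous.
pose g s := f (x + s *: v + h *: w) - f (x + s *: v).
have dg (s : R) : is_derive s 1 g (fv (x + s *: v + h *: w) - fv (x + s *: v)).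
  apply: is_derive_add; last by apply: is_derive_opp; apply/is_derive_line.
  have : is_derive s 1 (fun s : R => f ((x + h *: w) + s *: v)) (fv ((x + h *: w) + s *: v)).
    exact/is_derive_line.
  by apply: is_derive_fun_eq => [r|]; rewrite addrAC.
have [s sh gE] := MVT h0 (fun s _ => dg s) (cts _ _ dg).
have dk (t : R) : is_derive t 1 (fun t : R => fv (x + s *: v + t *: w)) (fvw (x + s *: v + t *: w)).
  exact/is_derive_line.
have [t th kE] := MVT h0 (fun t _ => dk t) (cts _ _ dk).
exists s, t; split.
- by move: sh; rewrite in_itv/= => /andP[/ltW-> /ltW->].
- by move: th; rewrite in_itv/= => /andP[/ltW-> /ltW->].
move: gE kE; rewrite /g !scale0r !addr0 subr0 => gE kE.
rewrite kE in gE; transitivity (fvw (x + s *: v + t *: w) * h * h); last by ring.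
by rewrite -gE; ring.
Qed.

(** The second difference is symmetric in [v] and [w], hence [h ^+ 2] times either mixed derivative
    at suitable points near [x]; continuity at [x] does the rest. *)
Lemma mixed_derivative_comm f (fv fw fvw fwv : V -> R) x v w :
  (forall y, is_derive y v f (fv y)) -> (forall y, is_derive y w f (fw y)) ->
  (forall y, is_derive y w fv (fvw y)) -> (forall y, is_derive y v fw (fwv y)) ->
  {for x, continuous fvw} -> {for x, continuous fwv} -> fvw x = fwv x.
Proof.
move=> dv dw dvw dwv cvw cwv; apply/eqP; rewrite -subr_eq0 -normr_le0.
apply/ler_addgt0Pr => e e0; rewrite add0r.
have e2 : 0 < e / 2 by rewrite divr_gt0.
have /nbhs_ballP[d1 /= d10 b1] : \forall y \near x, `|fvw x - fvw y| < e / 2.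
  exact: (cvgr_dist_lt _ _ cvw).
have /nbhs_ballP[d2 /= d20 b2] : \forall y \near x, `|fwv x - fwv y| < e / 2.
  exact: (cvgr_dist_lt _ _ cwv).
pose d := Num.min d1 d2.
have d0 : 0 < d by rewrite lt_min d10.
pose c := `|v| + `|w| + 1.
have c0 : 0 < c by rewrite /c ltr_wpDl// addr_ge0.
(* Steps of size at most [h] along [v] and [w] move a point by at most h (|v| + |w|), which is below
   [d]. *)
pose h := d / c / 2.
have h0 : 0 < h by rewrite !divr_gt0.
have near s t : 0 <= s <= h -> 0 <= t <= h -> `|x - (x + s *: v + t *: w)| < d.
  move=> /andP[s0 sh] /andP[t0 th].
  rewrite -addrA opprD addNKr normrN.
  apply: (@le_lt_trans _ _ (h * (`|v| + `|w|))).
    rewrite mulrDr (le_trans (ler_normD _ _))// !normrZ lerD// ler_wpM2r//.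
      by rewrite ger0_norm.
    by rewrite ger0_norm.
  apply: (@lt_trans _ _ (h * c)); first by rewrite ltr_pM2l// /c ltrDl.
  by rewrite /h mulrAC divfK ?gt_eqF//; lra.
have [s [t [sh th E1]]] := second_difference x h0 dv dvw.
have [s' [t' [sh' th' E2]]] := second_difference x h0 dw dwv.
have E : fvw (x + s *: v + t *: w) = fwv (x + s' *: w + t' *: v).
  apply: (@mulfI _ (h ^+ 2)); first by rewrite expf_neq0// gt_eqF.
  by rewrite -E1 -E2 [x + h *: v + h *: w]addrAC; ring.
have l1 : `|fvw x - fvw (x + s *: v + t *: w)| < e / 2.
  apply: b1; rewrite -ball_normE/=; apply: lt_le_trans (near _ _ sh th) _.
  by rewrite ge_min lexx.
have l2 : `|fwv x - fwv (x + s' *: w + t' *: v)| < e / 2.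
  apply: b2; rewrite -ball_normE/= [x + s' *: w + t' *: v]addrAC.
  apply: lt_le_trans (near _ _ th' sh') _.
  by rewrite ge_min lexx orbT.
rewrite E in l1.
have -> : fvw x - fwv x = (fvw x - fwv (x + s' *: w + t' *: v)) -
  (fwv x - fwv (x + s' *: w + t' *: v)) by ring.
apply: le_trans (ler_normB _ _) _.
by rewrite (splitr e) lerD// ltW.
Qed.

End schwarz.

(** * Test functions and their supports *)

Section test_functions.
Context {R : realType} (N : nat).
Set Implicit Arguments. Unset Strict Implicit.
Implicit Types (x : 'rV[R]_N) (i j : 'I_N) (u : 'rV[R]_N -> R) (Omega : set 'rV[R]_N).
Local Notation ei i := (delta_mx ord0 i : 'rV[R]_N).

Definition tsupp u := closure [set x | u x != 0].

Lemma smooth_partial u i : smooth u -> smooth (partial i u).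
Proof.
move=> su s; have := su (rcons s i).
by rewrite /iter_partial -cats1 foldr_cat.
Qed.

Lemma smooth_continuous u : smooth u -> continuous u.
Proof. by move=> su; have [] := su [::]. Qed.

Lemma smooth_is_derive u i x : smooth u -> is_derive x (ei i) u (partial i u x).
Proof. by move=> su; have [_ d] := su [::]; split. Qed.

Lemma partial_comm u i j x : smooth u ->
  partial i (partial j u) x = partial j (partial i u) x.
Proof.
move=> su.
apply: (@mixed_derivative_comm _ _ u (partial j u) (partial i u) _ _ x (ei j) (ei i)).
- by move=> y; exact: smooth_is_derive.
- by move=> y; exact: smooth_is_derive.
- by move=> y; apply: smooth_is_derive; exact: smooth_partial.
- by move=> y; apply: smooth_is_derive; exact: smooth_partial.
- by apply: smooth_continuous; do 2 apply: smooth_partial.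
- by apply: smooth_continuous; do 2 apply: smooth_partial.
Qed.

Lemma off_tsupp u x : ~ tsupp u x -> u x = 0.
Proof.
by move=> ux; apply/eqP; apply: contra_notT ux => ux; exact: subset_closure.
Qed.

Lemma partial_eq0_off (K : set 'rV[R]_N) u i : closed K ->
  (forall x, ~ K x -> u x = 0) -> forall x, ~ K x -> partial i u x = 0.
Proof.
move=> clK u0 x Kx.
rewrite /partial (@near_eq_derive _ _ _ u (cst 0)) ?derive_cst//.
have : \forall y \near x, ~ K y.
  by apply: open_nbhs_nbhs; split => //; exact: closed_openC.
by apply: filterS => y /u0.
Qed.

Lemma compact_support_bounded (K : set 'rV[R]_N) u : compact K -> continuous u ->
  (forall x, ~ K x -> u x = 0) -> exists C : R, forall x, `|u x| <= C.
Proof.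
move=> cK cu u0.
have /compact_bounded[M [Mreal bM]] : compact (u @` K).
  by apply: continuous_compact => //; exact: continuous_subspaceT.
exists (`|M| + 1) => x; have [Kx|Kx] := pselect (K x); last first.
  by rewrite u0// normr0 addr_ge0.
have M1 : M < `|M| + 1 by rewrite (le_lt_trans (ler_norm M))// ltrDl.
by apply: (bM _ M1); exists x.
Qed.

Lemma adm_continuous (D : R) (K : set 'rV[R]_N) u : compact K -> continuous u ->
  (forall x, ~ K x -> u x = 0) -> adm D K u.
Proof.
move=> cK cu u0; split=> //; split=> [x _ _|]; first exact: cu.
by have [C bC] := compact_support_bounded cK cu u0; exists C => x _ _.
Qed.

(** The inequality is strict because [Omega] is open: a point other than the origin can be pushed
    outwards by a factor 1 + d/2 inside [Omega]. *)
Lemma enorm_lt_sup Omega (D : R) : open Omega -> bounded_set Omega ->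
  sup [set enorm x | x in Omega] <= D -> forall x, Omega x -> x != 0 -> enorm x < D.
Proof.
move=> oO bO supD x Ox x0.
have hub : has_ubound [set enorm x | x in Omega].
  have [M [Mreal bM]] := bO.
  have M1 : M < `|M| + 1 by rewrite (le_lt_trans (ler_norm M))// ltrDl.
  exists (Num.sqrt (\sum_(i < N) (`|M| + 1) ^+ 2)) => _ [y Oy <-].
  rewrite ler_sqrt; last by apply: sumr_ge0 => i _; exact: sqr_ge0.
  apply: ler_sum => i _; rewrite -real_normK ?num_real// lerXn2r ?nnegrE ?addr_ge0//.
  by apply: le_trans (coord_le_norm y i) _; exact: bM.
have cl : {for (1 : R), continuous (fun t : R => t *: x)}.
  by apply: (@cvgZl _ _ _ _ _ id); exact: cvg_id.
have : \forall t \near (1 : R), Omega (t *: x).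
  by apply: cl; rewrite scale1r; exact: open_nbhs_nbhs.
move=> /nbhs_ballP[d /= d0 bd].
have Ot : Omega ((1 + d / 2) *: x).
  apply: bd; rewrite -ball_normE/= opprD addrA subrr add0r normrN gtr0_norm ?divr_gt0//.
  by rewrite ltr_pdivrMr// ltr_pMr// ltr1n.
have et : enorm ((1 + d / 2) *: x) = (1 + d / 2) * enorm x.
  rewrite !enormE; have -> : sqnorm ((1 + d / 2) *: x) = (1 + d / 2) ^+ 2 * sqnorm x.
    by rewrite /sqnorm mulr_sumr; apply: eq_bigr => i _; rewrite mxE exprMn.
  by rewrite sqrtrM ?sqr_ge0// sqrtr_sqr ger0_norm// addr_ge0// ltW// divr_gt0.
apply: lt_le_trans supD; apply: (@lt_le_trans _ _ (enorm ((1 + d / 2) *: x))).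
  by rewrite et ltr_pMl ?enorm_gt0// ltrDl divr_gt0.
by apply: ub_le_sup => //; exists ((1 + d / 2) *: x).
Qed.

End test_functions.

(** * Iterated logarithms and test functions *)

Section iterated_logarithms.
Context {R : realType} (N : nat) (D : R).
Set Implicit Arguments. Unset Strict Implicit.
Implicit Types (x : 'rV[R]_N) (i j : 'I_N) (k : nat).
Local Notation ei i := (delta_mx ord0 i : 'rV[R]_N).
Local Notation Q := (@sqnorm R N).
Hypothesis D0 : 0 < D.

(** [Xf 0] is |x|/D itself; the inductions on [k] start from it. *)
Definition Xf k x : R := X k (enorm x / D).
Definition Pf k x : R := \prod_(1 <= j < k.+1) Xf j x.
Definition Sf k x : R := \sum_(1 <= j < k.+1) Pf j x.

Lemma X1_itv (t : R) : 0 < t < 1 -> 0 < X1 t < 1.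
Proof.
move=> t01; have := ln_lt0 t01 => l0; rewrite /X1.
have l1 : 1 < 1 - ln t by lra.
by rewrite invr_gt0 (lt_trans _ l1)// invf_lt1 ?l1// (lt_trans _ l1).
Qed.

Lemma Xf_itv k x : x != 0 -> enorm x < D -> 0 < Xf k x < 1.
Proof.
move=> x0 xD; rewrite /Xf; elim: k => [|k ih].
  by rewrite /X/= divr_gt0 ?enorm_gt0// ltr_pdivrMr// mul1r.
by rewrite /X iterS; exact: X1_itv.
Qed.

Lemma Xf_gt0 k x : x != 0 -> enorm x < D -> 0 < Xf k x.
Proof. by move=> x0 xD; have /andP[] := Xf_itv k x0 xD. Qed.

Lemma Xf_lt1 k x : x != 0 -> enorm x < D -> Xf k x < 1.
Proof. by move=> x0 xD; have /andP[] := Xf_itv k x0 xD. Qed.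

Lemma Pf0 x : Pf 0 x = 1.
Proof. by rewrite /Pf big_geq. Qed.

Lemma PfS k x : Pf k.+1 x = Pf k x * Xf k.+1 x.
Proof. by rewrite /Pf big_nat_recr. Qed.

Lemma Sf0 x : Sf 0 x = 0.
Proof. by rewrite /Sf big_geq. Qed.

Lemma SfS k x : Sf k.+1 x = Sf k x + Pf k.+1 x.
Proof. by rewrite /Sf big_nat_recr. Qed.

Lemma Pf_gt0 k x : x != 0 -> enorm x < D -> 0 < Pf k x.
Proof.
move=> x0 xD; elim: k => [|k ih]; first by rewrite Pf0.
by rewrite PfS mulr_gt0// Xf_gt0.
Qed.

Lemma is_derive_X1 (t : R) : 0 < t < 1 -> is_derive t 1 (@X1 R) (X1 t ^+ 2 / t).
Proof.
move=> /andP[t0 t1]; have l0 : ln t < 0 by rewrite ln_lt0// t0.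
have d1 := is_derive_add (is_derive_const (1 : R) t 1) (is_derive_opp (is_derive1_ln t0)).
have l1 : 1 - ln t != 0 by lra.
have := is_deriveV (f := fun y : R => 1 - ln y) l1 d1.
apply: is_derive_fun_eq => //; rewrite /X1 /GRing.scale/=; field.
by rewrite gt_eqF ?l1.
Qed.

(** The derivative in ln |x| of a radial function is turned into a partial derivative by the factor
    x_i/|x|^2. Inductively X_(k+1)' = (X_(k+1)^2 / X_k) X_k P_k = X_(k+1) P_(k+1). *)
Lemma is_derive_Xf k i x : x != 0 -> enorm x < D ->
  is_derive x (ei i) (Xf k) (x ord0 i / Q x * (Xf k x * Pf k x)).
Proof.
move=> x0 xD; elim: k => [|k ih].
  have := is_derive_mul (is_derive_powR_enorm i 1 x0) (is_derive_const D^-1 x (ei i)).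
  apply: is_derive_fun_eq => [y|].
    by rewrite powRr1 ?enorm_ge0.
  by rewrite mulr0 add0r Pf0 powRr1 ?enorm_ge0// /Xf /X/=; ring.
have := is_derive_compose (is_derive_X1 (Xf_itv k x0 xD)) ih.
apply: is_derive_fun_eq => //.
have -> : X1 (Xf k x) = Xf k.+1 x by [].
by rewrite PfS; field; rewrite !gt_eqF ?sqnorm_gt0 ?Xf_gt0.
Qed.

(** Logarithmic differentiation: the factor X_j contributes P_j, and these add up to S. *)
Lemma is_derive_Pf k i x : x != 0 -> enorm x < D ->
  is_derive x (ei i) (Pf k) (x ord0 i / Q x * (Pf k x * Sf k x)).
Proof.
move=> x0 xD; elim: k => [|k ih].
  have := is_derive_const (1 : R) x (ei i); apply: is_derive_fun_eq => [y|].
    by rewrite Pf0.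
  by rewrite Sf0 !mulr0.
have := is_derive_mul ih (is_derive_Xf k.+1 i x0 xD).
apply: is_derive_fun_eq => [y|]; first by rewrite PfS.
by rewrite SfS PfS; ring.
Qed.

Definition PSf k x : R := \sum_(1 <= j < k.+1) Pf j x * Sf j x.

Lemma is_derive_Sf k i x : x != 0 -> enorm x < D ->
  is_derive x (ei i) (Sf k) (x ord0 i / Q x * PSf k x).
Proof.
move=> x0 xD; rewrite /PSf; elim: k => [|k ih].
  have := is_derive_const (0 : R) x (ei i); apply: is_derive_fun_eq => [y|].
    by rewrite Sf0.
  by rewrite big_geq// mulr0.
have := is_derive_add ih (is_derive_Pf k.+1 i x0 xD).
apply: is_derive_fun_eq => [y|]; first by rewrite SfS.
by rewrite [in RHS]big_nat_recr//= mulrDr.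
Qed.

(** P_j S_j is the sum of P_i P_j over i <= j. Doubling gives every ordered pair once and the
    diagonal once more. *)
Lemma PSfE k x : 2 * PSf k x = Sf k x ^+ 2 + \sum_(1 <= j < k.+1) Pf j x ^+ 2.
Proof.
rewrite /PSf; elim: k => [|k ih]; first by rewrite Sf0 !big_geq// expr0n addr0 mulr0.
by rewrite !(@big_nat_recr _ _ _ k.+1)//= mulrDr ih SfS; ring.
Qed.

Lemma bc_Xf k : bc D (Xf k).
Proof.
split=> [x x0 xD|]; last first.
  by exists 1 => x x0 xD; rewrite ger0_norm ltW ?Xf_gt0 ?Xf_lt1.
elim: k => [|k ih].
  exact: (cvgM (@continuous_enorm R N x) (@cst_continuous _ _ D^-1 x)).
apply: (@continuous_comp _ _ _ (Xf k) (@X1 R)) => //.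
exact: is_derive_continuous (is_derive_X1 (Xf_itv k x0 xD)).
Qed.

Lemma bc_Pf k : bc D (Pf k).
Proof.
elim: k => [|k ih].
  by rewrite (_ : Pf 0 = fun=> 1); [exact: bc_const|apply/funext => x; rewrite Pf0].
rewrite (_ : Pf k.+1 = fun x => Pf k x * Xf k.+1 x).
  by apply: bc_mul => //; exact: bc_Xf.
by apply/funext => x; rewrite PfS.
Qed.

Lemma bc_Sf k : bc D (Sf k).
Proof. by apply: bc_sum => j _; exact: bc_Pf. Qed.

Lemma bc_PSf k : bc D (PSf k).
Proof. by apply: bc_sum => j _; apply: bc_mul; [exact: bc_Pf|exact: bc_Sf]. Qed.

End iterated_logarithms.

(** * The integrals of the inequality for one test function *)

Section test_function_integrals.
Context {R : realType} (N : nat) (hN : (5 <= N)%N) (m : R) (hm0 : 0 <= m)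
  (hm : m < (N%:R - 4) / 2) (Omega : set 'rV[R]_N) (hopen : open Omega)
  (hbnd : bounded_set Omega) (h0 : Omega 0)
  (D : R) (hD : sup [set enorm x | x in Omega] <= D).
Set Implicit Arguments. Unset Strict Implicit.
Implicit Types (x : 'rV[R]_N) (i j : 'I_N) (k : nat) (u : 'rV[R]_N -> R).
Local Notation ei i := (delta_mx ord0 i : 'rV[R]_N).
Local Notation Q := (@sqnorm R N).
Local Notation p := (2 * m + 4).
Local Notation kap := ((N%:R + 2 * m) * (N%:R - 4 - 2 * m) / 4).
Local Notation A := ((1 + m) ^+ 2 + (N%:R + 2 * m) * (N%:R - 4 - 2 * m) / 8).

Lemma radius_gt0 : 0 < D.
Proof.
have lt0 : (0 < N)%N by exact: leq_trans hN.
pose i0 := Ordinal lt0.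
have cl : {for (0 : R), continuous (fun t : R => t *: ei i0)}.
  by apply: (@cvgZl _ _ _ _ _ id); exact: cvg_id.
have : \forall t \near (0 : R), Omega (t *: ei i0).
  by apply: cl; rewrite scale0r; exact: open_nbhs_nbhs.
move=> /nbhs_ballP[d /= d0 bd].
have Ot : Omega ((d / 2) *: ei i0).
  by apply: bd; rewrite -ball_normE/= sub0r normrN gtr0_norm ?divr_gt0//; lra.
apply: le_lt_trans (enorm_lt_sup hopen hbnd hD Ot _); first exact: enorm_ge0.
apply/eqP => /rowP/(_ i0); rewrite !mxE !eqxx mulr1 => /eqP.
by rewrite gt_eqF// divr_gt0.
Qed.

Lemma enorm_lt_radius x : Omega x -> enorm x < D.
Proof.
move=> Ox; have [->|x0] := eqVneq x 0; first by rewrite enorm0 radius_gt0.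
exact: (enorm_lt_sup hopen hbnd hD).
Qed.

Lemma exponent_lt_dim : p < N%:R.
Proof. by move: hm; rewrite ltr_pdivlMr//; lra. Qed.

Lemma kap_gt0 : 0 < kap.
Proof.
have := exponent_lt_dim => pN; rewrite divr_gt0// mulr_gt0//; last by lra.
by rewrite ltr_pwDl// ?mulr_ge0// ltr0n; exact: leq_trans hN.
Qed.

Lemma A_gt0 : 0 < A.
Proof.
have := kap_gt0; rewrite (_ : kap = (N%:R + 2 * m) * (N%:R - 4 - 2 * m) / 8 * 2); last by field.
have := sqr_ge0 (1 + m); lra.
Qed.

Section one_function.
Context u (tu : test_function Omega u).
Local Notation K := (tsupp u).

Lemma tsupp_weight_data : weight_data p D K.
Proof.
case: tu => _ _ KO; split.
- by have := hm0; lra.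
- exact: exponent_lt_dim.
- exact: radius_gt0.
- exact: closed_closure.
- by move=> x /KO; exact: enorm_lt_radius.
Qed.

Lemma adm_iter_partial (s : seq 'I_N) : adm D K (iter_partial s u).
Proof.
case: tu => su cK _; apply: adm_continuous => //; first by have [] := su s.
elim: s => [|i s ih] x Kx; first exact: off_tsupp.
by apply: (partial_eq0_off (K := K)) => //; exact: closed_closure.
Qed.

Local Notation u1 := (fun i => partial i u).
Local Notation u2 := (fun i j => partial i (partial j u)).

Lemma adm_self : adm D K u. Proof. exact: (adm_iter_partial [::]). Qed.
Lemma adm_partial i : adm D K (partial i u). Proof. exact: (adm_iter_partial [:: i]). Qed.
Lemma adm_partial2 i j : adm D K (partial i (partial j u)).
Proof. exact: (adm_iter_partial [:: i; j]). Qed.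

Lemma adm_log k : adm D K (fun x => u x ^+ 2 * Pf D k x ^+ 2).
Proof.
apply: adm_mul; first exact: adm_sqr adm_self.
by apply: bc_exp; apply: bc_Pf; exact: radius_gt0.
Qed.

Lemma hardy_intE : hardy_int m Omega u = (wint p (fun x => u x ^+ 2))%:E.
Proof.
rewrite -(wint_EFin tsupp_weight_data); last exact: adm_sqr adm_self.
rewrite /hardy_int integral_mkcond; apply: eq_integral => x _; rewrite patchE.
case: ifPn => // /negP xO; rewrite off_tsupp ?expr0n ?mul0r// => Kx; apply: xO.
by apply: mem_set; case: tu => _ _; apply.
Qed.

Lemma hardy_log_intE k : hardy_log_int m D k Omega u =
  (wint p (fun x => u x ^+ 2 * Pf D k x ^+ 2))%:E.
Proof.
rewrite -(wint_EFin tsupp_weight_data (adm_log k)).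
rewrite /hardy_log_int integral_mkcond; apply: eq_integral => x _; rewrite patchE.
have E : u x ^+ 2 / enorm x `^ p * \prod_(1 <= j < k.+1) X j (enorm x / D) ^+ 2 =
    u x ^+ 2 * Pf D k x ^+ 2 / enorm x `^ p.
  by rewrite /Pf prodrXl mulrAC.
case: ifPn => [_|/negP xO]; first by rewrite E.
rewrite off_tsupp ?expr0n ?mul0r// => Kx; apply: xO.
by apply: mem_set; case: tu => _ _; apply.
Qed.

Lemma rellich_intE : rellich_int m Omega u = (wint p (fun x => scaled_laplacian u2 x ^+ 2))%:E.
Proof.
have aL : adm D K (scaled_laplacian u2).
  by apply: adm_scaled_laplacian => i j; exact: adm_partial2.
rewrite -(wint_EFin tsupp_weight_data); last exact: adm_sqr aL.
have lap0 x : ~ K x -> laplacian u x = 0.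
  by move=> Kx; apply: big1 => i _; exact: (adm_partial2 i i).2.
pose f x := laplacian u x ^+ 2 / enorm x `^ (2 * m).
transitivity (\int[lebesgue_rV N]_x (f x)%:E)%E.
  rewrite /rellich_int integral_mkcond; apply: eq_integral => x _; rewrite patchE.
  case: ifPn => // /negP xO; rewrite /f lap0 ?expr0n ?mul0r// => Kx; apply: xO.
  by apply: mem_set; case: tu => _ _; apply.
have clap : continuous (laplacian u).
  apply: continuous_big => [|i _]; first exact: add_continuous.
  by case: tu => su _ _; have [] := su [:: i; i].
(* The integrands may differ at the origin: for m = 0 the first one is [laplacian u 0 ^+ 2] there
   and the second is 0. The exceptional set is taken to be a coordinate hyperplane. *)
apply: ae_eq_integral => //.
- apply/measurable_EFinP; apply: measurable_fun_continuous_off0 => x x0.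
  have e0 : enorm x `^ (2 * m) != 0 by rewrite gt_eqF// powR_gt0// enorm_gt0.
  have ce : {for x, continuous (fun y => enorm y `^ (2 * m))}.
    apply: (@continuous_comp _ _ _ (@enorm R N) (fun y : R => y `^ (2 * m))).
      exact: continuous_enorm.
    exact: is_derive_continuous (is_derive1_powR (2 * m) (enorm_gt0 x0)).
  have cl2 : {for x, continuous (fun y => laplacian u y ^+ 2)}.
    apply: (@continuous_comp _ _ _ (laplacian u) (fun t : R => t ^+ 2)).
      exact: clap.
    exact: exprn_continuous.
  exact: (cvgM cl2 (cvgV e0 ce)).
- apply/measurable_EFinP; apply: measurable_fun_continuous_off0 => x x0.
  by apply: (adm_weight_continuous tsupp_weight_data _ x0); exact: adm_sqr.
have lt0 : (0 < N)%N by exact: leq_trans hN.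
exists [set x : 'rV[R]_N | x ord0 (Ordinal lt0) = 0]; split.
- rewrite -[X in measurable X]setTI.
  exact: (@measurable_coord R N _ measurableT [set 0] (measurable_set1 _)).
- exact: lebesgue_rV_hyperplane.
move=> x /= fx; apply: contrapT => xi; apply: fx => _.
have x0 : x != 0 by apply/eqP => x0; apply: xi; rewrite x0 mxE.
rewrite /f /scaled_laplacian -/(laplacian u x); congr (_%:E).
have Q0 := sqnorm_gt0 x0; have e0 := enorm_gt0 x0.
have -> : enorm x `^ p = enorm x `^ (2 * m) * Q x ^+ 2.
  rewrite powRD; last by rewrite (gt_eqF e0) implybT.
  by rewrite powR_mulrn ?enorm_ge0// -sqr_enorm -exprM.
by field; rewrite !gt_eqF ?powR_gt0.
Qed.

Lemma wint_hardy_log k :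
  wint p (fun x => euler_shift m u u1 x ^+ 2) =
  wint p (fun x => (euler_shift m u u1 x + 2^-1 * Sf D k x * u x) ^+ 2)
  + 4^-1 * \sum_(1 <= j < k.+1) wint p (fun x => u x ^+ 2 * Pf D j x ^+ 2).
Proof.
have W := tsupp_weight_data; have au := adm_self; have D0 := radius_gt0.
have N2 : (2 <= N)%N by exact: leq_trans hN.
have du i x : is_derive x (ei i) u (partial i u x).
  by apply: smooth_is_derive; case: tu.
have dphi i x : x != 0 -> enorm x < D ->
    is_derive x (ei i) (fun y => 2^-1 * Sf D k y) (x ord0 i / Q x * (2^-1 * PSf D k x)).
  move=> x0 xD; have := is_derive_mul (is_derive_const 2^-1 x (ei i)) (is_derive_Sf D0 k i x0 xD).
  by apply: is_derive_fun_eq => //; rewrite mul0r addr0; ring.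
have bphi : bc D (fun y : 'rV[R]_N => 2^-1 * Sf D k y).
  by apply: bc_mul; [exact: bc_const|exact: bc_Sf].
have bphit : bc D (fun y : 'rV[R]_N => 2^-1 * PSf D k y).
  by apply: bc_mul; [exact: bc_const|exact: bc_PSf].
rewrite (wint_sqr_euler_shift W N2 du au adm_partial dphi bphi bphit); congr (_ + _).
rewrite -(wint_sum W); last by move=> j _; exact: adm_log.
rewrite -(wint_scale W); last by apply: adm_sum => j _; exact: adm_log.
congr (wint p); apply/funext => x.
rewrite -mulr_sumr (_ : 2^-1 * PSf D k x = 4^-1 * (2 * PSf D k x)); last by field.
by rewrite PSfE; field.
Qed.

(* The three deficit terms are nonnegative, and negligible along the minimising family. *)
Lemma wint_rellich k :
  wint p (fun x => scaled_laplacian u2 x ^+ 2) =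
  kap ^+ 2 * wint p (fun x => u x ^+ 2)
  + A * \sum_(1 <= j < k.+1) wint p (fun x => u x ^+ 2 * Pf D j x ^+ 2)
  + (wint p (fun x => rellich_defect m u u1 u2 x ^+ 2)
     + 4 * A * wint p (fun x => (euler_shift m u u1 x + 2^-1 * Sf D k x * u x) ^+ 2)
     + 2 * kap * wint p (fun x => Q x * grad_sqr u1 x - euler u1 x ^+ 2)).
Proof.
have W := tsupp_weight_data; have au := adm_self.
have N2 : (2 <= N)%N by exact: leq_trans hN.
have su : smooth u by case: tu.
have du i x : is_derive x (ei i) u (partial i u x) by exact: smooth_is_derive.
have du1 i j x : is_derive x (ei i) (partial j u) (partial i (partial j u) x).
  by apply: smooth_is_derive; exact: smooth_partial.
have u2C i j x : partial i (partial j u) x = partial j (partial i u) x by exact: partial_comm.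
rewrite (wint_sqr_laplacian W N2 du du1 u2C au adm_partial adm_partial2).
by rewrite (wint_hardy_log k); field.
Qed.

Lemma wint_rellich_ge k :
  kap ^+ 2 * wint p (fun x => u x ^+ 2)
  + A * \sum_(1 <= j < k.+1) wint p (fun x => u x ^+ 2 * Pf D j x ^+ 2)
  <= wint p (fun x => scaled_laplacian u2 x ^+ 2).
Proof.
rewrite (wint_rellich k) lerDl.
apply: addr_ge0; first apply: addr_ge0.
- by apply: wint_ge0 => x; exact: sqr_ge0.
- apply: mulr_ge0; first by have := A_gt0; lra.
  by apply: wint_ge0 => x; exact: sqr_ge0.
- apply: mulr_ge0; first by have := kap_gt0; lra.
  by apply: wint_ge0 => x; exact: grad_radial_gap_ge0.
Qed.

Lemma wint_log_gt0 k : u <> cst 0 -> 0 < wint p (fun x => u x ^+ 2 * Pf D k x ^+ 2).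
Proof.
move=> u0; have W := tsupp_weight_data.
have su : smooth u by case: tu.
have cu := smooth_continuous su.
(* The weighted integrand is 0 at the origin by convention, so positivity must come from another
   point, supplied by continuity if necessary. *)
have [x [x0 ux]] : exists x, x != 0 /\ u x != 0.
  have [y uy] : exists y, u y != 0.
    apply: contrapT => h; apply: u0; apply/funext => y; apply/eqP.
    by apply: contrapT => /negP uy; apply: h; exists y.
  have [y0|] := eqVneq y 0; last by exists y.
  rewrite {}y0 in uy.
  have lt0 : (0 < N)%N by exact: leq_trans hN.
  pose i0 := Ordinal lt0.
  have cl : {for (0 : R), continuous (fun t : R => `|u (t *: ei i0)|)}.
    apply: (@continuous_comp _ _ _ (fun t : R => u (t *: ei i0)) (fun t : R => `|t|)).
      apply: (@continuous_comp _ _ _ (fun t : R => t *: ei i0) u); last exact: cu.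
      by apply: (@cvgZl _ _ _ _ _ id); exact: cvg_id.
    exact: norm_continuous.
  have n0 : 0 < `|u (0 *: ei i0)| by rewrite scale0r normr_gt0.
  have /nbhs_ballP[d /= d0 bd] : \forall t \near (0 : R), 0 < `|u (t *: ei i0)|.
    exact: (cvgr_gt _ cl).
  exists ((d / 2) *: ei i0); split.
    apply/eqP => /rowP/(_ i0); rewrite !mxE !eqxx mulr1 => /eqP.
    by rewrite gt_eqF// divr_gt0.
  rewrite -normr_gt0; apply: bd.
  by rewrite -ball_normE/= sub0r normrN gtr0_norm ?divr_gt0//; lra.
have Kx : tsupp u x by apply: contrapT => /off_tsupp /eqP; rewrite (negbTE ux).
have xD : enorm x < D by case: W => _ _ _ _; apply.
rewrite -lte_fin -(wint_EFin W (adm_log k)).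
have cw := adm_weight_continuous W (adm_log k).
apply: (@integral_gt0_continuous _ _ _ x).
- exact: measurable_fun_continuous_off0.
- by move=> y; rewrite divr_ge0 ?powR_ge0// mulr_ge0 ?sqr_ge0.
- exact: cw.
- apply: divr_gt0; last by rewrite powR_gt0// enorm_gt0.
  apply: mulr_gt0; first by rewrite exprn_even_gt0.
  by rewrite exprn_gt0// Pf_gt0 ?radius_gt0.
Qed.

End one_function.

End test_function_integrals.

(** * A smooth bump *)

Section differentiability_classes.
Context {R : realType} {V : normedModType R} {I : Type} (dir : I -> V).
Set Implicit Arguments. Unset Strict Implicit.
Implicit Types (f g : V -> R) (U W : set V).

(** Differentiability of class C^n on [U] along the directions [dir]. Derivatives are given by
    witnesses that matter on [U] only, so closure rules and gluing need no explicit formula for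
    iterated derivatives. *)
Fixpoint Cn U (n : nat) f : Prop :=
  (forall x, U x -> {for x, continuous f}) /\
  if n is n'.+1 then
    forall i, exists g, (forall x, U x -> is_derive x (dir i) f (g x)) /\ Cn U n' g
  else True.

Lemma Cn_continuous U n f : Cn U n f -> forall x, U x -> {for x, continuous f}.
Proof. by case: n => [|n] []. Qed.

Lemma Cn_le U n f : Cn U n.+1 f -> Cn U n f.
Proof.
elim: n f => [|n ih] f [cf df]; split => // i.
by have [g [dg /ih Cg]] := df i; exists g.
Qed.

Lemma Cn_const U n (c : R) : Cn U n (fun=> c).
Proof.
elim: n c => [|n ih] c; split => //; try by move=> x _; exact: cst_continuous.
by move=> i; exists (fun=> 0); split => // x _; exact: is_derive_const.
Qed.

Lemma Cn_add U n f g : Cn U n f -> Cn U n g -> Cn U n (fun x => f x + g x).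
Proof.
elim: n f g => [|n ih] f g [cf df] [cg dg]; split => //;
  try by move=> x Ux; exact: (cvgD (cf x Ux) (cg x Ux)).
move=> i; have [f' [df' Cf']] := df i; have [g' [dg' Cg']] := dg i.
exists (fun x => f' x + g' x); split; last exact: ih.
by move=> x Ux; apply: is_derive_add; [exact: df'|exact: dg'].
Qed.

Lemma Cn_mul U n f g : Cn U n f -> Cn U n g -> Cn U n (fun x => f x * g x).
Proof.
elim: n f g => [|n ih] f g Cf Cg; have [cf df] := Cf; have [cg dg] := Cg; split => //;
  try by move=> x Ux; exact: (cvgM (cf x Ux) (cg x Ux)).
move=> i; have [f' [df' Cf']] := df i; have [g' [dg' Cg']] := dg i.
exists (fun x => f x * g' x + f' x * g x); split.
  by move=> x Ux; apply: is_derive_mul; [exact: df'|exact: dg'].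
by apply: Cn_add; apply: ih => //; exact: Cn_le.
Qed.

Lemma Cn_scale U n (c : R) f : Cn U n f -> Cn U n (fun x => c * f x).
Proof. by apply: Cn_mul; exact: Cn_const. Qed.

Lemma Cn_eq_on U n f g : open U -> (forall x, U x -> f x = g x) -> Cn U n f -> Cn U n g.
Proof.
move=> oU fg.
have near x : U x -> \forall y \near x, f y = g y.
  move=> Ux; have : nbhs x U by exact: open_nbhs_nbhs.
  by apply: filterS => y; exact: fg.
have cfg x : U x -> {for x, continuous f} -> {for x, continuous g}.
  move=> Ux cf; rewrite /prop_for/continuous_at -(fg x Ux).
  by apply: cvg_trans cf; apply: near_eq_cvg; exact: near.
case: n => [|n] [cf df]; split => //; try by move=> x Ux; apply: cfg => //; exact: cf.
move=> i; have [f' [df' Cf']] := df i; exists f'; split => // x Ux.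
by apply: is_derive_near (df' x Ux); exact: near.
Qed.

Lemma Cn_union U W n f : open U -> open W -> Cn U n f -> Cn W n f -> Cn (U `|` W) n f.
Proof.
move=> oU oW; elim: n f => [|n ih] f [cU dU] [cW dW]; split => //;
  try by move=> x [/cU|/cW].
move=> i; have [f1 [df1 C1]] := dU i; have [f2 [df2 C2]] := dW i.
(* [f1] and [f2] are derivatives on their own sets only; the total function ['D_(dir i) f] agrees
   with each of them there. *)
exists (fun x => 'D_(dir i) f x); split.
  by move=> x [/df1|/df2] [df _]; split.
apply: ih.
  by apply: Cn_eq_on C1 => // x /df1 [_ ->].
by apply: Cn_eq_on C2 => // x /df2 [_ ->].
Qed.

End differentiability_classes.

Section differentiability_composition.
Context {R : realType}.
Set Implicit Arguments. Unset Strict Implicit.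

Definition C1n (W : set R) (n : nat) (h : R -> R) : Prop := Cn (fun _ : unit => 1 : R) W n h.

Lemma Cn_comp (V : normedModType R) (I : Type) (dir : I -> V) (U : set V) (W : set R) n
    (f : V -> R) (h : R -> R) :
  (forall x, U x -> W (f x)) -> Cn dir U n f -> C1n W n h -> Cn dir U n (fun x => h (f x)).
Proof.
move=> UW; elim: n h => [|n ih] h Cf Ch; have [cf df] := Cf; have [ch dh] := Ch; split => //;
  try by move=> x Ux; apply: continuous_comp; [exact: cf|apply: ch; exact: UW].
move=> i; have [f' [df' Cf']] := df i; have [h' [dh' Ch']] := dh tt.
exists (fun x => h' (f x) * f' x); split.
  by move=> x Ux; apply: is_derive_compose; [apply: dh'; exact: UW|exact: df'].
by apply: Cn_mul => //; apply: ih => //; exact: Cn_le.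
Qed.

Lemma C1n_expR W n : C1n W n (@expR R).
Proof.
elim: n => [|n ih]; split => //; try by move=> x _; exact: continuous_expR.
by move=> i; exists (@expR R); split => // x _; exact: is_derive_expR.
Qed.

Lemma C1n_inv n : C1n [set t : R | 0 < t] n (fun t => t^-1).
Proof.
have d (t : R) : 0 < t -> is_derive t 1 (fun t : R => t^-1) (- (t^-1 * t^-1)).
  move=> t0; have := is_deriveV (f := fun t : R => t) _ (is_derive_id t 1).
  rewrite gt_eqF// => /(_ isT); apply: is_derive_fun_eq => //.
  by rewrite /GRing.scale/= mulr1 -invfM -expr2.
elim: n => [|n ih]; split => //; try by move=> t /d /is_derive_continuous.
move=> i; exists (fun t => -1 * (t^-1 * t^-1)); split.
  by move=> t /d; rewrite mulN1r.
by apply: Cn_scale; exact: Cn_mul.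
Qed.

Lemma C1n_ln n : C1n [set t : R | 0 < t] n (@ln R).
Proof.
case: n => [|n]; split => //; try by move=> t /= t0; exact: is_derive_continuous (is_derive1_ln t0).
move=> i; exists (fun t => t^-1); split; last exact: C1n_inv.
by move=> t /= t0; exact: is_derive1_ln.
Qed.

End differentiability_composition.

Section bump.
Context {R : realType}.
Set Implicit Arguments. Unset Strict Implicit.
Implicit Types (q : {poly R}) (t : R).

(* The functions q(1/t) exp(-1/t) extended by 0 are closed under differentiation. *)
Definition flat q t : R := if 0 < t then q.[t^-1] * expR (- t^-1) else 0.

(** Horner induction on [q], raising [k] by one, leaves only the bound y^j <= j! exp(y). *)
Lemma poly_le_expR q k : exists C : R, 0 <= C /\
  forall y : R, 0 <= y -> `|q.[y]| * y ^+ k <= C * expR y.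
Proof.
have pow j : exists C : R, 0 <= C /\ forall y : R, 0 <= y -> y ^+ j <= C * expR y.
  case: j => [|j].
    exists 1; split => // y y0; rewrite expr0 mul1r.
    by rewrite -expR0 ler_expR.
  exists (j.+1`!%:R); split => // y y0.
  have := expR_ge1Dxn j y0; rewrite -ler_pdivrMl ?ltr0n ?fact_gt0// mulrC.
  by apply: le_trans; rewrite lerDr.
elim/poly_ind: q k => [|q c ih] k.
  by exists 0; split => // y _; rewrite horner0 normr0 !mul0r.
have [C1 [C10 h1]] := ih k.+1; have [C2 [C20 h2]] := pow k.
exists (C1 + `|c| * C2); split; first by rewrite addr_ge0// mulr_ge0.
move=> y y0; rewrite hornerMXaddC.
apply: (@le_trans _ _ (`|q.[y]| * y ^+ k.+1 + `|c| * y ^+ k)).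
  rewrite exprS mulrA -mulrDl ler_wpM2r ?exprn_ge0//.
  by apply: le_trans (ler_normD _ _) _; rewrite normrM (ger0_norm y0).
by rewrite mulrDl lerD ?h1// -mulrA ler_wpM2l ?h2.
Qed.

(** The quadratic bound is what makes the difference quotient at 0 tend to 0. *)
Lemma flat_le q : exists C : R, 0 <= C /\ forall t, `|flat q t| <= C * t ^+ 2.
Proof.
have [C [C0 h]] := poly_le_expR q 2; exists C; split => // t.
rewrite /flat; case: ifPn => [t0|_]; last by rewrite normr0 mulr_ge0// sqr_ge0.
have ti : 0 <= t^-1 by rewrite invr_ge0 ltW.
have := h _ ti; rewrite normrM [`|expR _|]ger0_norm ?expR_ge0// expRN.
rewrite -ler_pdivrMr ?expR_gt0// mulrAC exprVn.
by rewrite ler_pdivrMr ?exprn_gt0// .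
Qed.

(** For t > 0 the derivative of q(1/t) exp(-1/t) is t^(-2) (q - q')(1/t) exp(-1/t). The delicate
    point is t = 0. *)
Lemma is_derive_flat q t : is_derive t 1 (flat q) (flat ('X^2 * (q - q^`())) t).
Proof.
have [t0|t0|->] := ltgtP t 0.
- rewrite [flat _ t]/flat ltNge (ltW t0)/=.
  apply: is_derive_near (is_derive_const 0 t 1).
  have : \forall s \near t, s < 0 by exact: lt_nbhsl.
  by apply: filterS => s s0; rewrite /flat ltNge (ltW s0).
- have di : is_derive t 1 (fun t : R => t^-1) (- (t^-1 * t^-1)).
    have := is_deriveV (f := fun t : R => t) _ (is_derive_id t 1).
    rewrite gt_eqF// => /(_ isT); apply: is_derive_fun_eq => //.
    by rewrite /GRing.scale/= mulr1 -invfM -expr2.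
  have dq := is_derive_poly q t^-1.
  have := is_derive_mul
    (@is_derive_compose _ _ (horner q) (fun t : R => t^-1) t 1 _ _ dq di)
    (@is_derive_compose _ _ (@expR R) (fun t : R => - t^-1) t 1 _ _
      (is_derive_expR (- t^-1)) (is_derive_opp di)).
  move=> h; apply: is_derive_near (is_derive_fun_eq _ _ h); last 2 first.
  - by [].
  - by rewrite /flat t0 hornerM hornerXn hornerD hornerN; ring.
  have : \forall s \near t, 0 < s by exact: lt_nbhsr.
  by apply: filterS => s s0; rewrite /flat s0.
rewrite [flat _ 0]/flat ltxx.
have [C [C0 h]] := flat_le q.
have lim : (fun s : R => s^-1 *: ((flat q \o shift 0) (s *: 1) - flat q 0)) @ 0^' --> (0 : R).
  apply/cvgrPdist_le => e e0; near=> s.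
  rewrite sub0r normrN /= addr0 /flat ltxx subr0 -/(flat q (s *: 1)) [s *: 1]mulr1.
  rewrite [_ *: _]/(_ * _) normrM normfV.
  have s0 : 0 < `|s| by rewrite normr_gt0; near: s; exact: nbhs_dnbhs_neq.
  rewrite ler_pdivrMl//; apply: le_trans (h s) _.
  rewrite -(real_normK (num_real s)) expr2 mulrA [leRHS]mulrC ler_wpM2r//.
  have : `|s| <= e / (C + 1).
    near: s; apply: dnbhs0_le; rewrite divr_gt0//; lra.
  rewrite ler_pdivlMr; last by lra.
  have := normr_ge0 s; nra.
by split; [apply/cvg_ex; exists 0|apply/cvg_lim].
Unshelve. all: by end_near. Qed.

Lemma C1n_flat q n : C1n setT n (flat q).
Proof.
elim: n q => [|n ih] q; split => //;
  try by move=> t _; exact: is_derive_continuous (is_derive_flat q t).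
move=> i; exists (flat ('X^2 * (q - q^`()))); split => // t _.
exact: is_derive_flat.
Qed.

Definition bump01 t : R := flat 1 t * flat 1 (1 - t).

Lemma bump01_eq0 t : ~~ (0 < t < 1) -> bump01 t = 0.
Proof.
rewrite negb_and -!leNgt /bump01 /flat => /orP[t0|t1].
  by rewrite ltNge t0/= mul0r.
by rewrite subr_gt0 [t < 1]ltNge t1/= mulr0.
Qed.

Lemma bump01_gt0 t : 0 < t < 1 -> 0 < bump01 t.
Proof.
move=> /andP[t0 t1]; rewrite /bump01 /flat t0 subr_gt0 t1 !hornerC.
by rewrite !mul1r mulr_gt0 ?expR_gt0.
Qed.

Lemma C1n_bump01 n : C1n setT n bump01.
Proof.
apply: Cn_mul; first exact: C1n_flat.
apply: (@Cn_comp _ _ _ _ _ setT _ (fun t : R => 1 - t) (flat 1)) => //; last exact: C1n_flat.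
apply: Cn_add; first exact: Cn_const.
elim: n => [|n ih]; split => //; try by move=> t _; exact: opp_continuous.
move=> i; exists (fun=> -1); split; last exact: Cn_const.
by move=> t _; apply: is_derive_opp; exact: is_derive_id.
Qed.

End bump.

(** * Primitives with compact support *)

Section compactly_supported_primitive.
Context {R : realType}.
Set Implicit Arguments. Unset Strict Implicit.
Local Notation mu := (@lebesgue_measure R).

Definition supp01 (psi : R -> R) := forall t, ~~ (0 <= t <= 1) -> psi t = 0.

Lemma integrable_continuous_itv (f : R -> R) (a b : R) : continuous f ->
  mu.-integrable `[a, b] (EFin \o f).
Proof.
move=> cf; apply: continuous_compact_integrable; first exact: segment_compact.
exact: continuous_subspaceT.
Qed.

(** [c] is the quotient of the two integrals: then psi1 - c psi0 has integral 0 and its primitive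
    from -1 vanishes outside [0, 1]. The argument of the bump is always above -1, whence the
    restriction on [s]. *)
Lemma supp01_primitive (psi0 psi1 : R -> R) : continuous psi0 -> continuous psi1 ->
  supp01 psi0 -> supp01 psi1 -> \int[mu]_(t in `[-1, 1]) psi0 t != 0 ->
  exists (c : R) (G : R -> R),
    (forall s : R, -1 < s -> is_derive s 1 G (psi1 s - c * psi0 s)) /\
    (forall s, -1 < s -> ~~ (0 <= s <= 1) -> G s = 0).
Proof.
move=> c0 c1 s0 s1 I0.
pose c := (\int[mu]_(t in `[-1, 1]) psi1 t) / (\int[mu]_(t in `[-1, 1]) psi0 t).
pose f t := psi1 t - c * psi0 t.
have cf : continuous f.
  move=> t; apply: (cvgB (c1 t)); apply: (cvgM (@cst_continuous _ _ c t) (c0 t)).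
have f0 : supp01 f by move=> t t01; rewrite /f s0// s1// mulr0 subr0.
have If : \int[mu]_(t in `[-1, 1]) f t = 0.
  rewrite RintegralB//; last 2 first.
  - exact: integrable_continuous_itv.
  - apply: integrable_continuous_itv => t; exact: (cvgM (@cst_continuous _ _ c t) (c0 t)).
  rewrite RintegralZl//; last exact: integrable_continuous_itv.
  by rewrite /c divfK// subrr.
exists c, (fun s => \int[mu]_(t in `[-1, s]) f t); split.
  move=> s s1'.
  have := @continuous_FTC1_closed R f (-1) s (s + 1).
  rewrite ltrDl ltr01 => /(_ isT (integrable_continuous_itv _ _ cf) s1' (cf s)) [dF FE].
  by split => //; rewrite -derive1E FE.
move=> s sm1 s01.
have [sneg|spos] := ltP s 0.
  rewrite (@eq_Rintegral _ _ _ _ _ (cst 0)); last first.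
    move=> t /set_mem/=; rewrite in_itv/= => /andP[_ ts]; apply: f0.
    by rewrite negb_and -ltNge (le_lt_trans ts sneg).
  by rewrite Rintegral_cst// mul0r.
have sgt1 : 1 < s by move: s01; rewrite spos/= -ltNge.
rewrite -[RHS]If Rintegral_mkcond [RHS]Rintegral_mkcond; congr Rintegral.
apply/funext => t; rewrite !patchE.
have [t1|t1] := boolP (0 <= t <= 1).
  have /andP[t0 t1'] := t1.
  rewrite !mem_set//= in_itv/= ?(le_trans _ t0) ?(le_trans t1') ?(ltW sgt1)//; lra.
by rewrite f0//; case: ifP; case: ifP.
Qed.

(** On [1/4, 3/4] each of the two factors of the bump is at least exp(-4). *)
Lemma bump_sqr_integral_gt0 : 0 < \int[mu]_(t in `[-1, 1]) (bump01 t ^+ 2 : R).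
Proof.
have cb : continuous (fun t : R => bump01 t ^+ 2).
  move=> t; apply: (@continuous_comp _ _ _ (@bump01 R) (fun s : R => s ^+ 2)).
    by apply: (Cn_continuous (C1n_bump01 0)).
  exact: exprn_continuous.
have lb (t : R) : 4^-1 <= t -> expR (- 4) <= flat 1 t.
  move=> t4; have t0 : 0 < t by lra.
  rewrite /flat t0 hornerC mul1r ler_expR lerN2.
  by rewrite invf_ple ?posrE// -[X in _ <= X]invrK lef_pV2 ?posrE// ?invr_gt0.
pose d := (expR (- 4) * expR (- 4)) ^+ 2 : R.
have d0 : 0 < d by rewrite exprn_gt0// mulr_gt0 ?expR_gt0.
have bd (t : R) : 4^-1 <= t <= 3 / 4 -> d <= bump01 t ^+ 2.
  move=> /andP[t1 t2].
  have h : expR (- 4) * expR (- 4) <= bump01 t.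
    by rewrite /bump01 ler_pM ?expR_ge0// lb//; lra.
  have e0 : 0 <= expR (- 4) * expR (- 4) :> R by rewrite mulr_ge0 ?expR_ge0.
  by rewrite /d; apply: lerXn2r; rewrite ?nnegrE// (le_trans e0).
have ib := integrable_continuous_itv (-1) 1 cb.
rewrite /Rintegral fine_gt0//; apply/andP; split; last first.
  by have /integrable_fin_num := ib; move=> /(_ _)/fin_numPlt/andP[].
apply: (@lt_le_trans _ _ (\int[mu]_(t in `[4^-1%R, (3 / 4)%R]) (cst d%:E t))%E).
  rewrite integral_cst//= lebesgue_measure_itv/= lte_fin ifT; last by lra.
  by rewrite -EFinB -EFinM lte_fin mulr_gt0//; lra.
apply: (@le_trans _ _ (\int[mu]_(t in `[4^-1%R, (3 / 4)%R]) ((bump01 t ^+ 2)%R)%:E)%E).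
  apply: ge0_le_integral => //.
  - by move=> t _; rewrite lee_fin ltW.
  - apply/measurable_EFinP; apply: measurable_funTS; exact: continuous_measurable_fun.
apply: ge0_subset_integral => //.
- apply/measurable_EFinP; apply: measurable_funTS; exact: continuous_measurable_fun.
- by move=> t _; rewrite lee_fin sqr_ge0.
- by move=> t /=; rewrite !in_itv/= => /andP[t1 t2]; apply/andP; split; lra.
Qed.

End compactly_supported_primitive.

(** * Bounds for the iterated logarithms *)

Section iterated_logarithm_bounds.
Context {R : realType} (N : nat) (D : R).
Set Implicit Arguments. Unset Strict Implicit.
Implicit Types (x : 'rV[R]_N) (k : nat).
Hypothesis D0 : 0 < D.

(** This is ln(1/t) <= 1/t - 1. It makes X_k increase with k, starting from |x|/D. *)
Lemma X1_ge (t : R) : 0 < t < 1 -> t <= X1 t.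
Proof.
move=> /andP[t0 t1]; have l0 : ln t < 0 by rewrite ln_lt0// t0.
rewrite /X1 -[leLHS]invrK lef_pV2 ?posrE ?invr_gt0//; last by lra.
have := @le_ln1Dx R (t^-1 - 1); rewrite addrCA subrr addr0 lnV ?posrE//.
have : 0 < t^-1 by rewrite invr_gt0.
lra.
Qed.

Lemma Xf_le k j x : x != 0 -> enorm x < D -> (k <= j)%N -> Xf D k x <= Xf D j x.
Proof.
move=> x0 xD; elim: j => [|j ih]; first by rewrite leqn0 => /eqP ->.
rewrite leq_eqVlt => /predU1P[->//|/ih kj]; apply: le_trans kj _.
exact: X1_ge (Xf_itv D0 j x0 xD).
Qed.

Lemma Pf_le1 k x : x != 0 -> enorm x < D -> Pf D k x <= 1.
Proof.
move=> x0 xD; elim: k => [|k ih]; first by rewrite Pf0.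
by rewrite PfS mulr_ile1// ?ltW ?Pf_gt0 ?Xf_gt0 ?Xf_lt1.
Qed.

Lemma Pf_leX k x : x != 0 -> enorm x < D -> (0 < k)%N -> Pf D k x <= Xf D k x.
Proof.
move=> x0 xD; case: k => // k _; rewrite PfS ler_piMl ?Pf_le1//.
by rewrite ltW// Xf_gt0.
Qed.

Lemma Pf_leX1 k x : x != 0 -> enorm x < D -> (0 < k)%N -> Pf D k x <= Xf D 1 x.
Proof.
move=> x0 xD; elim: k => // -[_ _|k ih _]; first exact: Pf_leX.
rewrite PfS; apply: le_trans (ih isT); rewrite ler_piMr ?(ltW (Xf_lt1 _ _ _ _))//.
by rewrite ltW// Pf_gt0.
Qed.

(** For k >= 2, P_k X_k >= X_1 X_2^k because X_j >= X_2 for j >= 2; with X_1 = exp(-y) and X_2 =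
    1/(1+y), the exponential beats the power. The second derivative of the profile contains P_1^2 =
    X_1^2, which must be compared with P_k. *)
Lemma sqr_X1_le k : (0 < k)%N -> exists C : R, 0 <= C /\
  forall x, x != 0 -> enorm x < D -> Xf D 1 x ^+ 2 <= C * (Pf D k x * Xf D k x).
Proof.
case: k => // -[_|k _].
  by exists 1; split => // x x0 xD; rewrite PfS Pf0 !mul1r expr2.
pose q := k.+2.
(* The constant comes from (1+y)^q <= q! exp(1+y). *)
exists (q`!%:R * expR 1); split; first by rewrite mulr_ge0 ?expR_ge0.
move=> x x0 xD; have X1p := Xf_gt0 D0 1 x0 xD; have X2p := Xf_gt0 D0 2 x0 xD.
have Pge j : Xf D 1 x * Xf D 2 x ^+ j <= Pf D j.+1 x.
  elim: j => [|j ih]; first by rewrite PfS Pf0 mul1r expr0 mulr1.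
  rewrite PfS exprSr mulrA ler_pM// ?mulr_ge0 ?exprn_ge0 ?(ltW X1p) ?(ltW X2p)//.
  exact: Xf_le.
apply: (@le_trans _ _ (q`!%:R * expR 1 * (Xf D 1 x * Xf D 2 x ^+ k.+1 * Xf D 2 x))); last first.
  rewrite ler_wpM2l ?mulr_ge0 ?expR_ge0//.
  rewrite ler_pM ?Pge ?mulr_ge0 ?exprn_ge0 ?(ltW X1p) ?(ltW X2p)//.
  exact: Xf_le.
have -> : q`!%:R * expR 1 * (Xf D 1 x * Xf D 2 x ^+ k.+1 * Xf D 2 x) =
    Xf D 1 x * (q`!%:R * expR 1 * Xf D 2 x ^+ q) by rewrite /q [_ ^+ k.+2]exprSr; ring.
rewrite expr2 ler_pM2l//.
have -> : Xf D 2 x = (1 - ln (Xf D 1 x))^-1 by [].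
set y := - ln (Xf D 1 x).
have y0 : 0 < y by rewrite oppr_gt0 ln_lt0// Xf_itv.
have -> : Xf D 1 x = expR (- y) by rewrite /y opprK lnK.
have y1 : 0 <= 1 + y by lra.
have y1' : 0 < 1 + y by lra.
have := expR_ge1Dxn k.+1 y1.
have f0 : 0 < q`!%:R :> R by rewrite ltr0n fact_gt0.
move=> h; have {h} : (1 + y) ^+ q / q`!%:R <= expR (1 + y).
  by apply: le_trans h; rewrite lerDr.
rewrite ler_pdivrMr// expRD => h.
rewrite exprVn ler_pdivlMr ?exprn_gt0// expRN ler_pdivrMl ?expR_gt0//.
rewrite (_ : expR y * _ = expR 1 * expR y * q`!%:R)//; ring.
Qed.

(** X_1 is inverted by y -> exp(1 - 1/y). This supplies a point where the bump does not vanish. *)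
Lemma Xf_surj k (y : R) : (0 < N)%N -> 0 < y < 1 ->
  exists x, [/\ x != 0, enorm x < D & Xf D k x = y].
Proof.
move=> N0; elim: k y => [|k ih] y /andP[y0 y1].
  pose i0 := Ordinal N0; pose x : 'rV[R]_N := (y * D) *: delta_mx ord0 i0.
  have yD : 0 < y * D by rewrite mulr_gt0.
  have ex : enorm x = y * D.
    rewrite enormE /sqnorm (bigD1 i0)//= big1 ?addr0.
      by rewrite !mxE !eqxx mulr1 sqrtr_sqr gtr0_norm.
    by move=> j ji; rewrite !mxE (negbTE ji) andbF mulr0 expr0n.
  exists x; split.
  - by apply/eqP => x0; move: yD; rewrite -ex x0 enorm0 ltxx.
  - by rewrite ex -[ltRHS]mul1r ltr_pM2r.
  - by rewrite /Xf /X/= ex mulfK// gt_eqF.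
have yi : 1 < y^-1 by rewrite invf_gt1.
have [|x [x0 xD xy]] := ih (expR (1 - y^-1)).
  by rewrite expR_gt0/= -[ltRHS]expR0 ltr_expR subr_lt0.
exists x; split => //; have -> : Xf D k.+1 x = X1 (Xf D k x) by [].
by rewrite xy /X1 expRK opprB addrCA subrr addr0 invrK.
Qed.

(** A lower bound on X_k is traced back to one on |x|, one logarithm at a time; it keeps the
    supports of the minimising family away from the origin. *)
Lemma Xf_lower k (d : R) : 0 < d -> exists r : R, 0 < r /\
  forall x, x != 0 -> enorm x < D -> d <= Xf D k x -> r <= enorm x.
Proof.
elim: k d => [|k ih] d d0.
  exists (d * D); split; first by rewrite mulr_gt0.
  by move=> x _ _; rewrite /Xf /X/= ler_pdivlMr.
have [r [r0 h]] := ih _ (expR_gt0 (1 - d^-1)).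
exists r; split => // x x0 xD dX; apply: h => //.
have /andP[Xp X1'] := Xf_itv D0 k x0 xD.
have l0 : ln (Xf D k x) < 0 by rewrite ln_lt0// Xp.
rewrite -[leRHS]lnK ?posrE// ler_expR.
have : d <= (1 - ln (Xf D k x))^-1 by [].
rewrite -[leLHS]invrK lef_pV2 ?posrE ?invr_gt0//; lra.
Qed.

End iterated_logarithm_bounds.

(** * The minimising family *)

Section punctured_ball.
Context {R : realType} (N : nat) (D : R).
Set Implicit Arguments. Unset Strict Implicit.
Implicit Types (x : 'rV[R]_N) (i j : 'I_N) (f g : 'rV[R]_N -> R).
Local Notation ei i := (delta_mx ord0 i : 'rV[R]_N).
Local Notation Q := (@sqnorm R N).

Definition punctured : set 'rV[R]_N := [set x | (x != 0) && (enorm x < D)].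

(** Extension by 0: elsewhere the formulas with powers and logarithms yield default or meaningless
    values. *)
Definition guard f x : R := if (x != 0) && (enorm x < D) then f x else 0.

(* f' is the derivative of f with respect to ln |x|. *)
Definition rd f f' : Prop := forall i x, x != 0 -> enorm x < D ->
  is_derive x (ei i) f (x ord0 i / Q x * f' x).

Lemma open_punctured : open punctured.
Proof.
have -> : punctured = (@enorm R N) @^-1` [set t | 0 < t < D].
  apply/seteqP; split => x /=; first by move=> /andP[x0 ->]; rewrite enorm_gt0.
  move=> /andP[x0 xD]; apply/andP; split=> //; apply: contraTneq x0 => ->.
  by rewrite enorm0 ltxx.
apply: open_comp => [x _|]; first exact: continuous_enorm.
rewrite (_ : [set t | 0 < t < D] = `]0, D[%classic); first exact: interval_open.
by apply/seteqP; split => t /=; rewrite in_itv.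
Qed.

Lemma guardE f x : x != 0 -> enorm x < D -> guard f x = f x.
Proof. by move=> x0 xD; rewrite /guard x0 xD. Qed.

Lemma near_guard f x : x != 0 -> enorm x < D -> \forall y \near x, f y = guard f y.
Proof.
move=> x0 xD; have : nbhs x punctured.
  by apply: open_nbhs_nbhs; split; [exact: open_punctured|rewrite /punctured/= x0].
by apply: filterS => y /andP[y0 yD]; rewrite guardE.
Qed.

Lemma rd_guard f f' : rd f f' -> rd (guard f) (guard f').
Proof.
move=> df i x x0 xD; rewrite guardE//.
by apply: is_derive_near (df i x x0 xD); exact: near_guard.
Qed.

Lemma rd_eq f g f' g' : (forall x, x != 0 -> enorm x < D -> f' x = g' x) ->
  f =1 g -> rd f f' -> rd g g'.
Proof.
by move=> fg' /funext -> df i x x0 xD; rewrite -fg'//; exact: df.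
Qed.

Lemma rd_const (c : R) : rd (fun=> c) (fun=> 0).
Proof. by move=> i x _ _; rewrite mulr0; exact: is_derive_const. Qed.

Lemma rd_add f g f' g' : rd f f' -> rd g g' -> rd (fun x => f x + g x) (fun x => f' x + g' x).
Proof.
by move=> df dg i x x0 xD; rewrite mulrDr; apply: is_derive_add; [exact: df|exact: dg].
Qed.

Lemma rd_mul f g f' g' : rd f f' -> rd g g' ->
  rd (fun x => f x * g x) (fun x => f x * g' x + f' x * g x).
Proof.
move=> df dg i x x0 xD; have := is_derive_mul (df i x x0 xD) (dg i x x0 xD).
by apply: is_derive_fun_eq => //; ring.
Qed.

Lemma rd_scale (c : R) f f' : rd f f' -> rd (fun x => c * f x) (fun x => c * f' x).
Proof.
move=> df; apply: rd_eq (rd_mul (rd_const c) df) => // x _ _.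
by rewrite mul0r addr0.
Qed.

Lemma rd_comp (h h' : R -> R) f f' :
  (forall x, x != 0 -> enorm x < D -> is_derive (f x) 1 h (h' (f x))) -> rd f f' ->
  rd (fun x => h (f x)) (fun x => h' (f x) * f' x).
Proof.
move=> dh df i x x0 xD; have := is_derive_compose (dh x x0 xD) (df i x x0 xD).
by apply: is_derive_fun_eq => //; rewrite mulrCA.
Qed.

Lemma rd_powR_enorm (q : R) : rd (fun x => enorm x `^ q) (fun x => q * enorm x `^ q).
Proof.
move=> i x x0 xD; have := is_derive_powR_enorm i q x0.
by apply: is_derive_fun_eq => //; ring.
Qed.

Lemma continuous_powR_enorm (q : R) x : x != 0 -> {for x, continuous (fun y => enorm y `^ q)}.
Proof.
move=> x0; apply: (@continuous_comp _ _ _ (@enorm R N) (fun y : R => y `^ q)).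
  exact: continuous_enorm.
exact: is_derive_continuous (is_derive1_powR q (enorm_gt0 x0)).
Qed.

Context (K : set 'rV[R]_N).
Hypotheses (cK : compact K) (clK : closed K) (KU : K `<=` punctured).

Lemma guard_eq0 f : (forall x, x != 0 -> enorm x < D -> ~ K x -> f x = 0) ->
  forall x, ~ K x -> guard f x = 0.
Proof. by move=> f0 x Kx; rewrite /guard; case: ifPn => // /andP[x0 xD]; exact: f0. Qed.

Lemma guard_continuous f : (forall x, x != 0 -> enorm x < D -> {for x, continuous f}) ->
  (forall x, x != 0 -> enorm x < D -> ~ K x -> f x = 0) -> continuous (guard f).
Proof.
move=> cf f0 x; have [Kx|Kx] := pselect (K x).
  have /andP[x0 xD] := KU Kx; rewrite /continuous_at guardE//.
  by apply: cvg_trans (cf x x0 xD); apply: (@near_eq_cvg _ _ (nbhs x)); exact: near_guard.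
rewrite /continuous_at (guard_eq0 f0 Kx).
apply: (@cvg_near_cst _ _ _ _ (nbhs x)).
have : nbhs x (~` K) by apply: open_nbhs_nbhs; split => //; exact: closed_openC.
by apply: filterS => y; exact: guard_eq0.
Qed.

Lemma guard_adm f : (forall x, x != 0 -> enorm x < D -> {for x, continuous f}) ->
  (forall x, x != 0 -> enorm x < D -> ~ K x -> f x = 0) -> adm D K (guard f).
Proof.
move=> cf f0; apply: adm_continuous => //; first exact: guard_continuous.
exact: guard_eq0.
Qed.

(** The last index of [s] is the innermost derivative, hence the induction from the right. *)
Lemma smooth_Cn f : (forall n, Cn (fun i => ei i) setT n f) -> smooth f.
Proof.
move=> Cf s; elim/last_ind: s f Cf => [|s i ih] f Cf.
  split=> [x|i x]; first exact: (Cn_continuous (Cf 0%N)).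
  by have [_ /(_ i)[g [dg _]]] := Cf 1%N; have [] := dg x I.
rewrite /iter_partial -cats1 foldr_cat -/(iter_partial s (partial i f)).
apply: ih => n; have [_ /(_ i)[g [dg Cg]]] := Cf n.+1.
rewrite (_ : partial i f = g)//; apply/funext => x.
by have [_ <-] := dg x I.
Qed.

(** The space is covered by two open sets, the punctured ball, where the formula holds, and the
    complement of [K], where the function is 0. *)
Lemma guard_smooth f : (forall n, Cn (fun i => ei i) punctured n f) ->
  (forall x, x != 0 -> enorm x < D -> ~ K x -> f x = 0) -> smooth (guard f).
Proof.
move=> Cf f0; apply: smooth_Cn => n.
have -> : [set: 'rV[R]_N] = punctured `|` ~` K.
  apply/esym/seteqP; split => // x _.
  by have [Kx|Kx] := pselect (K x); [left; exact: KU|right].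
apply: Cn_union; [exact: open_punctured|exact: closed_openC| |].
  apply: Cn_eq_on (Cf n); first exact: open_punctured.
  by move=> x /andP[x0 xD]; rewrite guardE.
apply: (@Cn_eq_on _ _ _ _ (~` K) n (fun=> 0)); first exact: closed_openC.
  by move=> x Kx; rewrite (guard_eq0 f0).
exact: Cn_const.
Qed.

End punctured_ball.

Section elementary_Cn.
Context {R : realType} (N : nat) (D : R).
Set Implicit Arguments. Unset Strict Implicit.
Hypothesis D0 : 0 < D.
Local Notation ei := (fun i : 'I_N => (delta_mx ord0 i : 'rV[R]_N)).
Local Notation U := (@punctured R N D).

Lemma Cn_coord n j : Cn ei U n (fun x => x ord0 j).
Proof.
case: n => [|n]; split => //; try by move=> x _; exact: coord_continuous.
move=> i; exists (fun=> (i == j)%:R); split; last exact: Cn_const.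
by move=> x _; exact: is_derive_coord.
Qed.

Lemma Cn_sum (I J : Type) (V : normedModType R) (dir : I -> V) (W : set V) n
    (s : seq J) (F : J -> V -> R) :
  (forall k, Cn dir W n (F k)) -> Cn dir W n (fun x => \sum_(k <- s) F k x).
Proof.
move=> CF; elim: s => [|k s ih].
  rewrite (_ : (fun _ => _) = fun=> 0); first exact: Cn_const.
  by apply/funext => x; rewrite big_nil.
rewrite (_ : (fun _ => _) = fun x => F k x + \sum_(j <- s) F j x); first exact: Cn_add.
by apply/funext => x; rewrite big_cons.
Qed.

Lemma Cn_sqnorm n : Cn ei U n (@sqnorm R N).
Proof. by apply: Cn_sum => j; apply: Cn_mul; exact: Cn_coord. Qed.

Lemma Cn_powR n (f : 'rV[R]_N -> R) (q : R) : (forall x, U x -> 0 < f x) ->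
  Cn ei U n f -> Cn ei U n (fun x => f x `^ q).
Proof.
move=> f0 Cf; apply: (@Cn_eq_on _ _ _ _ _ _ (fun x => expR (q * ln (f x)))).
- exact: open_punctured.
- by move=> x Ux; rewrite /powR gt_eqF// f0.
apply: (@Cn_comp _ _ _ _ _ setT _ (fun x => q * ln (f x)) (@expR R)) => //; last exact: C1n_expR.
by apply: Cn_scale; apply: Cn_comp Cf (C1n_ln n).
Qed.

Lemma Cn_powR_enorm n (q : R) : Cn ei U n (fun x => enorm x `^ q).
Proof.
rewrite (_ : (fun _ => _) = fun x => sqnorm x `^ (q / 2)).
  apply: Cn_powR; last exact: Cn_sqnorm.
  by move=> x /andP[x0 _]; exact: sqnorm_gt0.
by apply/funext => x; rewrite powR_enorm.
Qed.

Lemma Cn_Xf n k : Cn ei U n (Xf D k).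
Proof.
elim: k => [|k ih].
  rewrite (_ : Xf D 0 = fun x => enorm x `^ 1 * D^-1).
    by apply: Cn_mul; [exact: Cn_powR_enorm|exact: Cn_const].
  by apply/funext => x; rewrite powRr1 ?enorm_ge0.
have -> : @Xf R N D k.+1 = fun x => (1 + (-1) * ln (Xf D k x))^-1.
  by apply/funext => x; rewrite mulN1r.
apply: Cn_comp (C1n_inv n).
  move=> x /andP[x0 xD] /=; have := ln_lt0 (Xf_itv D0 k x0 xD); lra.
apply: Cn_add; first exact: Cn_const.
apply: Cn_scale; apply: Cn_comp ih (C1n_ln n).
by move=> x /andP[x0 xD]; exact: Xf_gt0.
Qed.

Lemma Cn_Pf n k : Cn ei U n (Pf D k).
Proof.
elim: k => [|k ih].
  by rewrite (_ : Pf D 0 = fun=> 1); [exact: Cn_const|apply/funext => x; rewrite Pf0].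
rewrite (_ : Pf D k.+1 = fun x => Pf D k x * Xf D k.+1 x); last by apply/funext => x; rewrite PfS.
by apply: Cn_mul => //; exact: Cn_Xf.
Qed.

End elementary_Cn.

Section bump_derivatives.
Context {R : realType}.
Set Implicit Arguments. Unset Strict Implicit.

Lemma supp01_derive (f g : R -> R) : supp01 f -> (forall t : R, is_derive t 1 f (g t)) -> supp01 g.
Proof.
move=> f0 df t t01; have [_ <-] := df t.
rewrite (@near_eq_derive _ _ _ f (cst 0)) ?derive_cst//.
move: t01; rewrite negb_and -!ltNge => /orP[t0|t1].
  have : \forall s \near t, s < 0 by exact: lt_nbhsl.
  by apply: filterS => s s0; apply: f0; rewrite negb_and -!ltNge s0.
have : \forall s \near t, 1 < s by exact: lt_nbhsr.
by apply: filterS => s s1; apply: f0; rewrite negb_and -!ltNge s1 orbT.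
Qed.

Lemma bump01_derivatives : exists b1 b2 : R -> R,
  [/\ forall t : R, is_derive t 1 (@bump01 R) (b1 t), forall t : R, is_derive t 1 b1 (b2 t),
    continuous b2, supp01 b1 & supp01 b2].
Proof.
have [_ /(_ tt)[b1 [d1 [_ /(_ tt)[b2 [d2 [c2 _]]]]]]] := @C1n_bump01 R 2.
have s1 : supp01 b1.
  apply: supp01_derive (fun t => d1 t I) => t t01; apply: bump01_eq0.
  by apply: contra t01 => /andP[/ltW-> /ltW->].
exists b1, b2; split => //.
- by move=> t; exact: d1.
- by move=> t; exact: d2.
- by move=> t; exact: c2.
- by apply: supp01_derive s1 _ => t; exact: d2.
Qed.

End bump_derivatives.

Section minimising_family.
Context {R : realType} (N : nat) (m D : R) (k n : nat).
Set Implicit Arguments. Unset Strict Implicit.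
Implicit Types (x : 'rV[R]_N) (i j : 'I_N) (psi : R -> R).
Local Notation ei i := (delta_mx ord0 i : 'rV[R]_N).
Local Notation Q := (@sqnorm R N).
Let a : R := (N%:R - 4 - 2 * m) / 2.
Let nr : R := n%:R.
Hypotheses (D0 : 0 < D) (k0 : (0 < k)%N) (n0 : (0 < n)%N).
Context (b1 b2 : R -> R).
Hypothesis db0 : forall t : R, is_derive t 1 (@bump01 R) (b1 t).
Hypothesis db1 : forall t : R, is_derive t 1 b1 (b2 t).
Hypothesis cb2 : continuous b2.
Hypotheses (sb1 : supp01 b1) (sb2 : supp01 b2).

Let nr0 : 0 < nr. Proof. by rewrite /nr ltr0n. Qed.

Let sb0 : supp01 (@bump01 R).
Proof.
move=> t t01; apply: bump01_eq0; apply: contra t01 => /andP[/ltW-> /ltW->]//.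
Qed.

Let cb0 : continuous (@bump01 R).
Proof. by move=> t; exact: is_derive_continuous (db0 t). Qed.

Let cb1 : continuous b1.
Proof. by move=> t; exact: is_derive_continuous (db1 t). Qed.

(* -ln X_k, rescaled so that the bump lives where n <= -ln X_k <= 2n. *)
Definition log_arg x : R := - ln (Xf D k x) / nr - 1.
(** It solves M' + S M / 2 = 0 in ln |x|, so that |x|^(-a) M annihilates the square e + S u / 2 left
    over in the Hardy identity. *)
Definition ground_state x : R := Pf D k x `^ (- 2^-1).
Definition bump_at x : R := bump01 (log_arg x).
Definition bump_at1 x : R := b1 (log_arg x) / nr.
Definition bump_at2 x : R := b2 (log_arg x) / nr ^+ 2.
Definition P2f x : R := \sum_(1 <= j < k.+1) Pf D j x ^+ 2.

Local Notation P := (Pf D k).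
Local Notation S := (Sf D k).
Local Notation ar := log_arg.
Local Notation M := ground_state.

(* The profile w = P_k^(-1/2) chi and its first two derivatives in ln |x|. *)
Definition profile x : R := M x * bump_at x.
Definition profile1 x : R := M x * (- (2^-1 * (S x * bump_at x)) - P x * bump_at1 x).
Definition profile2 x : R := M x * (- (4^-1 * (P2f x * bump_at x)) + P x ^+ 2 * bump_at2 x).
Definition rho x : R := enorm x `^ (- a).

Definition v0 x : R := rho x * profile x.
Definition v1 x : R := rho x * (profile1 x - a * profile x).
Definition v2 x : R := rho x * (profile2 x - 2 * a * profile1 x + a ^+ 2 * profile x).

Definition minimiser : 'rV[R]_N -> R := guard D v0.

Lemma rd_log_arg : rd D ar (fun x => - P x / nr).
Proof.
have dX : rd D (@Xf R N D k) (fun x => Xf D k x * P x).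
  by move=> i x x0 xD; exact: is_derive_Xf.
have dl : rd D (fun x => ln (Xf D k x)) (fun x => (Xf D k x)^-1 * (Xf D k x * P x)).
  apply: (rd_comp (h := @ln R) (h' := fun t => t^-1)) dX => x x0 xD.
  by apply: is_derive1_ln; exact: Xf_gt0.
have := rd_add (rd_scale (- nr^-1) dl) (rd_const (-1)).
apply: rd_eq => [x x0 xD|x]; last by rewrite /log_arg; ring.
rewrite mulKf ?gt_eqF ?Xf_gt0//; ring.
Qed.

Lemma rd_ground_state : rd D M (fun x => - (2^-1 * (S x * M x))).
Proof.
have dP : rd D (@Pf R N D k) (fun x => P x * S x).
  by move=> i x x0 xD; exact: is_derive_Pf.
have dh x : x != 0 -> enorm x < D ->
    is_derive (P x) 1 (fun t : R => t `^ (- 2^-1)) (- 2^-1 * P x `^ (- 2^-1 - 1)).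
  by move=> x0 xD; apply: is_derive1_powR; exact: Pf_gt0.
have := @rd_comp _ _ _ (fun t : R => t `^ (- 2^-1)) (fun t => - 2^-1 * t `^ (- 2^-1 - 1)) _ _ dh dP.
apply: rd_eq => // x x0 xD; have Pp := Pf_gt0 D0 k x0 xD.
rewrite /ground_state powRB ?powRr1 ?(ltW Pp)//; last by rewrite (gt_eqF Pp) implybT.
by field; rewrite gt_eqF.
Qed.

Lemma rd_bump_at : rd D bump_at (fun x => - (P x * bump_at1 x)).
Proof.
have := @rd_comp _ _ _ (@bump01 R) b1 _ _ (fun x _ _ => db0 (ar x)) rd_log_arg.
by apply: rd_eq => // x x0 xD; rewrite /bump_at1; ring.
Qed.

Lemma rd_bump_at1 : rd D bump_at1 (fun x => - (P x * bump_at2 x)).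
Proof.
have := rd_scale nr^-1 (@rd_comp _ _ _ b1 b2 _ _ (fun x _ _ => db1 (ar x)) rd_log_arg).
apply: rd_eq => [x x0 xD|x]; last by rewrite /bump_at1 mulrC.
by rewrite /bump_at2; field; rewrite gt_eqF.
Qed.

Let rdP : rd D (@Pf R N D k) (fun x => P x * S x).
Proof. by move=> i x x0 xD; exact: is_derive_Pf. Qed.

Let rdS : rd D (@Sf R N D k) (@PSf R N D k).
Proof. by move=> i x x0 xD; exact: is_derive_Sf. Qed.

Lemma rd_profile : rd D profile profile1.
Proof.
have := rd_mul rd_ground_state rd_bump_at.
by apply: rd_eq => // x x0 xD; rewrite /profile1; ring.
Qed.

(** The terms in [bump_at1] cancel, and S^2 - 2 S' = - [P2f]. All that is left is quadratic in the
    P_j, which is why the Rellich defect is small. *)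
Lemma rd_profile1 : rd D profile1 profile2.
Proof.
have := rd_mul rd_ground_state (rd_add (rd_scale (- 2^-1) (rd_mul rdS rd_bump_at))
  (rd_scale (-1) (rd_mul rdP rd_bump_at1))).
apply: rd_eq => [x x0 xD|x]; last by rewrite /profile1; ring.
rewrite /profile2 (_ : PSf D k x = 2^-1 * (2 * PSf D k x)); last by field.
by rewrite PSfE -/(P2f x); field.
Qed.

Let rd_rho : rd D rho (fun x => - a * rho x).
Proof. exact: rd_powR_enorm. Qed.

Lemma rd_v0 : rd D v0 v1.
Proof.
have := rd_mul rd_rho rd_profile.
by apply: rd_eq => // x x0 xD; rewrite /v1; ring.
Qed.

Lemma rd_v1 : rd D v1 v2.
Proof.
have := rd_mul rd_rho (rd_add rd_profile1 (rd_scale (- a) rd_profile)).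
apply: rd_eq => [x x0 xD|x]; last by rewrite /v1; ring.
by rewrite /v2; ring.
Qed.

Lemma log_arg_gtN1 x : x != 0 -> enorm x < D -> -1 < ar x.
Proof.
move=> x0 xD; rewrite /log_arg -[ltLHS]add0r ltrD2r divr_gt0// oppr_gt0.
exact: ln_lt0 (Xf_itv D0 k x0 xD).
Qed.

Lemma Xf_le_of_arg x : x != 0 -> enorm x < D -> 0 <= ar x -> Xf D k x <= expR (- nr).
Proof.
move=> x0 xD; rewrite /log_arg subr_ge0 ler_pdivlMr// mul1r => h.
by rewrite -[leLHS]lnK ?posrE ?Xf_gt0// ler_expR lerNr.
Qed.

Lemma Xf_ge_of_arg x : x != 0 -> enorm x < D -> ar x <= 1 -> expR (- (2 * nr)) <= Xf D k x.
Proof.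
move=> x0 xD; rewrite /log_arg lerBlDr ler_pdivrMr// => h.
by rewrite -[leRHS]lnK ?posrE ?Xf_gt0// ler_expR lerNl; lra.
Qed.

(** Contains the support of the bump: there |x|/D <= X_k <= exp(-n) gives the outer radius, and X_k
    >= exp(-2n) an inner one. *)
Definition annulus (r : R) : set 'rV[R]_N := [set x | r <= enorm x <= D * expR (- nr)].

Definition annulus_radius (r : R) := 0 < r /\
  forall x, x != 0 -> enorm x < D -> expR (- (2 * nr)) <= Xf D k x -> r <= enorm x.

Lemma annulus_radius_exists : exists r, annulus_radius r.
Proof. exact: Xf_lower D0 k _ (expR_gt0 _). Qed.

Context (r : R).
Hypothesis hr : annulus_radius r.
Local Notation K := (annulus r).

Lemma closed_annulus : closed K.
Proof.
have -> : K = (@enorm R N) @^-1` `[r, D * expR (- nr)]%classic.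
  by apply/seteqP; split => x /=; rewrite in_itv.
by apply: closed_comp => [x _|]; [exact: continuous_enorm|exact: interval_closed].
Qed.

Lemma compact_annulus : compact K.
Proof.
apply: bounded_closed_compact closed_annulus.
exists (D * expR (- nr)); split; first exact: num_real.
move=> M MD x /andP[_ xD]; apply/ltW/(le_lt_trans _ MD).
exact: le_trans (norm_le_enorm x) xD.
Qed.

Lemma annulus_sub : K `<=` punctured D.
Proof.
move=> x /andP[rx xD]; apply/andP; split.
  apply: contraTneq rx => ->; rewrite enorm0 -ltNge; exact: hr.1.
apply: le_lt_trans xD _; rewrite -[ltRHS]mulr1 ltr_pM2l// -expR0 ltr_expR.
by rewrite oppr_lt0.
Qed.

Lemma arg_off_annulus x : x != 0 -> enorm x < D -> ~ K x -> ~~ (0 <= ar x <= 1).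
Proof.
move=> x0 xD; apply: contra_notN => /andP[h1 h2]; apply/andP; split.
  by apply: hr.2 => //; exact: Xf_ge_of_arg.
rewrite mulrC -ler_pdivrMr//; apply: le_trans (Xf_le_of_arg x0 xD h1).
exact: (Xf_le D0 x0 xD (leq0n k)).
Qed.

Lemma continuous_log_arg x : x != 0 -> enorm x < D -> {for x, continuous ar}.
Proof.
move=> x0 xD.
have cl : {for x, continuous (fun y => ln (Xf D k y))}.
  apply: (@continuous_comp _ _ _ (Xf D k) (@ln R)); first exact: (bc_Xf N D0 k).1.
  exact: is_derive_continuous (is_derive1_ln (Xf_gt0 D0 k x0 xD)).
apply: (@continuous_comp _ _ _ (fun y => ln (Xf D k y)) (fun t : R => - t / nr - 1)) => //.
have dt (t : R) := is_derive_add (is_derive_mul (is_derive_opp (is_derive_id t (1 : R)))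
  (is_derive_const nr^-1 t 1)) (is_derive_const (-1) t 1).
exact: is_derive_continuous (dt _).
Qed.

Lemma adm_guard_supp (F : 'rV[R]_N -> R) psi :
  (forall x, x != 0 -> enorm x < D -> {for x, continuous F}) ->
  (forall x, x != 0 -> enorm x < D -> {for ar x, continuous psi}) ->
  (forall s, -1 < s -> ~~ (0 <= s <= 1) -> psi s = 0) ->
  adm D K (guard D (fun x => F x * psi (ar x))).
Proof.
move=> cF cpsi s0; apply: guard_adm; [exact: compact_annulus|exact: closed_annulus|exact: annulus_sub| |].
  move=> x x0 xD; have cp : {for x, continuous (fun y => psi (ar y))}.
    by apply: continuous_comp; [exact: continuous_log_arg|exact: cpsi].
  exact: (cvgM (cF x x0 xD) cp).
move=> x x0 xD Kx; rewrite s0 ?mulr0//; first exact: log_arg_gtN1.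
exact: arg_off_annulus.
Qed.

(** The derivative of [ar] in ln |x| is -P/n, so the weighted integral of this density is formally n
    times the area of the sphere times the integral of [psi]. *)
Definition Phi psi : 'rV[R]_N -> R := guard D (fun x => rho x ^+ 2 * P x * psi (ar x)).

Lemma continuous_rho_sqr x : x != 0 -> {for x, continuous (fun y => rho y ^+ 2)}.
Proof.
move=> x0; apply: (@continuous_comp _ _ _ rho (fun t : R => t ^+ 2)).
  exact: continuous_powR_enorm.
exact: exprn_continuous.
Qed.

Lemma adm_Phi psi : continuous psi -> supp01 psi -> adm D K (Phi psi).
Proof.
move=> cpsi spsi; apply: adm_guard_supp => [x x0 xD|x _ _|s _]; last exact: spsi.
  exact: (cvgM (continuous_rho_sqr x0) ((bc_Pf N D0 k).1 x x0 xD)).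
exact: cpsi.
Qed.

Hypotheses (N2 : (2 <= N)%N) (p0 : 0 < 2 * m + 4) (pN : 2 * m + 4 < N%:R).
Local Notation p := (2 * m + 4).

Lemma annulus_weight_data : weight_data p D K.
Proof.
split => //; first exact: closed_annulus.
by move=> x /annulus_sub /andP[].
Qed.

(** The divergence of |x|^(-p) rho^2 G(ar) x is -1/n times the weighted density of psi1 - c psi0;
    the remaining terms cancel by N - p = 2a. This stands in for the change of variables to [ar]. *)
Lemma wint_Phi_proportional psi0 psi1 (c : R) (G : R -> R) :
  continuous psi0 -> continuous psi1 -> supp01 psi0 -> supp01 psi1 ->
  (forall s : R, -1 < s -> is_derive s 1 G (psi1 s - c * psi0 s)) ->
  (forall s, -1 < s -> ~~ (0 <= s <= 1) -> G s = 0) ->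
  wint p (Phi psi1) = c * wint p (Phi psi0).
Proof.
move=> c0 c1 s0 s1 dG G0; have W := annulus_weight_data.
pose f s := psi1 s - c * psi0 s.
have cf : continuous f.
  by move=> t; exact: (cvgB (c1 t) (cvgM (@cst_continuous _ _ c t) (c0 t))).
have sf : supp01 f by move=> t t01; rewrite /f s0// s1// mulr0 subr0.
pose be x := rho x ^+ 2 * G (ar x).
pose be' x := (- 2 * a) * be x - nr^-1 * (rho x ^+ 2 * P x * f (ar x)).
have drho2 : rd D (fun x => rho x ^+ 2) (fun x => - 2 * a * rho x ^+ 2).
  have := rd_mul rd_rho rd_rho; apply: rd_eq => [x _ _|x]; last by rewrite expr2.
  by rewrite expr2; ring.
have dbe : rd D be be'.
  have dh x : x != 0 -> enorm x < D -> is_derive (ar x) 1 G (f (ar x)).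
    by move=> x0 xD; apply: dG; exact: log_arg_gtN1.
  have dGa := @rd_comp _ _ _ G f _ _ dh rd_log_arg.
  have := rd_mul drho2 dGa.
  by apply: rd_eq => // x x0 xD; rewrite /be' /be; ring.
have abe : adm D K (guard D be).
  apply: adm_guard_supp => [x x0 xD|x x0 xD|//]; first exact: continuous_rho_sqr.
  exact: is_derive_continuous (dG _ (log_arg_gtN1 x0 xD)).
have aPf := adm_Phi cf sf.
have be'E x : guard D be' x = (- 2 * a) * guard D be x - nr^-1 * Phi f x.
  by rewrite /Phi /guard; case: ifP => //; rewrite !mulr0 subr0.
have abe' : adm D K (guard D be').
  rewrite (_ : guard D be' = fun x => (- 2 * a) * guard D be x - nr^-1 * Phi f x).
    by apply: adm_sub; exact: adm_scale.
  by apply/funext => x; exact: be'E.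
have a0 : adm D K (fun=> 0) by split=> //; exact: bc_const.
have adbe i : adm D K (fun x => x ord0 i * (x ord0 i / Q x * guard D be' x)).
  have : adm D K (fun x => x ord0 i ^+ 2 / Q x * guard D be' x).
    by apply: adm_mull => //; exact: bc_sqr_coord_ratio.
  by congr adm; apply/funext => x; ring.
have E1 := @wint_div_eq0 _ _ _ _ _ W N2 (fun i x => 0) (fun i x => 0) (guard D be)
  (fun i x => x ord0 i / Q x * guard D be' x)
  (fun i x _ _ => is_derive_const 0 x (ei i)) (rd_guard dbe) (fun=> a0) abe (fun=> a0) adbe.
have E2 : wint p (Phi f) = 0.
  apply: (@mulfI _ (- nr^-1)); first by rewrite oppr_eq0 invr_eq0 gt_eqF.
  rewrite mulr0 -(wint_scale W)// -[RHS]E1; apply: (eq_wint W); last 2 first.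
  - exact: adm_scale.
  - apply: adm_add; last exact: adm_sum.
    apply: adm_add; last exact: adm_scale.
    apply: adm_add; last by apply: adm_mull; [exact: bc_sqnorm|apply: adm_sum].
    by apply: adm_scale; apply: adm_sum => i _; apply: adm_mull => //; exact: bc_coord.
  move=> x x0 xD _.
  rewrite [X in (2 - p) * X]big1 => [|i _]; last by rewrite mulr0.
  rewrite [X in Q x * X]big1//.
  have -> : \sum_i x ord0 i * (x ord0 i / Q x * guard D be' x) = Q x / Q x * guard D be' x.
    by rewrite {2}/sqnorm !mulr_suml; apply: eq_bigr => i _; ring.
  by rewrite mulfV ?gt_eqF ?sqnorm_gt0// mul1r be'E /a; field; rewrite gt_eqF.
apply/eqP; rewrite -subr_eq0 -(wint_scale W); last exact: adm_Phi.
rewrite -(wint_sub W); [|exact: adm_Phi|by apply: adm_scale; exact: adm_Phi].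
rewrite -E2; apply/eqP; congr (wint p); apply/funext => x.
by rewrite /Phi /guard; case: ifP => _; rewrite /f; ring.
Qed.

Context (Omega : set 'rV[R]_N) (hK : K `<=` Omega).
Local Notation u := minimiser.

Lemma v0_off_annulus x : x != 0 -> enorm x < D -> ~ K x -> v0 x = 0.
Proof.
move=> x0 xD Kx; rewrite /v0 /profile /bump_at sb0 ?mulr0//.
exact: arg_off_annulus.
Qed.

Lemma minimiser_off_annulus x : ~ K x -> u x = 0.
Proof. by apply: guard_eq0 => y; exact: v0_off_annulus. Qed.

Lemma tsupp_minimiser : tsupp u `<=` K.
Proof.
have /closure_id -> := closed_annulus.
apply: closure_subset => x /= ux; apply: contrapT => Kx.
by rewrite minimiser_off_annulus// eqxx in ux.
Qed.

Lemma test_minimiser : test_function Omega u.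
Proof.
split; last exact: subset_trans tsupp_minimiser hK.
  apply: (guard_smooth closed_annulus annulus_sub _ v0_off_annulus) => q.
  apply: Cn_mul; first exact: Cn_powR_enorm.
  apply: Cn_mul.
    by apply: Cn_powR; [move=> x /andP[x0 xD]; exact: Pf_gt0|exact: Cn_Pf].
  apply: (@Cn_comp _ _ _ _ _ setT _ ar (@bump01 R)) => //; last exact: C1n_bump01.
  rewrite (_ : ar = fun x => (- nr^-1) * ln (Xf D k x) + (-1)).
    apply: Cn_add; last exact: Cn_const.
    have Xp x : punctured D x -> [set t : R | 0 < t] (Xf D k x).
      by move=> /andP[x0 xD]; exact: Xf_gt0.
    apply: Cn_scale; exact: (Cn_comp Xp (Cn_Xf N D0 q k) (C1n_ln q)).
  by apply/funext => x; rewrite /log_arg; ring.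
apply: (subclosed_compact _ compact_annulus tsupp_minimiser).
exact: closed_closure.
Qed.

Lemma minimiser_neq0 : u <> cst 0.
Proof.
(* - ln X_k = 3n/2 places the argument at 1/2, the middle of the bump. *)
have y1 : 0 < expR (- (3 / 2 * nr)) < 1.
  by rewrite expR_gt0/= -[ltRHS]expR0 ltr_expR oppr_lt0 mulr_gt0.
have [x [x0 xD xy]] := Xf_surj D0 k (ltnW N2) y1.
move=> /(congr1 (fun f => f x)); rewrite /minimiser guardE// => /eqP; apply/negP.
rewrite gt_eqF// /v0 mulr_gt0 ?powR_gt0 ?enorm_gt0// mulr_gt0 ?powR_gt0 ?Pf_gt0//.
apply: bump01_gt0; rewrite /log_arg xy expRK opprK mulfK ?gt_eqF//.
by apply/andP; split; lra.
Qed.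

Lemma partial_minimiser i x : x != 0 -> enorm x < D ->
  partial i u x = x ord0 i / Q x * v1 x.
Proof.
by move=> x0 xD; have [_] := rd_guard rd_v0 i x0 xD; rewrite guardE.
Qed.

Lemma partial2_minimiser i x : x != 0 -> enorm x < D ->
  partial i (partial i u) x = (Q x)^-1 * v1 x + x ord0 i ^+ 2 / Q x ^+ 2 * (v2 x - 2 * v1 x).
Proof.
move=> x0 xD; have Q0 := sqnorm_gt0 x0.
have dQ : is_derive x (ei i) (fun y => (Q y)^-1) (- (Q x ^+ 2)^-1 * (2 * x ord0 i)).
  have di : is_derive (Q x) 1 (fun t : R => t^-1) (- (Q x ^+ 2)^-1).
    have := is_deriveV (f := fun t : R => t) _ (is_derive_id (Q x) 1).
    rewrite gt_eqF// => /(_ isT); apply: is_derive_fun_eq => //.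
    by rewrite /GRing.scale/= mulr1.
  exact: (@is_derive_compose _ _ _ Q x (ei i) _ _ di (is_derive_sqnorm x i)).
have h := is_derive_mul (is_derive_mul (is_derive_coord x i i) dQ) (rd_v1 i x0 xD).
have : is_derive x (ei i) (partial i u) ((Q x)^-1 * v1 x + x ord0 i ^+ 2 / Q x ^+ 2 * (v2 x - 2 * v1 x)).
  have h' : is_derive x (ei i) (fun y => y ord0 i / Q y * v1 y)
      ((Q x)^-1 * v1 x + x ord0 i ^+ 2 / Q x ^+ 2 * (v2 x - 2 * v1 x)).
    apply: is_derive_fun_eq h => //; rewrite eqxx mulr1n; field.
    by rewrite gt_eqF.
  apply: is_derive_near h'.
  have : nbhs x (punctured D).
    by apply: open_nbhs_nbhs; split; [exact: open_punctured|rewrite /punctured/= x0].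
  by apply: filterS => y /andP[y0 yD]; rewrite partial_minimiser.
by case.
Qed.

Local Notation u1 := (fun i => partial i u).
Local Notation u2 := (fun i j => partial i (partial j u)).

Lemma sum_sqr_coord_ratio x : x != 0 -> \sum_i x ord0 i ^+ 2 / Q x = 1.
Proof. by move=> x0; rewrite -mulr_suml mulfV// gt_eqF// sqnorm_gt0. Qed.

Lemma euler_minimiser x : x != 0 -> enorm x < D -> euler u1 x = v1 x.
Proof.
move=> x0 xD; rewrite -[RHS]mul1r -(sum_sqr_coord_ratio x0) mulr_suml.
by apply: eq_bigr => i _; rewrite partial_minimiser//; ring.
Qed.

Lemma grad_minimiser x : x != 0 -> enorm x < D -> Q x * grad_sqr u1 x = v1 x ^+ 2.
Proof.
move=> x0 xD; rewrite -[RHS]mul1r -(sum_sqr_coord_ratio x0) mulr_suml mulr_sumr.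
apply: eq_bigr => i _; rewrite partial_minimiser//; field.
by rewrite gt_eqF// sqnorm_gt0.
Qed.

Lemma laplacian_minimiser x : x != 0 -> enorm x < D ->
  scaled_laplacian u2 x = (N%:R - 2) * v1 x + v2 x.
Proof.
move=> x0 xD; have Q0 := sqnorm_gt0 x0.
transitivity (\sum_(i < N) v1 x + (\sum_i x ord0 i ^+ 2 / Q x) * (v2 x - 2 * v1 x)).
  rewrite /scaled_laplacian mulr_sumr mulr_suml -big_split/=.
  by apply: eq_bigr => i _; rewrite partial2_minimiser//; field; rewrite gt_eqF.
by rewrite sum_sqr_coord_ratio// sumr_const card_ord -mulr_natl; ring.
Qed.

Lemma ground_state_sqr x : x != 0 -> enorm x < D -> M x ^+ 2 * P x = 1.
Proof.
move=> x0 xD; have Pp := Pf_gt0 D0 k x0 xD.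
rewrite /ground_state -powR_mulrn ?powR_ge0// -powRrM.
rewrite (_ : - 2^-1 * 2%:R = -1); last by field.
by rewrite powR_inv1 ?(ltW Pp)// mulVf// gt_eqF.
Qed.

Let au : adm D K u.
Proof.
apply: (adm_continuous D compact_annulus _ minimiser_off_annulus).
by case: test_minimiser => su _ _; exact: smooth_continuous.
Qed.

Let adm_sub_tsupp f : adm D (tsupp u) f -> adm D K f.
Proof. by move=> [bf f0]; split => // x Kx; apply: f0 => /tsupp_minimiser. Qed.

Let au1 i : adm D K (partial i u).
Proof.
apply: adm_sub_tsupp.
exact: (adm_partial D test_minimiser).
Qed.

Let au2 i j : adm D K (partial i (partial j u)).
Proof.
apply: adm_sub_tsupp.
exact: (adm_partial2 D test_minimiser).
Qed.

Let psi0 t : R := bump01 t ^+ 2.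
Let psi1 t : R := b1 t ^+ 2.
Let psi2 t : R := b2 t ^+ 2.

Let continuous_sqr (f : R -> R) : continuous f -> continuous (fun t => f t ^+ 2).
Proof.
move=> cf t; apply: (@continuous_comp _ _ _ f (fun s : R => s ^+ 2)); first exact: cf.
exact: exprn_continuous.
Qed.

Let supp01_sqr (f : R -> R) : supp01 f -> supp01 (fun t => f t ^+ 2).
Proof. by move=> f0 t /f0 ->; rewrite expr0n. Qed.

Let aPhi0 : adm D K (Phi psi0). Proof. by apply: adm_Phi; [exact: continuous_sqr|exact: supp01_sqr]. Qed.
Let aPhi1 : adm D K (Phi psi1). Proof. by apply: adm_Phi; [exact: continuous_sqr|exact: supp01_sqr]. Qed.
Let aPhi2 : adm D K (Phi psi2). Proof. by apply: adm_Phi; [exact: continuous_sqr|exact: supp01_sqr]. Qed.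

Lemma wint_log_minimiser : wint p (fun x => u x ^+ 2 * P x ^+ 2) = wint p (Phi psi0).
Proof.
apply: (eq_wint annulus_weight_data) => //; last first.
  by apply: adm_mul; [exact: adm_sqr|apply: bc_exp; exact: bc_Pf].
move=> x x0 xD _; rewrite /minimiser /Phi !guardE// /v0 /profile.
have MP := ground_state_sqr x0 xD.
transitivity (rho x ^+ 2 * (M x ^+ 2 * P x) * P x * bump_at x ^+ 2); first by ring.
by rewrite MP mulr1.
Qed.

(** The function is radial, so its gradient has no tangential part. *)
Lemma wint_gap_minimiser :
  wint p (fun x => Q x * grad_sqr u1 x - euler u1 x ^+ 2) = 0.
Proof.
rewrite -(wint0 annulus_weight_data); apply: (eq_wint annulus_weight_data).
- by move=> x x0 xD _; rewrite grad_minimiser// euler_minimiser// subrr.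
- exact: adm_grad_radial_gap.
- by split => //; exact: bc_const.
Qed.

(** The factor [ground_state] cancels S/2, so only the derivative of the bump survives; it carries
    the factor 1/n. *)
Lemma wint_hardy_defect_minimiser :
  wint p (fun x => (euler_shift m u u1 x + 2^-1 * S x * u x) ^+ 2) =
  nr ^- 2 * wint p (Phi psi1).
Proof.
rewrite -(wint_scale annulus_weight_data)//.
apply: (eq_wint annulus_weight_data); last 2 first.
- apply: adm_sqr; apply: adm_add; first exact: adm_euler_shift.
  by apply: adm_mull => //; apply: bc_mul; [exact: bc_const|exact: bc_Sf].
- exact: adm_scale.
move=> x x0 xD _; have MP := ground_state_sqr x0 xD.
rewrite /euler_shift euler_minimiser// /minimiser /Phi !guardE// /v1 /v0 /profile1 /profile.
transitivity (rho x ^+ 2 * (M x ^+ 2 * P x) * P x * bump_at1 x ^+ 2); first by rewrite -/a; ring.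
by rewrite MP mulr1 /bump_at1 /psi1; field; rewrite gt_eqF.
Qed.

(** 2(1+m) = N-2-2a cancels the terms of first order and [kap] those of order zero, leaving the
    second derivative of the profile. *)
Lemma defect_minimiser x : x != 0 -> enorm x < D ->
  rellich_defect m u u1 u2 x = rho x * profile2 x.
Proof.
move=> x0 xD; rewrite /rellich_defect laplacian_minimiser// /euler_shift euler_minimiser//.
rewrite /minimiser guardE// /v2 /v1 /v0 -/a.
have aE : N%:R = 2 * a + 4 + 2 * m by rewrite /a; field.
by rewrite aE; field.
Qed.

Lemma P2f_le x : x != 0 -> enorm x < D -> 0 <= P2f x <= k%:R * Xf D 1 x ^+ 2.
Proof.
move=> x0 xD; apply/andP; split; first by apply: sumr_ge0 => j _; exact: sqr_ge0.
have -> : k%:R * Xf D 1 x ^+ 2 = \sum_(1 <= j < k.+1) Xf D 1 x ^+ 2.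
  by rewrite sumr_const_nat subn1 mulr_natl.
rewrite /P2f !big_nat; apply: ler_sum => j /andP[j1 _].
by apply: lerXn2r; rewrite ?nnegrE ?(ltW (Pf_gt0 _ _ _ _)) ?(ltW (Xf_gt0 _ _ _ _))// Pf_leX1.
Qed.

(** On the support [P2f] <= k X_1^2 <= k C P X_k and P <= X_k <= exp(-n), while M^2 = 1/P. Both
    parts of the second derivative thus gain exp(-n) over P, and its square exp(-2n). *)
Lemma wint_defect_minimiser_le (C : R) : 0 <= C ->
  (forall x, x != 0 -> enorm x < D -> Xf D 1 x ^+ 2 <= C * (P x * Xf D k x)) ->
  wint p (fun x => rellich_defect m u u1 u2 x ^+ 2) <=
  expR (- nr) ^+ 2 * (k%:R ^+ 2 * C ^+ 2 / 8) * wint p (Phi psi0)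
  + expR (- nr) ^+ 2 * (2 / nr ^+ 4) * wint p (Phi psi2).
Proof.
move=> C0 XC; have W := annulus_weight_data.
rewrite -!(wint_scale W)// -(wint_add W); [|exact: adm_scale|exact: adm_scale].
apply: (le_wint W); last 2 first.
- by apply: adm_sqr; exact: adm_rellich_defect.
- by apply: adm_add; exact: adm_scale.
move=> x x0 xD _; rewrite defect_minimiser//.
have MP := ground_state_sqr x0 xD; have Pp := Pf_gt0 D0 k x0 xD.
have rp : 0 <= rho x ^+ 2 by exact: sqr_ge0.
rewrite /Phi !guardE// /psi0 /psi2.
have [ax|ax] := boolP (0 <= ar x <= 1); last first.
  rewrite /profile2 /bump_at /bump_at2 sb0// sb2//.
  by rewrite !(mulr0, mul0r, oppr0, addr0, expr0n).
have /andP[ax0 ax1] := ax.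
have Xe := Xf_le_of_arg x0 xD ax0; have Xp := Xf_gt0 D0 k x0 xD.
have PX := Pf_leX D0 x0 xD k0.
set ee := expR (- nr) in Xe *.
have e0 : 0 < ee by exact: expR_gt0.
have /andP[P20 P2k] := P2f_le x0 xD.
set c0 := bump01 (ar x); set c2 := b2 (ar x).
have -> : (rho x * profile2 x) ^+ 2 =
   rho x ^+ 2 * (M x ^+ 2 * (P2f x * c0 / 4 - P x ^+ 2 * (c2 / nr ^+ 2)) ^+ 2).
  rewrite /profile2 /bump_at /bump_at2 -/c0 -/c2; field.
  by rewrite gt_eqF.
have -> : ee ^+ 2 * (k%:R ^+ 2 * C ^+ 2 / 8) * (rho x ^+ 2 * P x * c0 ^+ 2) +
    ee ^+ 2 * (2 / nr ^+ 4) * (rho x ^+ 2 * P x * c2 ^+ 2) =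
    rho x ^+ 2 * (ee ^+ 2 * (k%:R ^+ 2 * C ^+ 2 / 8) * P x * c0 ^+ 2 +
    2 * ee ^+ 2 * P x * (c2 / nr ^+ 2) ^+ 2).
  by field; rewrite gt_eqF.
rewrite ler_wpM2l//.
set c2n := c2 / nr ^+ 2.
have M2 : M x ^+ 2 = (P x)^-1.
  by apply: (@mulIf _ (P x)); rewrite ?gt_eqF// MP mulVf ?gt_eqF.
rewrite M2 mulrC ler_pdivrMr//.
have P2e : P2f x <= k%:R * C * P x * ee.
  apply: le_trans P2k _; rewrite -!mulrA ler_wpM2l//.
  apply: le_trans (XC x x0 xD) _; rewrite ler_wpM2l// ler_wpM2l//.
  exact: ltW.
have Pe : P x <= ee by exact: le_trans PX Xe.
have s1 : (P2f x * c0) ^+ 2 <= (k%:R * C * P x * ee * c0) ^+ 2.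
  rewrite [leLHS]exprMn [leRHS]exprMn ler_wpM2r ?sqr_ge0//.
  by rewrite ler_sqr ?nnegrE// (le_trans P20).
have s2 : (P x ^+ 2 * c2n) ^+ 2 <= (P x * ee * c2n) ^+ 2.
  rewrite [leLHS]exprMn [leRHS]exprMn ler_wpM2r ?sqr_ge0//.
  by rewrite ler_sqr ?nnegrE ?sqr_ge0 ?mulr_ge0 ?(ltW Pp) ?(ltW e0)// expr2 ler_wpM2l// ltW.
(* (y - z)^2 <= 2 y^2 + 2 z^2; this is the origin of 1/8 = 2/16 and of the factor 2 in the bound. *)
have s3 : (P2f x * c0 / 4 - P x ^+ 2 * c2n) ^+ 2 <=
    2 * ((P2f x * c0) ^+ 2 / 16) + 2 * (P x ^+ 2 * c2n) ^+ 2.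
  rewrite -subr_ge0.
  rewrite (_ : _ - _ = (P2f x * c0 / 4 + P x ^+ 2 * c2n) ^+ 2) ?sqr_ge0//; by field.
apply: le_trans s3 _.
have -> : (ee ^+ 2 * (k%:R ^+ 2 * C ^+ 2 / 8) * P x * c0 ^+ 2 + 2 * ee ^+ 2 * P x * c2n ^+ 2) * P x
  = 2 * ((k%:R * C * P x * ee * c0) ^+ 2 / 16) + 2 * (P x * ee * c2n) ^+ 2 by field.
by rewrite lerD// ler_wpM2l// ler_wpM2r// invr_ge0.
Qed.

(** On the support X_1 <= X_k <= exp(-n). Hence the same family is also minimising for the
    inequality without logarithmic terms. *)
Lemma wint_first_log_minimiser :
  wint p (fun x => u x ^+ 2 * Pf D 1 x ^+ 2) <= expR (- nr) ^+ 2 * wint p (fun x => u x ^+ 2).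
Proof.
have W := annulus_weight_data; have au' := adm_sqr au.
rewrite -(wint_scale W)//; apply: (le_wint W); last 2 first.
- by apply: adm_mul => //; apply: bc_exp; exact: bc_Pf.
- exact: adm_scale.
move=> x x0 xD _; rewrite mulrC.
have [ax|ax] := boolP (0 <= ar x <= 1); last first.
  by rewrite /minimiser guardE// /v0 /profile /bump_at sb0// !mulr0 expr0n !mulr0.
have /andP[ax0 ax1] := ax; apply: ler_wpM2r; first exact: sqr_ge0.
have Pp := Pf_gt0 D0 1 x0 xD.
apply: lerXn2r; rewrite ?nnegrE ?(ltW Pp) ?expR_ge0//.
apply: le_trans (Xf_le_of_arg x0 xD ax0).
by apply: le_trans (Pf_leX D0 x0 xD _) (Xf_le D0 x0 xD _).
Qed.

End minimising_family.

(** * Near-minimisers supported in the domain *)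

Section sharpness.
Context {R : realType} (N : nat) (hN : (5 <= N)%N) (m : R) (hm0 : 0 <= m)
  (hm : m < (N%:R - 4) / 2) (Omega : set 'rV[R]_N) (hopen : open Omega)
  (hbnd : bounded_set Omega) (h0 : Omega 0)
  (D : R) (hD : sup [set enorm x | x in Omega] <= D).
Set Implicit Arguments. Unset Strict Implicit.
Local Notation p := (2 * m + 4).
Local Notation kap := ((N%:R + 2 * m) * (N%:R - 4 - 2 * m) / 4).
Local Notation A := ((1 + m) ^+ 2 + (N%:R + 2 * m) * (N%:R - 4 - 2 * m) / 8).

Lemma ball_sub_domain : exists2 d : R, 0 < d & forall x : 'rV[R]_N, enorm x < d -> Omega x.
Proof.
have /nbhs_ballP[d /= d0 bd] : nbhs (0 : 'rV[R]_N) Omega by exact: open_nbhs_nbhs.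
exists d => // x xd; apply: bd; rewrite -ball_normE/= sub0r normrN.
exact: le_lt_trans (norm_le_enorm x) xd.
Qed.

(** The first estimate says that the remainders are small against the k-th logarithmic term and
    gives the sharpness of A; together with the second, at k = 1, it gives the sharpness of
    kap^2. *)
Lemma exists_near_minimiser k (e : R) : (0 < k)%N -> 0 < e ->
  exists2 u : 'rV[R]_N -> R, test_function Omega u /\ u <> cst 0 &
    wint p (fun x => scaled_laplacian (fun i j => partial i (partial j u)) x ^+ 2) <=
      kap ^+ 2 * wint p (fun x => u x ^+ 2)
      + A * \sum_(1 <= j < k.+1) wint p (fun x => u x ^+ 2 * Pf D j x ^+ 2)
      + e * wint p (fun x => u x ^+ 2 * Pf D k x ^+ 2)
    /\ wint p (fun x => u x ^+ 2 * Pf D 1 x ^+ 2) <= e * wint p (fun x => u x ^+ 2).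
Proof.
move=> k0 e0.
have D0 := radius_gt0 hN hopen hbnd h0 hD.
have A0 := A_gt0 hN hm0 hm.
have pN := exponent_lt_dim hm.
have p0 : 0 < p by have := hm0; lra.
have N2 : (2 <= N)%N by exact: leq_trans hN.
have [b1 [b2 [db0 db1 cb2 sb1 sb2]]] := @bump01_derivatives R.
have cb0 : continuous (@bump01 R) by move=> t; exact: is_derive_continuous (db0 t).
have cb1 : continuous b1 by move=> t; exact: is_derive_continuous (db1 t).
have sb0 : supp01 (@bump01 R).
  by move=> t t01; apply: bump01_eq0; apply: contra t01 => /andP[/ltW-> /ltW->].
have csq (f : R -> R) : continuous f -> continuous (fun t => f t ^+ 2).
  move=> cf t; apply: (@continuous_comp _ _ _ f (fun s : R => s ^+ 2)); first exact: cf.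
  exact: exprn_continuous.
have ssq (f : R -> R) : supp01 f -> supp01 (fun t => f t ^+ 2).
  by move=> f0 t /f0 ->; rewrite expr0n.
have I0 : \int[lebesgue_measure]_(t in `[-1, 1]) (bump01 t ^+ 2 : R) != 0.
  by rewrite gt_eqF// bump_sqr_integral_gt0.
(* [c1] and [c2] depend on the bump alone, so [n] can be chosen after them. *)
have [c1 [G1 [dG1 G10]]] :=
  supp01_primitive (csq _ cb0) (csq _ cb1) (ssq _ sb0) (ssq _ sb1) I0.
have [c2 [G2 [dG2 G20]]] :=
  supp01_primitive (csq _ cb0) (csq _ cb2) (ssq _ sb0) (ssq _ sb2) I0.
have [C [C0 XC]] := sqr_X1_le N D0 k0.
have [d d0 dO] := ball_sub_domain.
(* The remainders are at most B/n times the k-th term: the first two summands come from the Rellich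
   defect, the last one from the Hardy defect. *)
pose B : R := k%:R ^+ 2 * C ^+ 2 / 8 + 2 * `|c2| + 4 * A * `|c1|.
have B0 : 0 <= B.
  by rewrite /B !addr_ge0 ?mulr_ge0 ?sqr_ge0 ?invr_ge0 ?(ltW A0).
(* One summand for each demand on [n]: n >= 1, B/n <= e, 1/n <= e, and D exp(-n) < d, which puts the
   annulus inside [Omega]. *)
pose b := 1 + B / e + e^-1 + D / d.
have b0 : 0 <= b by rewrite /b !addr_ge0 ?divr_ge0 ?invr_ge0 ?(ltW e0) ?(ltW D0) ?(ltW d0).
pose n := Num.bound b; have bn : b < n%:R by exact: archi_boundP.
pose nr : R := n%:R.
have be0 : 0 <= B / e by rewrite divr_ge0 ?(ltW e0).
have ie0 : 0 < e^-1 by rewrite invr_gt0.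
have Dd0 : 0 < D / d by rewrite divr_gt0.
have n1 : 1 <= nr by move: bn; rewrite /b /nr; lra.
have nr0 : 0 < nr by exact: lt_le_trans n1.
have n0 : (0 < n)%N by rewrite -(ltr0n R).
have Bn : B * nr^-1 <= e.
  rewrite ler_pdivrMr// mulrC -ler_pdivrMr//; move: bn; rewrite /b /nr; lra.
have en : nr^-1 <= e.
  rewrite -[leRHS]invrK lef_pV2 ?posrE ?invr_gt0//; move: bn; rewrite /b /nr; lra.
have En : expR (- nr) <= nr^-1.
  rewrite expRN lef_pV2 ?posrE ?expR_gt0//.
  by apply: le_trans (expR_ge1Dx nr); rewrite lerDr.
have in1 : nr^-1 <= 1 by rewrite invf_le1.
have in0 : 0 < nr^-1 by rewrite invr_gt0.
have E2 : expR (- nr) ^+ 2 <= nr^-1.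
  apply: le_trans (_ : expR (- nr) * 1 <= _); last by rewrite mulr1.
  by rewrite expr2 ler_wpM2l ?expR_ge0// (le_trans En).
have [r hr] := annulus_radius_exists N k n D0.
have KO : annulus D n r `<=` Omega.
  move=> x /andP[_ xD]; apply: dO; apply: le_lt_trans xD _.
  rewrite mulrC -ltr_pdivlMr//; apply: le_lt_trans En _.
  rewrite -[ltRHS]invf_div ltf_pV2 ?posrE//; move: bn; rewrite /b /nr; lra.
have tu : test_function Omega (minimiser m D k n) by exact: (test_minimiser m D0 n0 hr KO).
have u0 := @minimiser_neq0 _ N m D k n D0 n0 N2.
exists (minimiser m D k n); first by split.
set u := minimiser m D k n in tu u0 *.
split; last first.
  apply: le_trans (wint_first_log_minimiser D0 k0 n0 hr p0 pN KO) _.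
  rewrite ler_wpM2r ?(le_trans E2)//.
  by apply: wint_ge0 => x; exact: sqr_ge0.
rewrite (wint_rellich hN hm0 hm hopen hbnd h0 hD tu k) lerD2l.
have gap := wint_gap_minimiser D0 n0 db0 hr p0 pN KO.
have hdf := wint_hardy_defect_minimiser D0 n0 db0 db1 sb1 hr p0 pN KO.
have zdf := wint_defect_minimiser_le D0 k0 n0 db0 db1 cb2 sb2 hr p0 pN KO C0 XC.
have lg := wint_log_minimiser D0 n0 db0 hr p0 pN KO.
have w1 := wint_Phi_proportional D0 n0 hr N2 p0 pN (csq _ cb0) (csq _ cb1) (ssq _ sb0) (ssq _ sb1) dG1 G10.
have w2 := wint_Phi_proportional D0 n0 hr N2 p0 pN (csq _ cb0) (csq _ cb2) (ssq _ sb0) (ssq _ sb2) dG2 G20.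
rewrite gap hdf lg w1 mulr0 addr0.
rewrite w2 in zdf.
set I := wint p (Phi _ _ _ _ _) in zdf w1 w2 lg *.
have I0' : 0 <= I.
  by rewrite -lg; apply: wint_ge0 => x; rewrite mulr_ge0 ?sqr_ge0.
apply: le_trans (lerD zdf (lexx _)) _.
apply: le_trans (_ : B * nr^-1 * I <= _); last by rewrite ler_wpM2r.
rewrite -/nr.
have -> : expR (- nr) ^+ 2 * (k%:R ^+ 2 * C ^+ 2 / 8) * I +
    expR (- nr) ^+ 2 * (2 / nr ^+ 4) * (c2 * I) + 4 * A * (nr ^- 2 * (c1 * I)) =
    (expR (- nr) ^+ 2 * (k%:R ^+ 2 * C ^+ 2 / 8) + expR (- nr) ^+ 2 * nr ^- 4 * (2 * c2)
     + nr ^- 2 * (4 * A * c1)) * I by ring.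
have q2 : nr ^- 2 <= nr^-1 by rewrite -exprVn expr2 ler_piMr// ltW.
have q4 : nr ^- 4 <= 1 by rewrite -exprVn exprn_ile1 ?(ltW in0).
have E4 : expR (- nr) ^+ 2 * nr ^- 4 <= nr^-1.
  by apply: le_trans E2; rewrite ler_piMr ?sqr_ge0.
have -> : B * nr^-1 = nr^-1 * (k%:R ^+ 2 * C ^+ 2 / 8) + nr^-1 * (2 * `|c2|)
    + nr^-1 * (4 * A * `|c1|) by rewrite /B; ring.
rewrite ler_wpM2r// lerD ?lerD//.
- by rewrite ler_wpM2r// !mulr_ge0 ?sqr_ge0 ?invr_ge0.
- apply: le_trans (_ : expR (- nr) ^+ 2 * nr ^- 4 * (2 * `|c2|) <= _).
    by rewrite ler_wpM2l ?ler_wpM2l ?ler_norm// mulr_ge0 ?sqr_ge0 ?invr_ge0 ?exprn_ge0 ?(ltW nr0).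
  by rewrite ler_wpM2r// mulr_ge0.
- apply: le_trans (_ : nr ^- 2 * (4 * A * `|c1|) <= _).
    by rewrite ler_wpM2l ?invr_ge0 ?sqr_ge0// ler_wpM2l ?ler_norm// mulr_ge0 ?(ltW A0).
  by rewrite ler_wpM2r// !mulr_ge0 ?(ltW A0).
Qed.
End sharpness.

(** * The series inequality and the two best constants *)

Theorem theorem1p6 (R : realType) (N : nat) (hN : (5 <= N)%N)
    (m : R) (hm0 : 0 <= m) (hm : m < (N%:R - 4) / 2)
    (Omega : set 'rV[R]_N) (hopen : open Omega) (hconn : connected Omega)
    (hbnd : bounded_set Omega) (h0 : Omega 0)
    (D : R) (hD : sup [set enorm x | x in Omega] <= D) :
  let A := (1 + m) ^+ 2 + (N%:R + 2 * m) * (N%:R - 4 - 2 * m) / 8 in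
  let C := ((N%:R + 2 * m) * (N%:R - 4 - 2 * m) / 4) ^+ 2 in
  [/\ forall u : 'rV[R]_N -> R, test_function Omega u ->
        (rellich_int m Omega u >=
           C%:E * hardy_int m Omega u +
           A%:E * \sum_(1 <= i <oo) hardy_log_int m D i Omega u)%E,
      (let S := [set c : R | forall u : 'rV[R]_N -> R, test_function Omega u ->
                  (rellich_int m Omega u >= c%:E * hardy_int m Omega u)%E] in
       S C /\ forall c, S c -> c <= C) &
      forall k : nat, (1 <= k)%N ->
        A%:E = ereal_inf
          [set ((rellich_int m Omega u - C%:E * hardy_int m Omega u -
                 A%:E * \sum_(1 <= i < k) hardy_log_int m D i Omega u) /
                hardy_log_int m D k Omega u)%E
          | u in [set u : 'rV[R]_N -> R | test_function Omega u /\ u <> cst 0]]].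
Proof.
move=> A C.
have A0 : 0 < A := A_gt0 hN hm0 hm.
pose p := 2 * m + 4.
pose wR u := wint p (fun x => scaled_laplacian (fun i j : 'I_N => partial i (partial j u)) x ^+ 2).
pose wH (u : 'rV[R]_N -> R) := wint p (fun x => u x ^+ 2).
pose wL k (u : 'rV[R]_N -> R) := wint p (fun x => u x ^+ 2 * Pf D k x ^+ 2).
have rE u (tu : test_function Omega u) : rellich_int m Omega u = (wR u)%:E.
  exact: (rellich_intE hN hm0 hm hopen hbnd h0 hD tu).
have hE u (tu : test_function Omega u) : hardy_int m Omega u = (wH u)%:E.
  exact: (hardy_intE hN hm0 hm hopen hbnd h0 hD tu).
have lE u (tu : test_function Omega u) i : hardy_log_int m D i Omega u = (wL i u)%:E.
  exact: (hardy_log_intE hN hm0 hm hopen hbnd h0 hD tu).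
have sE u (tu : test_function Omega u) n :
    (\sum_(1 <= i < n) hardy_log_int m D i Omega u = (\sum_(1 <= i < n) wL i u)%:E)%E.
  by rewrite -sumEFin; apply: eq_bigr => i _; exact: lE.
have ge u (tu : test_function Omega u) n : C * wH u + A * \sum_(1 <= j < n.+1) wL j u <= wR u.
  exact: (wint_rellich_ge hN hm0 hm hopen hbnd h0 hD tu n).
have wL0 u i : 0 <= wL i u by apply: wint_ge0 => x; rewrite mulr_ge0 ?sqr_ge0.
have wL_gt0 u (tu : test_function Omega u) (u0 : u <> cst 0) i : 0 < wL i u.
  exact: (wint_log_gt0 hN hm0 hm hopen hbnd h0 hD tu).
have wHE u : wL 0 u = wH u.
  by rewrite /wL /wH; congr wint; apply/funext => x; rewrite Pf0 expr1n mulr1.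
have ge0 u (tu : test_function Omega u) : C * wH u <= wR u.
  by have := ge u tu 0; rewrite big_geq// mulr0 addr0.
split.
- move=> u tu; rewrite rE// hE//.
  set L := (\sum_(1 <= i <oo) _)%E.
  (* All partial sums have the same bound, which passes to the limit and shows that the series is
     finite. *)
  have LB : (L <= ((wR u - C * wH u) / A)%:E)%E.
    apply: lime_le.
      by apply: is_cvg_nneseries => i _ _; rewrite lE// lee_fin.
    apply: nearW => n; rewrite sE// lee_fin ler_pdivlMr// mulrC lerBrDl.
    (* The range [1 <= i < n] is covered by [ge] only when [n] is a successor; at [n = 0] the sum is
       empty. *)
    case: n => [|n]; last exact: ge.
    by rewrite big_geq// mulr0 addr0; exact: ge0.
  have AL : (A%:E * L <= (wR u - C * wH u)%:E)%E.
    apply: le_trans (lee_wpmul2l _ LB) _; first by rewrite lee_fin ltW.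
    by rewrite -EFinM lee_fin mulrC divfK// gt_eqF.
  rewrite -EFinM; apply: le_trans (leeD2l _ AL) _.
  by rewrite -EFinD lee_fin; lra.
- split=> [u tu|c Sc].
    by rewrite rE// hE// -EFinM lee_fin ge0.
  apply/ler_addgt0Pr => e e0.
  have e'0 : 0 < e / (A + 1) by rewrite divr_gt0// addr_gt0.
  (* With k = 1 the excess of [wR u] over [C * wH u] is at most (A + d) [wL 1 u], hence at most (A +
     d) d [wH u]; this [d] makes (A + d) d <= e. *)
  pose d := Num.min (e / (A + 1)) 1.
  have d0 : 0 < d by rewrite lt_min e'0 ltr01.
  have de : (A + d) * d <= e.
    apply: le_trans (_ : (A + 1) * d <= _).
      by rewrite ler_wpM2r ?(ltW d0)// lerD2l /d ge_min lexx orbT.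
    rewrite mulrC -ler_pdivlMr; last by rewrite addr_gt0.
    by rewrite /d ge_min lexx.
  have [u [tu u0] [Ru Lu]] := exists_near_minimiser hN hm0 hm hopen hbnd h0 hD (ltn0Sn 0) d0.
  have H0 : 0 < wH u by rewrite -wHE; exact: wL_gt0.
  rewrite -(ler_pM2r H0); have := Sc u tu; rewrite rE// hE// -EFinM lee_fin => /le_trans; apply.
  rewrite big_nat1 -/(wR u) -/(wH u) -/(wL 1 u) -/A -/C in Ru; rewrite -/(wH u) -/(wL 1 u) in Lu.
  have h1 : (A + d) * wL 1 u <= (A + d) * (d * wH u) by rewrite ler_wpM2l// addr_ge0 ?ltW.
  have h2 : (A + d) * d * wH u <= e * wH u by rewrite ler_wpM2r// ltW.
  apply: le_trans Ru _; move: h1 h2; lra.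
- move=> k k1.
  have numE u (tu : test_function Omega u) (u0 : u <> cst 0) :
      ((rellich_int m Omega u - C%:E * hardy_int m Omega u -
                 A%:E * \sum_(1 <= i < k) hardy_log_int m D i Omega u) /
                hardy_log_int m D k Omega u)%E =
      ((wR u - C * wH u - A * \sum_(1 <= i < k) wL i u) / wL k u)%:E.
    (* The denominator is positive because [u] is not identically 0, so the extended real quotient
       is that of the real numbers. *)
    rewrite rE// hE// lE// sE// -!EFinM -!EFinB inver gt_eqF ?wL_gt0//.
  have sumS u : \sum_(1 <= i < k.+1) wL i u = \sum_(1 <= i < k) wL i u + wL k u.
    by rewrite big_nat_recr.
  apply/eqP; rewrite eq_le; apply/andP; split.
    apply: le_ereal_inf_tmp => _ [u [tu u0] <-].
    rewrite numE// lee_fin ler_pdivlMr ?wL_gt0//.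
    by have := ge u tu k; rewrite sumS; lra.
  apply/lee_addgt0Pr => e e0.
  have [u [tu u0] [Ru _]] := exists_near_minimiser hN hm0 hm hopen hbnd h0 hD k1 e0.
  apply: (@le_trans _ _ ((wR u - C * wH u - A * \sum_(1 <= i < k) wL i u) / wL k u)%:E).
    by apply: ereal_inf_lbound; exists u => //; rewrite numE.
  rewrite -EFinD lee_fin ler_pdivrMr ?wL_gt0//.
  have {}Ru : wR u <= C * wH u + A * (\sum_(1 <= i < k) wL i u + wL k u) + e * wL k u.
    by rewrite -sumS.
  by move: Ru; lra.
Qed.
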